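(* Let $(k_{s,t})_{(s,t)\in\Delta}$ be a family of transition kernels of a branching process on $[0,\infty]$. Then there exists a unique map $(s,x)\mapsto\mathbb{Q}^{(s,x)}$, assigning to each $s\ge0$ and $x\in[0,\infty]$ a probability measure $\mathbb{Q}^{(s,x)}$ on the measurable space $(D[0,\infty),\mathcal{G}_{[s,\infty)})$, such that $\big((X^{c}_t)_{t\ge0},D[0,\infty),\mathcal{G},(\mathcal{G}_I)_I,(\mathbb{Q}^{(s,x)})_{s\ge0,x\in[0,\infty]}\big)$ is a Markov family on $[0,\infty]$ (i.e. a branching process) with transition kernels $(k_{s,t})$.
   Context: $\Delta=\{(s,t):0\le s\le t<\infty\}$. Transition kernels and their composition $(k\star l)(x,B)=\int l(y,B)k(x,\mathrm dy)$ are as usual. A family of transition kernels of a branching process is a family $(k_{s,t})_{(s,t)\in\Delta}$ of transition kernels on the compact space $[0,\infty]$ satisfying: (K1) $k_{s,s}(x,\cdot)=\delta_x$; (K2) $k_{s,t}\star k_{t,u}=k_{s,u}$ for $s\le t\le u$; (K3) $\Delta\times[0,\infty)\ni(s,t,x)\mapsto k_{s,t}(x,\cdot)$ is weakly continuous into probability measures on $[0,\infty]$; (K4) $k_{s,t}(x,\cdot)\ast k_{s,t}(y,\cdot)=k_{s,t}(x+y,\cdot)$ for $x,y\in[0,\infty)$; (K5) $k_{s,t}(0,\cdot)=\delta_0$; (K6) $k_{s,t}(\infty,\cdot)=\delta_\infty$. A Markov family on $S$ with transition kernels $(k_{s,t})$ (satisfying K1, K2) is a process $(Z_t)_{t\ge0}$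 on a measurable space $(\Omega,\mathcal F)$ with sub-$\sigma$-fields $\mathcal F_I$ for each closed interval $I\subset[0,\infty)$ such that $I\subseteq J\Rightarrow\mathcal F_I\subseteq\mathcal F_J$, $Z_t$ is $\mathcal F_I$-measurable whenever $t\in I$, together with probability measures $\mathbb P^{(s,x)}$ on $(\Omega,\mathcal F_{[s,\infty)})$ ($s\ge0$, $x\in S$) with $\mathbb P^{(s,x)}[Z_s=x]=1$ and $\mathbb E^{(s,x)}[f(Z_u)\mid\mathcal F_{[s,t]}]=\int_S f(y)k_{t,u}(Z_t,\mathrm dy)$ $\mathbb P^{(s,x)}$-a.s. for all $0\le s\le t\le u$, $x\in S$ and bounded Borel $f$. For $s\ge0$, $D[s,\infty)$ is the set of càdlàg functions $\omega:[s,\infty)\to[0,\infty]$ such that if $r:=\omega(t)\in\{0,\infty\}$ for some $t\ge s$, or $r:=\omega(t-)\in\{0,\infty\}$ for some $t>s$, then $\omega(u)=r$ for all $u\ge t$. $X^c_t(\omega)=\omega(t)$ is the coordinate process on $D[0,\infty)$, $\mathcal G_I=\sigma(X^c_t:t\in I)$ for closed intervals $I$, and $\mathcal G=\mathcal G_{[0,\infty)}$. *)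

(* Defs.v *)
From HB Require Import structures.
From mathcomp Require Import all_boot all_order all_algebra.
From mathcomp Require Import all_classical all_reals all_analysis measurable_realfun.
Set Implicit Arguments.
Unset Strict Implicit.
Unset Printing Implicit Defensive.
Import Order.TTheory GRing.Theory Num.Theory.
Import numFieldNormedType.Exports.
Local Open Scope classical_set_scope.
Local Open Scope ring_scope.
Local Open Scope ereal_scope.

Section Defs.
Variable R : realType.

(** The path space D[0,oo): cadlag functions [0,oo) -> [0,oo] (order/compact
    topology of the extended reals) for which 0 and +oo are absorbing, both
    for values and for left limits.  Paths are encoded as functions on R,
    normalised by w t = w 0 for t < 0 (so that they are determined by their
    restriction to [0,oo)). *)
Definition is_Dpath (w : R -> \bar R) : Prop :=
  (forall t : R, (t < 0)%R -> w t = w 0%R) /\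
  (forall t : R, (0 <= t)%R -> 0 <= w t) /\
  (forall t : R, (0 <= t)%R -> w @ at_right t --> w t) /\
  (forall t : R, (0 < t)%R -> cvg (w @ at_left t)) /\
      (forall t : R, (0 <= t)%R -> (w t = 0 \/ w t = +oo) ->
          forall u : R, (t <= u)%R -> w u = w t) /\
      (forall t : R, (0 < t)%R ->
          (lim (w @ at_left t) = 0 \/ lim (w @ at_left t) = +oo) ->
          forall u : R, (t <= u)%R -> w u = lim (w @ at_left t)).

Record Dpath := MkDpath { dval :> R -> \bar R ; dvalP : is_Dpath dval }.

Lemma is_Dpath0 : is_Dpath (fun _ => 0).
Proof.
split; first by [].
split; first by [].
split; first by move=> t _; exact: cvg_cst.
split; first by move=> t _; apply/cvg_ex; exists 0; exact: cvg_cst.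
split; first by [].
by move=> t _ _ u _; rewrite lim_cst.
Qed.

HB.instance Definition _ := gen_eqMixin Dpath.
HB.instance Definition _ := gen_choiceMixin Dpath.
HB.instance Definition _ := isPointed.Build Dpath (MkDpath is_Dpath0).

Definition Xc (t : R) (w : Dpath) : \bar R := dval w t.

Definition Ggen (I : set R) : set (set Dpath) :=
  [set A | exists t, I t /\ exists B : set (\bar R),
      measurable B /\ A = Xc t @^-1` B].

Definition G_ (I : set R) : set (set Dpath) := <<s Ggen I >>.

Definition Omega (s : R) := g_sigma_algebraType (Ggen `[s, +oo[%classic).

Definition closed_interval (I : set R) : Prop :=
  exists a : R, (0 <= a)%R /\
    (I = `[a, +oo[%classic \/ exists b : R, (a <= b)%R /\ I = `[a, b]%classic).

Definition is_cond_exp (I : set R) (s : R) (P : probability (Omega s) R)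
    (X Y : Dpath -> \bar R) : Prop :=
  measurable_fun (setT : set (g_sigma_algebraType (Ggen I))) Y /\
  forall A : set Dpath, G_ I A ->
    \int[P]_(w in (A : set (Omega s))) X w = \int[P]_(w in (A : set (Omega s))) Y w.

Definition markov_family
    (k : R -> R -> R.-pker (\bar R) ~> (\bar R))
    (Q : forall s : R, \bar R -> probability (Omega s) R) : Prop :=
  [/\ (forall I J, closed_interval I -> closed_interval J -> I `<=` J ->
         G_ I `<=` G_ J),
      (forall I t, closed_interval I -> I t ->
         measurable_fun (setT : set (g_sigma_algebraType (Ggen I))) (Xc t)),
      (forall (s : R) (x : \bar R), (0 <= s)%R -> 0 <= x ->
         Q s x [set w : Omega s | Xc s w = x] = 1) &
      (forall (s t u : R) (x : \bar R) (f : \bar R -> R),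
         (0 <= s)%R -> (s <= t)%R -> (t <= u)%R -> 0 <= x ->
         measurable_fun setT f -> (exists M : R, forall y, (`|f y| <= M)%R) ->
         is_cond_exp `[s, t]%classic (Q s x)
           (fun w => (f (Xc u w))%:E)
           (fun w => \int[k t u (Xc t w)]_y (f y)%:E))].

Definition conv (mu nu : set (\bar R) -> \bar R) (B : set (\bar R)) : \bar R :=
  \int[mu]_a \int[nu]_b (\1_B (a + b))%:E.

Definition DeltaX : set (R * R * R) :=
  [set p | (0 <= p.1.1)%R /\ (p.1.1 <= p.1.2)%R /\ (0 <= p.2)%R].

Definition branching_kernels (k : R -> R -> R.-pker (\bar R) ~> (\bar R)) : Prop :=
      (forall (s t : R) (x : \bar R), (0 <= s)%R -> (s <= t)%R -> 0 <= x ->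
         k s t x [set y | y < 0] = 0) /\
      (forall (s : R) (x : \bar R) B, (0 <= s)%R -> 0 <= x -> measurable B ->
         k s s x B = \d_x B) /\
      (forall (s t u : R) (x : \bar R) B, (0 <= s)%R -> (s <= t)%R -> (t <= u)%R ->
         0 <= x -> measurable B ->
         k s u x B = \int[k s t x]_y k t u y B) /\
      (forall f : \bar R -> R, {within [set y : \bar R | 0 <= y], continuous f} ->
         {within DeltaX, continuous (fun p : R * R * R =>
            \int[k p.1.1 p.1.2 (p.2)%:E]_(y in [set y : \bar R | 0 <= y]) (f y)%:E)}) /\
      (forall (s t x y : R) B, (0 <= s)%R -> (s <= t)%R -> (0 <= x)%R -> (0 <= y)%R ->
         measurable B ->
         conv (k s t x%:E) (k s t y%:E) B = k s t (x + y)%:E B) /\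
      (forall (s t : R) B, (0 <= s)%R -> (s <= t)%R -> measurable B ->
         k s t 0 B = \d_(0 : \bar R) B) /\
      (forall (s t : R) B, (0 <= s)%R -> (s <= t)%R -> measurable B ->
         k s t +oo B = \d_(+oo : \bar R) B).

End Defs.

(* Main.v *)
Require Import Defs.
From HB Require Import structures.
From mathcomp Require Import all_boot all_order all_algebra.
From mathcomp Require Import all_classical all_reals all_analysis measurable_realfun giry.
From mathcomp Require Import lra.
Set Implicit Arguments.
Unset Strict Implicit.
Unset Printing Implicit Defensive.
Import Order.TTheory GRing.Theory Num.Theory.
Import numFieldNormedType.Exports.
Local Open Scope classical_set_scope.
Local Open Scope ring_scope.
Local Open Scope ereal_scope.

(* Uniqueness: the Markov property and the initial law determine all finite
   dimensional distributions, which generate the sigma-algebra of the path space.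

   Existence: Kolmogorov extension is only needed for the rational times
   [s + q], where the events {Z_q > r} form a countable family, so that the
   process can be coded into a sequence of bits, realized on the unit interval.
   Write [L a b y] for the integral of exp(-z) against k_{a,b}(y, dz).  By the
   branching property [L a b] is multiplicative on [0, oo), hence strictly
   decreasing on [0, oo], and by Chapman-Kolmogorov q |-> L (s + q) T Z_q is a
   bounded martingale.  Dubins' inequality bounds its upcrossings; it follows
   that almost surely Z has one-sided limits along the rationals.  The same
   inequality, for the martingale and for 1 minus it, shows that a path which
   approaches oo or 0 never leaves it.  The right limits of Z thus lie in the
   path space; as y |-> k_{a,b}(y, .) is Feller on [0, oo], jointly in the times
   a and b, the Markov property passes to them. *)

(** * Kernels and chains observed at finitely many times *)

(** Two facts are not among the axioms and carry the analytic weight. The strict monotonicity of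
    [L a b] reduces to [L a b 1 < 1], which is forced by continuity in time together with
    Chapman-Kolmogorov. Continuity in the state is assumed on [0, oo) only; at oo it is recovered
    from the decay of [L a b n] in n and the continuity of [L] in the times, by comparing test
    functions with affine functions of exp(-z). Strict monotonicity turns oscillations of Z into
    crossings of the martingale; that [L] takes the value 0 only at oo and the value 1 only at 0 is
    what makes these two points absorbing for the limit. The rational process Z and its right limits
    are never compared path by path, not even at rational times: a right limit may differ from Z at
    the same time. The law of the right limits, including the starting point, is obtained by
    dominated convergence along rational times decreasing to the given ones, tested on nonnegative
    continuous functions. *)

Section kernel_restriction.
Context d (T : measurableType d) (R : realType).
Variables (k : R.-pker T ~> T) (A : set T) (mA : measurable A).

Definition kres (y : T) : set T -> \bar R := mrestr (k y) mA.

HB.instance Definition _ y := Measure.on (kres y).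

Let kres_setT y : kres y setT <= 1.
Proof.
rewrite /kres /mrestr setTI -(@prob_kernel _ _ _ _ _ k y).
by apply: le_measure; rewrite ?inE.
Qed.

HB.instance Definition _ y :=
  Measure_isSubProbability.Build _ _ _ (kres y) (kres_setT y).

(** Seen as a map into the Giry space, a kernel composes by [giry_bind], and iterated integrals
    follow from the monad laws. Restriction to [A] loses mass, hence subprobability measures. *)
Definition kgiry (y : T) : giry T R := kres y.

Lemma kgiryE y B : kgiry y B = k y (B `&` A).
Proof. by []. Qed.

Lemma measurable_kgiry : measurable_fun setT kgiry.
Proof.
apply: measurable_giry_codensity => // B mB.
exact: (measurable_kernel k _ (measurableI _ _ mB mA)).
Qed.

End kernel_restriction.

Lemma giry_bindE d1 d2 (T1 : measurableType d1) (T2 : measurableType d2)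
  (R : realType) (mu : giry T1 R) (f : T1 -> giry T2 R)
  (mf : measurable_fun setT f) (B : set T2) :
  measurable B -> giry_bind mu mf B = \int[mu]_y f y B.
Proof.
move=> mB; have mi : measurable_fun [set: T2] (fun x => (\1_B x)%:E : \bar R).
  exact/measurable_EFinP/measurable_indic.
have := @giry_int_bind _ _ _ _ _ mu f mf _ mi _.
rewrite /giry_int integral_indic// setIT => -> //.
by apply: eq_integral => y _; rewrite integral_indic// setIT.
Qed.

Lemma integral_giryD d (T : measurableType d) (R : realType)
    (mu1 mu2 mu : giry T R) (f : T -> \bar R) :
  (forall B, measurable B -> mu1 B + mu2 B = mu B) ->
  measurable_fun setT f -> (forall x, 0 <= f x) ->
  \int[mu1]_x f x + \int[mu2]_x f x = \int[mu]_x f x.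
Proof.
move=> H mf f0; rewrite -ge0_integral_measure_add//.
by apply: eq_measure_integral => B mB _; rewrite [LHS]measure_addE; exact: H.
Qed.

Lemma giry_splitC d (T : measurableType d) (R : realType) (mu : giry T R)
    (A B : set T) : measurable A -> measurable B ->
  mu (B `&` A) + mu (B `&` ~` A) = mu B.
Proof.
move=> mA mB; rewrite -measureU; first by rewrite -setIUr setUv setIT.
- exact: measurableI.
- by apply: measurableI => //; exact: measurableC.
- by rewrite setIACA setICr setI0.
Qed.

Section chain.
Context d (T : measurableType d) (R : realType).
Variables (p : R -> R -> R.-pker T ~> T) (s : R) (x0 : T).
Hypothesis CK : forall a b c x B, (s <= a)%R -> (a <= b)%R -> (b <= c)%R ->
  measurable B -> p a c x B = \int[p a b x]_y p b c y B.
Hypothesis p_id : forall a x B, (s <= a)%R -> measurable B ->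
  p a a x B = \d_x B.
Variables (e : nat -> R) (A : nat -> set T).
Hypothesis e_ge : forall i, (s <= e i)%R.
Hypothesis mA : forall i, measurable (A i).

Implicit Types (l : seq (nat * bool)) (c : nat * bool) (B : set T).

Definition cset c : set T := if c.2 then A c.1 else ~` A c.1.

Lemma measurable_cset c : measurable (cset c).
Proof.
by case: c => i [] /=; rewrite /cset /=; [|apply: measurableC]; exact: mA.
Qed.

(* A list of constraints [c] stands for the event "the chain is in [cset c] at
   time [e c.1]"; lists are kept sorted, the latest time first. *)
Definition ltime l : R := if l is c :: _ then e c.1 else s.

Lemma ltime_ge l : (s <= ltime l)%R.
Proof. by case: l => //= c l; exact: e_ge. Qed.

(** The law of the state at time [ltime l] on the event [l], not normalised: its total mass is the
    probability of that event. [predict l t] lets this law evolve without constraint up to [t]. *)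
Fixpoint chain l : giry T R := if l is c :: l' then
  giry_bind (chain l')
    (measurable_kgiry (p (ltime l') (e c.1)) (measurable_cset c))
  else giry_ret x0.

Definition predict l t : giry T R :=
  giry_bind (chain l) (measurable_kgiry (p (ltime l) t) measurableT).

Lemma chain_nil B : chain [::] B = \d_x0 B.
Proof. by []. Qed.

Lemma chain_consE c l B : measurable B ->
  chain (c :: l) B = \int[chain l]_y p (ltime l) (e c.1) y (B `&` cset c).
Proof. by move=> mB; exact: giry_bindE. Qed.

Lemma predictE l t B : measurable B ->
  predict l t B = \int[chain l]_y p (ltime l) t y B.
Proof.
by move=> mB; rewrite [LHS]giry_bindE//; apply: eq_integral => y _; rewrite /= /kres /mrestr setIT.
Qed.

Lemma chain_predict c l B : measurable B ->
  chain (c :: l) B = predict l (e c.1) (B `&` cset c).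
Proof.
move=> mB; rewrite chain_consE// predictE//.
by apply: measurableI => //; exact: measurable_cset.
Qed.

Lemma predict_CK l t u B : (ltime l <= t)%R -> (t <= u)%R -> measurable B ->
  \int[predict l t]_y p t u y B = predict l u B.
Proof.
move=> lt tu mB; rewrite predictE//.
have := @giry_int_bind _ _ _ _ _ (chain l) _
  (measurable_kgiry (p (ltime l) t) measurableT) _
  (measurable_kernel (p t u) _ mB) (fun y => measure_ge0 _ _).
rewrite /giry_int -/(predict l t) => ->.
apply: eq_integral => y _.
rewrite (CK y (ltime_ge l) lt tu mB).
by apply: eq_measure_integral => C mC _; rewrite /= /kres /mrestr setIT.
Qed.

Lemma predict_ltime l B : measurable B -> predict l (ltime l) B = chain l B.
Proof.
move=> mB; rewrite predictE//.
under eq_integral do rewrite (p_id _ (ltime_ge l) mB).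
rewrite -[in RHS](setIT B) -integral_indic//.
Qed.

Lemma predict_setT l t : predict l t setT = chain l setT.
Proof.
rewrite predictE//; under eq_integral do rewrite prob_kernel.
by rewrite integral_cst// mul1e.
Qed.

Local Opaque chain predict.

(** Ties in time are broken by the index and the bit, so that [later] is antisymmetric and a sorted
    list depends only on the multiset of its constraints. *)
Let key c : (R *l (nat *l bool))%type := (e c.1, (c.1, c.2)).
Definition later c c' := (key c' <= key c)%O.

Lemma later_time c c' : later c c' -> (e c'.1 <= e c.1)%R.
Proof. by rewrite /later /key lexi_pair => /andP[]. Qed.

Lemma later_trans : transitive later.
Proof. by move=> c c1 c2 /[swap]; exact: le_trans. Qed.

Lemma later_total : total later.
Proof. by move=> c c'; exact: le_total. Qed.

Lemma later_anti : antisymmetric later.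
Proof.
move=> [i b] [i' b'] /andP[h1 h2].
have /eqP : key (i, b) == key (i', b') by rewrite eq_le; apply/andP.
by rewrite /key => -[_ -> ->].
Qed.

Fixpoint ins c l := if l is c' :: l' then
  if later c c' then c :: l else c' :: ins c l' else [:: c].

Lemma perm_ins c l : perm_eq (ins c l) (c :: l).
Proof.
elim: l => //= c' l ih; case: ifP => // _.
rewrite perm_sym (perm_trans (permEl (perm_catCA [:: c] [:: c'] l)))//=.
by rewrite perm_cons perm_sym.
Qed.

Lemma sorted_ins c l : sorted later l -> sorted later (ins c l).
Proof.
elim: l => //= c' l ih; case: ifPn => [cc' /= ->|ncc']; first by rewrite cc'.
have c'c : later c' c by have := later_total c c'; rewrite (negbTE ncc').
rewrite /= !(path_sortedE later_trans) => /andP[h1 h2].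
by rewrite (perm_all _ (perm_ins c l)) /= c'c h1 ih.
Qed.

Lemma ltime_ub c l : sorted later l -> c \in l -> (e c.1 <= ltime l)%R.
Proof.
case: l => // c' l /= h; rewrite inE => /predU1P[->//|cl].
apply: later_time; move: h; rewrite (path_sortedE later_trans) => /andP[/allP h _].
exact: h.
Qed.

Lemma ltime_behead c l : sorted later (c :: l) -> (ltime l <= e c.1)%R.
Proof. by case: l => [_|c' l /= /andP[/later_time]]//=; exact: e_ge. Qed.

Lemma chain_ins_head i l B : measurable B ->
  chain ((i, true) :: l) B + chain ((i, false) :: l) B = predict l (e i) B.
Proof.
move=> mB; rewrite (chain_predict (i, true))// (chain_predict (i, false))//.
exact: giry_splitC (mA i) mB.
Qed.

Lemma later_bit i b b' c : i != c.1 -> later (i, b) c = later (i, b') c.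
Proof.
case: c => j b0 /= ij; rewrite /later /key !lexi_pair /=.
have [ij'|//] := leP (j : nat) i; have [ji|//] := leP (i : nat) j.
by case/eqP: ij; apply/eqP; rewrite eqn_leq; apply/andP.
Qed.

Lemma predict_sum l1 l2 (mu : giry T R) u t B :
  ltime l1 = u -> ltime l2 = u -> measurable B ->
  (forall C, measurable C -> chain l1 C + chain l2 C = mu C) ->
  predict l1 t B + predict l2 t B = \int[mu]_y p u t y B.
Proof.
move=> h1 h2 mB H; rewrite (predictE l1 t mB) (predictE l2 t mB) h1 h2.
by apply: integral_giryD => //; exact: measurable_kernel.
Qed.

(** Summing over both values of a constraint forgets it. If it is the latest one, the two laws at
    time [e i] add up to the unconstrained law and Chapman-Kolmogorov removes the stop at [e i];
    otherwise the sum is carried through the later kernels by linearity. *)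
Lemma predict_ins i l t B : sorted later l -> i \notin map fst l ->
  (e i <= t)%R -> (ltime l <= t)%R -> measurable B ->
  predict (ins (i, true) l) t B + predict (ins (i, false) l) t B = predict l t B.
Proof.
elim: l t B => [|c' l ih] t B sl.
  move=> _ it lt mB.
  transitivity (\int[predict [::] (e i)]_y p (e i) t y B).
    by apply: predict_sum => // C mC; exact: chain_ins_head.
  by apply: predict_CK => //; exact: e_ge.
rewrite [map _ _]/= inE negb_or => /andP[ic il] it lt mB.
rewrite [ins (i, true) _]/= [ins (i, false) _]/=.
rewrite (later_bit false true ic); case: ifPn => [h|nh].
  transitivity (\int[predict (c' :: l) (e i)]_y p (e i) t y B).
    by apply: predict_sum => // C mC; exact: chain_ins_head.
  by apply: predict_CK => //; exact: later_time h.
rewrite (predictE (c' :: l) t mB).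
apply: predict_sum => // C mC.
have mC' := measurableI _ _ mC (measurable_cset c').
rewrite (chain_predict c' (ins _ l) mC) (chain_predict c' (ins (i, false) l) mC).
rewrite (chain_predict c' l mC); apply: ih => //.
- by move: sl; rewrite /= => /path_sorted.
- by have := later_total c' (i, true); rewrite (negbTE nh) orbF => /later_time.
- exact: ltime_behead sl.
Qed.

Definition mass l : \bar R := chain (sort later l) setT.

Lemma sort_cons c l : sort later (c :: l) = ins c (sort later l).
Proof.
apply: (sorted_eq later_trans later_anti).
- exact: sort_sorted later_total _.
- exact/sorted_ins/sort_sorted/later_total.
- rewrite perm_sort perm_sym (perm_trans (perm_ins _ _))//.
  by rewrite perm_cons perm_sort.
Qed.

Lemma perm_mass l l' : perm_eq l l' -> mass l = mass l'.
Proof.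
move=> ll'; congr (chain _ _).
exact/(perm_sortP later_total later_trans later_anti).
Qed.

Lemma mass_nil : mass [::] = 1.
Proof. by rewrite -[RHS](diracT R x0) -chain_nil. Qed.

(** Kolmogorov consistency. Evolution preserves the total mass, so all three terms can be read at
    one time [t] that comes after every constraint. *)
Lemma mass_cons i l : i \notin map fst l ->
  mass ((i, true) :: l) + mass ((i, false) :: l) = mass l.
Proof.
move=> il; rewrite /mass !sort_cons.
set t := Num.max (e i) (ltime (sort later l)).
rewrite -!(predict_setT _ t) predict_ins//.
- exact: sort_sorted later_total _.
- by rewrite (perm_mem (perm_map _ (permEl (perm_sort _ _)))).
- by rewrite /t le_max lexx.
- by rewrite /t le_max lexx orbT.
Qed.

Lemma ltime_ins c l : sorted later l -> (ltime l <= e c.1)%R ->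
  ltime (ins c l) = e c.1.
Proof.
move=> sl lc; apply/eqP; rewrite eq_le; apply/andP; split; last first.
  apply: ltime_ub; first exact: sorted_ins.
  by rewrite (perm_mem (perm_ins _ _)) mem_head.
by case: l lc {sl} => //= c' l lc; case: ifP.
Qed.

(** Among constraints at the same latest time, [ins] may put [c] below the head. The kernel from a
    time to itself is the identity, so simultaneous constraints intersect in whatever order they
    come. *)
Lemma chain_ins c l B : sorted later l -> (ltime l <= e c.1)%R ->
  measurable B -> chain (ins c l) B = predict l (e c.1) (B `&` cset c).
Proof.
elim: l B => [|c' l ih] B sl lc mB; first by rewrite /ins chain_predict.
rewrite /=; case: ifPn => h; first by rewrite -chain_predict.
have ecc' : e c.1 = e c'.1.
  apply/eqP; rewrite eq_le lc andbT.
  by have := later_total c' c; rewrite (negbTE h) orbF => /later_time.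
have sl' : sorted later l by move: sl => /= /path_sorted.
have ll' : (ltime l <= e c.1)%R by rewrite ecc'; exact: ltime_behead sl.
have mBc' := measurableI _ _ mB (measurable_cset c').
have mBc := measurableI _ _ mB (measurable_cset c).
rewrite (chain_predict c' (ins c l) mB) -ecc' -(ltime_ins sl' ll').
rewrite (predict_ltime _ mBc') (ltime_ins sl' ll') (ih _ sl' ll' mBc').
have -> : predict (c' :: l) (e c.1) (B `&` cset c) =
          chain (c' :: l) (B `&` cset c).
  by rewrite ecc'; exact: (predict_ltime (c' :: l) mBc).
rewrite (chain_predict c' l mBc) -ecc'.
by congr (predict _ _ _); exact: setIAC.
Qed.

Lemma mass_later c l : (forall c', c' \in l -> (e c'.1 <= e c.1)%R) ->
  mass (c :: l) = predict (sort later l) (e c.1) (cset c).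
Proof.
move=> lc; rewrite /mass sort_cons chain_ins//.
- by rewrite setTI.
- exact: sort_sorted later_total _.
- have : {subset sort later l <= l} by move=> x; rewrite mem_sort.
  by case: (sort later l) => [_|c' l' /(_ c' (mem_head _ _))/lc//]; exact: e_ge.
Qed.

Lemma mass_dup c l : (forall c', c' \in l -> (e c'.1 <= e c.1)%R) ->
  mass (c :: c :: l) = mass (c :: l).
Proof.
move=> lc; have sl : sorted later (sort later l) by exact/sort_sorted/later_total.
have ll : (ltime (sort later l) <= e c.1)%R.
  have : {subset sort later l <= l} by move=> x; rewrite mem_sort.
  by case: (sort later l) => [_|c' l' /(_ c' (mem_head _ _))/lc//]; exact: e_ge.
rewrite mass_later; last by move=> c'; rewrite inE => /predU1P[->|/lc].
rewrite (mass_later lc) sort_cons -(ltime_ins sl ll).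
rewrite (predict_ltime _ (measurable_cset c)) (ltime_ins sl ll).
rewrite (chain_ins sl ll (measurable_cset c)).
by congr (predict _ _ _); exact: setIid.
Qed.

Lemma mass_mem c l : (forall c', c' \in l -> (e c'.1 <= e c.1)%R) -> c \in l ->
  mass (c :: l) = mass l.
Proof.
move=> lc cl; have pl := perm_to_rem cl.
have rc c' : c' \in rem c l -> (e c'.1 <= e c.1)%R by move=> /mem_rem/lc.
rewrite [RHS](perm_mass pl) -[RHS](mass_dup rc).
by apply: perm_mass; rewrite perm_cons.
Qed.

(** The joint law of two bits at one time; it serves to show that the bits attached to a fixed time
    describe a single random variable. *)
Lemma mass2 i b j b' : e i = e j ->
  mass [:: (i, b); (j, b')] = predict [::] (e i) (cset (i, b) `&` cset (j, b')).
Proof.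
move=> ij; rewrite mass_later; last by move=> c; rewrite inE => /eqP ->/=; rewrite ij.
rewrite ij -[e j]/(ltime [:: (j, b')]) (predict_ltime _ (measurable_cset _)).
by rewrite (chain_predict _ _ (measurable_cset _)).
Qed.

End chain.

(** * A Markov process indexed by the rationals *)

Section random_bits.
Variable R : realType.

Definition unit_lebesgue : set (measurableTypeR R) -> \bar R :=
  mrestr lebesgue_measure (measurable_itv `[0%R, 1%R[).

HB.instance Definition _ := Measure.on unit_lebesgue.

Let unit_lebesgue_setT : unit_lebesgue setT = 1.
Proof.
by rewrite /unit_lebesgue /mrestr setTI lebesgue_measure_itv/= lte01 oppr0 adde0.
Qed.

HB.instance Definition _ :=
  Measure_isProbability.Build _ _ _ unit_lebesgue unit_lebesgue_setT.

Fixpoint bit_path {U : Type} (b : nat -> U -> bool) n u : seq bool :=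
  if n is n'.+1 then b n' u :: bit_path b n' u else [::].

Variable p : seq bool -> R.
Hypothesis p_nil : p [::] = 1%R.
Hypothesis p_ge0 : forall bs, (0 <= p bs)%R.
Hypothesis p_cons : forall bs, (p (true :: bs) + p (false :: bs))%R = p bs.

(* Each word [bs] owns the subinterval of [0, 1) of length [p bs] starting at
   [left_end bs]; the intervals of its two children split it from the left. *)
Fixpoint left_end bs : R := if bs is b :: bs' then
  (if b then left_end bs' else left_end bs' + p (true :: bs'))%R else 0%R.

Fixpoint bisect n (u : R) : seq bool := if n is n'.+1 then
  let bs := bisect n' u in (u < left_end bs + p (true :: bs))%R :: bs
  else [::].

Definition bisect_bit n (u : measurableTypeR R) : bool := head false (bisect n.+1 u).

Lemma bit_path_bisect n u : bit_path bisect_bit n u = bisect n u.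
Proof. by elim: n => //= n ->. Qed.

Lemma size_bisect n u : size (bisect n u) = n.
Proof. by elim: n => //= n ->. Qed.

Lemma bisectP u bs : (0 <= u < 1)%R ->
  (bisect (size bs) u == bs) = (left_end bs <= u < left_end bs + p bs)%R.
Proof.
move=> u01; elim: bs => [|b bs ih] /=; first by rewrite p_nil add0r u01.
rewrite eqseq_cons andbC ih; have := p_cons bs.
have := p_ge0 (true :: bs); have := p_ge0 (false :: bs).
have [/eqP ->|ne] := boolP (bisect (size bs) u == bs).
  move=> p0 p1 pE.
  case: b; have [h|h] := ltP u (left_end bs + p (true :: bs))%R;
    rewrite /= ?andbT ?andbF.
  - by apply: andb_idr => _; lra.
  - by [].
  - by [].
  - by rewrite -addrA pE; apply: andb_idl => _; lra.
move: ih; rewrite (negbTE ne) => /esym ih p0 p1 pE.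
rewrite ih andFb; apply/esym/negbTE; move/negbT: ih; apply: contra.
by case: b => /andP[? ?]; apply/andP; split; lra.
Qed.

Lemma measurable_bisect bs :
  measurable [set u : measurableTypeR R | bisect (size bs) u = bs].
Proof.
elim: bs => [|b bs ih] /=; first by rewrite (_ : mkset _ = setT)//; exact/seteqP.
pose t := (left_end bs + p (true :: bs))%R.
rewrite (_ : mkset _ = [set u | bisect (size bs) u = bs] `&`
   (if b then `]-oo, t[%classic else `[t, +oo[%classic)).
  by apply: measurableI => //; case: b; exact: measurable_itv.
apply/seteqP; split => [u /= [ub ubs]|u /= [-> ub]].
  split => //; rewrite -ub ubs -/t; case: ltP => h /=; rewrite in_itv/= ?h//.
congr cons; rewrite -/t; move: ub; case: b; rewrite /= in_itv/= ?andbT// => h.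
by apply/negbTE; rewrite -leNgt.
Qed.

Lemma measurable_bisect_bit n : measurable_fun setT (bisect_bit n).
Proof.
apply: (measurable_fun_bool true); rewrite setTI.
rewrite (_ : _ @^-1` _ = \bigcup_(bs in [set bs : seq bool | size bs = n])
  [set u | bisect (size (true :: bs)) u = true :: bs]).
  rewrite bigcup_mkcond; apply: countable_bigcupT_measurable => // bs.
  by case: ifP => _; [exact: measurable_bisect|exact: measurable0].
apply/seteqP; split => [u /= h|u [bs /= sbs]].
  exists (bisect n u) => /=; first exact: size_bisect.
  by rewrite size_bisect; congr cons.
by rewrite /bisect_bit /= sbs => -[-> _].
Qed.

Lemma unit_lebesgue_bisect bs :
  unit_lebesgue [set u | bit_path bisect_bit (size bs) u = bs] = (p bs)%:E.
Proof.
have l0 : forall bs, (0 <= left_end bs)%R.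
  by elim=> //= -[] // bs' ih; rewrite addr_ge0.
have l1 : forall bs, (left_end bs + p bs <= 1)%R.
  elim=> /= [|[] bs' ih]; first by rewrite p_nil add0r.
    by have := p_cons bs'; have := p_ge0 (false :: bs'); lra.
  by have := p_cons bs'; lra.
rewrite /unit_lebesgue /mrestr.
rewrite (_ : _ `&` _ = `[left_end bs, (left_end bs + p bs)%R[%classic).
  rewrite lebesgue_measure_itv/= lte_fin ltrDl -EFinB addrAC subrr add0r.
  by case: ltP => // h; congr EFin; apply/eqP; rewrite eq_le h p_ge0.
apply/seteqP; split => u /=.
  by rewrite bit_path_bisect => -[/eqP h]; rewrite !in_itv/= => h'; rewrite -bisectP.
rewrite !in_itv/= => h; have u01 : (0 <= u < 1)%R.
  by have := l0 bs; have := l1 bs; case/andP: h; lra.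
by rewrite bit_path_bisect; split => //; apply/eqP; rewrite bisectP.
Qed.

End random_bits.

Lemma exists_random_bits (R : realType) (p : seq bool -> R) :
  p [::] = 1%R -> (forall bs, (0 <= p bs)%R) ->
  (forall bs, (p (true :: bs) + p (false :: bs))%R = p bs) ->
  exists (P : probability (measurableTypeR R) R)
    (b : nat -> measurableTypeR R -> bool),
    (forall n, measurable_fun setT (b n)) /\
    forall bs, P [set u | bit_path b (size bs) u = bs] = (p bs)%:E.
Proof.
move=> p1 p0 pc; exists (@unit_lebesgue R), (bisect_bit p); split.
  exact: measurable_bisect_bit.
exact: unit_lebesgue_bisect.
Qed.

Lemma uniq_fst_inj (T T' : eqType) (l : seq (T * T')) i b b' :
  uniq (map fst l) -> (i, b) \in l -> (i, b') \in l -> b = b'.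
Proof.
elim: l => //= -[j c] l ih /= /andP[jl ul]; rewrite !inE !xpair_eqE.
have [ij|_] := eqVneq i j; last exact: ih.
have il b0 : (i, b0) \in l = false.
  by apply/negP => /(map_f fst)/=; rewrite ij (negbTE jl).
by rewrite !il !orbF /= => /eqP -> /eqP ->.
Qed.

Section consistent_weights.
Variables (R : realType) (m : seq (nat * bool) -> R).
Hypothesis m_nil : m [::] = 1%R.
Hypothesis m_ge0 : forall l, (0 <= m l)%R.
Hypothesis perm_m : forall l l', perm_eq l l' -> m l = m l'.
Hypothesis m_cons : forall i l, i \notin map fst l ->
  (m ((i, true) :: l) + m ((i, false) :: l))%R = m l.

Fixpoint word bs : seq (nat * bool) :=
  if bs is b :: bs' then (size bs', b) :: word bs' else [::].

Lemma word_fst bs : map fst (word bs) = rev (iota 0 (size bs)).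
Proof.
elim: bs => // b bs ih; rewrite [LHS]/= ih [size (b :: bs)]/=.
by rewrite -addn1 iotaD rev_cat.
Qed.

Fixpoint constraints (S : nat -> option bool) n k : seq (nat * bool) :=
  if k is k'.+1 then
    (if S n is Some b then [:: (n, b)] else [::]) ++ constraints S n.+1 k'
  else [::].

Lemma mem_constraints S n k c : c \in constraints S n k =
  (S c.1 == Some c.2) && (n <= c.1 < n + k)%N.
Proof.
case: c => j b; elim: k n => [|k ih] n /=.
  by rewrite addn0 in_nil; case: (leqP n j); rewrite ?andbF.
rewrite mem_cat {}ih /= addSnnS; have [->|jn] := eqVneq j n.
  rewrite ltnn leqnn addnS ltnS leq_addr andbF orbF andbT.
  by case: (S n) => [b'|//]; rewrite inE xpair_eqE eqxx andbT eq_sym.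
rewrite ltn_neqAle (eq_sym n) jn.
by case: (S n) => [b'|]; rewrite ?inE ?xpair_eqE ?(negbTE jn).
Qed.

Lemma uniq_constraints S n k : uniq (constraints S n k).
Proof.
elim: k n => //= k ih n; rewrite cat_uniq ih andbT; case: (S n) => [b|] //=.
  by rewrite has_sym /= mem_constraints /= ltnn andbF.
by apply/hasPn.
Qed.

(** Words fix an initial segment of the bits, a list of constraints fixes arbitrary ones: the free
    bits in between are summed out with [m_cons]. *)
Lemma exists_bits_of_weights :
  exists (P : probability (measurableTypeR R) R)
    (b : nat -> measurableTypeR R -> bool),
    (forall n, measurable_fun setT (b n)) /\
    forall l, uniq (map fst l) ->
      P [set u | all (fun c => b c.1 u == c.2) l] = (m l)%:E.
Proof.
have [||P [b [mb Pb]]] := @exists_random_bits R (m \o word) m_nil.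
- by move=> bs; exact: m_ge0.
- move=> bs /=; apply: m_cons; rewrite word_fst mem_rev mem_iota.
  by rewrite add0n ltnn andbF.
exists P, b; split => // l ul.
have mbit n c : measurable [set u | b n u = c].
  by have := mb n measurableT [set c]; rewrite setTI; exact.
have mword bs : measurable [set u | bit_path b (size bs) u = bs].
  elim: bs => [|c bs ih]; first by rewrite (_ : mkset _ = setT)//; exact/seteqP.
  rewrite (_ : mkset _ = [set u | b (size bs) u = c] `&`
    [set u | bit_path b (size bs) u = bs]); first exact: measurableI.
  by apply/seteqP; split => u /= [-> ->].
have mall l' : measurable [set u | all (fun c => b c.1 u == c.2) l'].
  elim: l' => [|c l' ih]; first by rewrite (_ : mkset _ = setT)//; exact/seteqP.
  rewrite (_ : mkset _ = [set u | b c.1 u = c.2] `&`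
    [set u | all (fun c => b c.1 u == c.2) l']); first exact: measurableI.
  by apply/seteqP; split => u /= => [/andP[/eqP]|[/eqP -> ->]].
(* The list as a partial assignment, so that its constraints can be met in the order of the bits. *)
pose S i := if (i, true) \in l then Some true else
  if (i, false) \in l then Some false else None.
have SE c : (S c.1 == Some c.2) = (c \in l).
  have l1 i : (i, true) \in l -> (i, false) \in l -> false.
    by move=> h1 h2; have := uniq_fst_inj ul h1 h2.
  case: c => i [] /=; rewrite /S.
    by case: ifP => // _; case: ifP.
  case: ifP => [h|_]; last by case: ifP.
  by apply/esym/negP => /(l1 _ h).
(* One bit at a time, [bs] being the bits already read: a bit fixed by [S] moves from the list to
   the word, a free bit is split into its two values. *)
have key k bs : P ([set u | bit_path b (size bs) u = bs] `&`
    [set u | all (fun c => b c.1 u == c.2) (constraints S (size bs) k)]) =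
    (m (word bs ++ constraints S (size bs) k))%:E.
  elim: k bs => [|k ih] bs.
    by rewrite /= cats0 (_ : [set u : measurableTypeR R | true] = setT) ?setIT ?Pb//;
      exact/seteqP.
  have ihc c := ih (c :: bs); rewrite /=; case ES : (S (size bs)) => [c|] /=.
    rewrite (@perm_m _ (word (c :: bs) ++ constraints S (size (c :: bs)) k)).
      rewrite -ihc; congr (P _); apply/seteqP; split => u /=.
        by move=> [-> /andP[/eqP -> ->]].
      by move=> [[-> ->] ->]; rewrite eqxx.
    by rewrite /= -cat1s perm_catCA.
  rewrite -(@m_cons (size bs)); last first.
    rewrite map_cat mem_cat word_fst mem_rev mem_iota ltnn andbF /=.
    apply/negP => /mapP[c]; rewrite mem_constraints => /and3P[_ + _] ec.
    by rewrite -ec ltnn.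
  rewrite EFinD -(ihc true) -(ihc false) -measureU.
  - congr (P _); apply/seteqP; split => u /=.
      by move=> [-> ->]; case: (b (size bs) u); [left|right].
    by case=> -[[_ ->] ->].
  - by apply: measurableI; [exact: mword|exact: mall].
  - by apply: measurableI; [exact: mword|exact: mall].
  - by apply/seteqP; split => u //= [[[-> _] _] [[]]].
pose N := (\max_(c <- l) c.1).+1.
have := key N [::]; rewrite /= (_ : [set u : measurableTypeR R | [::] = [::]] = setT).
  have pl : perm_eq l (constraints S 0 N).
    apply: uniq_perm; [exact: map_uniq ul|exact: uniq_constraints|].
    move=> c; rewrite mem_constraints SE add0n/=; case cl : (c \in l) => //.
    by apply/esym; rewrite /= ltnS; exact: (@leq_bigmax_seq _ _ xpredT (fun c => c.1)).
  rewrite setTI -(perm_m pl) => <-; congr (P _); apply/funext => u /=.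
  by rewrite (perm_all _ pl).
by apply/seteqP.
Qed.

End consistent_weights.

(** * Uniqueness of finite measures, densities and restricted laws *)

Section measure_tools.
Context d (T : measurableType d) (R : realType).

Lemma finite_measure_ext (G : set_system T) (m1 m2 : {measure set T -> \bar R}) :
  G `<=` measurable -> setI_closed G -> G setT ->
  (forall A, G A -> m1 A = m2 A) -> m1 setT < +oo ->
  forall A, <<s G >> A -> m1 A = m2 A.
Proof.
move=> Gm GI GT m12 moo A sA.
apply: (g_sigma_algebra_measure_unique G Gm (fun=> setT)) => //.
by rewrite bigcup_const.
Qed.

Lemma ge0_integral_mrestr (mu : {measure set T -> \bar R}) (D : set T)
    (mD : measurable D) (f : T -> \bar R) :
  measurable_fun setT f -> (forall x, 0 <= f x) ->
  \int[mrestr mu mD]_x f x = \int[mu]_(x in D) f x.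
Proof.
move=> mf f0; rewrite -(setUv D) ge0_integral_setU//=.
- rewrite [X in _ + X](_ : _ = 0); last first.
    apply: null_set_integral; first exact: measurableC.
      exact: measurable_funTS.
    by rewrite /= /mrestr setICl measure0.
  rewrite adde0; apply: eq_measure_integral => A mA AD.
  by rewrite /mrestr; congr (mu _); exact/setIidPl.
- exact: measurableC.
- by rewrite setUv.
- by rewrite disj_set2E setICr.
Qed.

Section density.
Variables (mu : {measure set T -> \bar R}) (f : T -> \bar R).
Hypotheses (mf : measurable_fun setT f) (f0 : forall x, 0 <= f x).

(** Makes a measure of the right-hand side of a Markov identity, as a function of the past event, so
    that the identity need only be checked on a pi-system. *)
Definition density (A : set T) : \bar R := \int[mu]_(x in A) f x.

Let density0 : density set0 = 0.
Proof. exact: integral_set0. Qed.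

Let density_ge0 A : 0 <= density A.
Proof. exact: integral_ge0. Qed.

Let density_sigma_additive : semi_sigma_additive density.
Proof. exact: semi_sigma_additive_nng_induced. Qed.

HB.instance Definition _ := isMeasure.Build _ _ _ density
  density0 density_ge0 density_sigma_additive.

Definition mdensity : {measure set T -> \bar R} := density.

End density.
End measure_tools.

Section restricted_law.
Context d d' (T : measurableType d) (T' : measurableType d') (R : realType).
Variables (mu : {measure set T -> \bar R}) (D : set T) (mD : measurable D).
Variables (f : T -> T') (mf : measurable_fun setT f).

Definition restricted_law : set T' -> \bar R := pushforward (mrestr mu mD) f.

Let restricted_law0 : restricted_law set0 = 0.
Proof. exact: measure0. Qed.

Let restricted_law_ge0 B : 0 <= restricted_law B.
Proof. exact: measure_ge0. Qed.

Let restricted_law_sigma_additive : semi_sigma_additive restricted_law.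
Proof. exact: measure_semi_sigma_additive. Qed.

HB.instance Definition _ := isMeasure.Build _ _ _ restricted_law
  restricted_law0 restricted_law_ge0 restricted_law_sigma_additive.

Definition mrestricted_law : {measure set T' -> \bar R} := restricted_law.

Lemma mrestricted_lawE B : mrestricted_law B = mu (D `&` f @^-1` B).
Proof. by rewrite setIC. Qed.

Lemma ge0_integral_restricted_law (g : T' -> \bar R) :
  measurable_fun setT g -> (forall y, 0 <= g y) ->
  \int[mrestricted_law]_y g y = \int[mu]_(x in D) g (f x).
Proof.
move=> mg g0; rewrite [LHS](ge0_integral_pushforward mf)//.
rewrite preimage_setT ge0_integral_mrestr//; first exact: measurableT_comp.
by move=> x; exact: g0.
Qed.

End restricted_law.

Section extended_rays.
Context {R : realType}.

Definition eray (r : R) : set (\bar R) := [set y | r%:E < y].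

Lemma erayE r : eray r = `]r%:E, +oo[%classic.
Proof. by apply/funext => y; rewrite /eray/= in_itv/= andbT. Qed.

Lemma measurable_eray r : measurable (eray r).
Proof. by rewrite erayE; exact: emeasurable_itv. Qed.

Definition rat_erays : set_system (\bar R) :=
  [set A | A = setT \/ exists q : rat, A = eray (ratr q)].

Lemma rat_erays_setI : setI_closed rat_erays.
Proof.
move=> A B [->|[q ->]]; first by rewrite setTI.
move=> [->|[r ->]]; first by rewrite setIT; right; exists q.
right; exists (Num.max q r); apply/seteqP; split => y; rewrite /eray/=.
  by move=> [h1 h2]; rewrite /Order.max; case: ifP.
move=> h; split; apply: le_lt_trans h; rewrite lee_fin ler_rat le_max lexx//.
by rewrite orbT.
Qed.

Lemma eray_bigcup (x : R) :
  eray x = \bigcup_(q in [set q : rat | (x < ratr q)%R]) eray (ratr q).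
Proof.
apply/seteqP; split => y; rewrite /eray/=; last first.
  by move=> [q /= xq]; apply: lt_trans; rewrite lte_fin.
case: y => [y| |]//; rewrite ?lte_fin => xy.
  have /rat_in_itvoo[q] := xy; rewrite in_itv/= => /andP[xq qy].
  by exists q => //=; rewrite lte_fin.
have /rat_in_itvoo[q] : (x < x + 1)%R by rewrite ltrDl.
by rewrite in_itv/= => /andP[xq _]; exists q => //=; rewrite ltry.
Qed.

Lemma measurable_rat_erays : @measurable _ (\bar R) = <<s rat_erays >>.
Proof.
apply/seteqP; split; last first.
  apply: smallest_sub; first exact: sigma_algebra_measurable.
  by move=> A [->|[q ->]]; [exact: measurableT|exact: measurable_eray].
rewrite [X in X `<=` _](ErealGenOInfty.measurableE R).
apply: smallest_sub; first exact: smallest_sigma_algebra.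
move=> _ [x ->]; rewrite -erayE eray_bigcup bigcup_mkcond.
apply: (@countable_bigcupT_measurable _ (g_sigma_algebraType rat_erays)) => // q.
by case: ifP => _; [apply: sub_sigma_algebra; right; exists q|exact: measurable0].
Qed.

Lemma emeasure_ext (m1 m2 : {measure set (\bar R) -> \bar R}) :
  m1 setT = m2 setT -> m1 setT < +oo ->
  (forall q : rat, m1 (eray (ratr q)) = m2 (eray (ratr q))) ->
  forall A, measurable A -> m1 A = m2 A.
Proof.
move=> m12T moo m12 A; rewrite measurable_rat_erays.
apply: finite_measure_ext => //.
- by rewrite measurable_rat_erays; exact: sub_sigma_algebra.
- exact: rat_erays_setI.
- by left.
- by move=> B [->//|[q ->]].
Qed.

Lemma measurable_fun_eray d (T : measurableType d) (f : T -> \bar R) :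
  (forall q : rat, measurable (f @^-1` eray (ratr q))) -> measurable_fun setT f.
Proof.
move=> mf; apply: (measurability _ measurable_rat_erays).
by move=> _ [_ [->|[q ->]] <-]; rewrite setTI// preimage_setT.
Qed.

End extended_rays.

Lemma measure_mod_null d (T : measurableType d) (R : realType)
    (P : {measure set T -> \bar R}) (N A B : set T) :
  measurable A -> measurable B -> measurable N -> P N = 0 ->
  (forall u, ~ N u -> A u <-> B u) -> P A = P B.
Proof.
move=> mA mB mN N0 AB.
have h X : measurable X -> P X = P (X `\` N).
  move=> mX.
  have XN : P (X `&` N) = 0.
    by apply: (subset_measure0 _ mN _ N0); [exact: measurableI|exact: subIsetr].
  transitivity (P (X `\` N) + P (X `&` N)); first exact: measureDI.
  by rewrite XN adde0.
rewrite (h A)// (h B)//; congr (P _); apply/seteqP.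
by split => u [/= Xu Nu]; split => //; apply/AB.
Qed.

Definition past_gen (R : realType) (U : Type) (Z : rat -> U -> \bar R) (q : rat) :
    set_system U :=
  [set C | exists r, (0 <= r <= q)%R /\
    exists B, measurable B /\ C = Z r @^-1` B].

Lemma past_measurable (R : realType) d (U : measurableType d)
    (Z : rat -> U -> \bar R) q C :
  (forall q, measurable_fun setT (Z q)) -> <<s past_gen Z q >> C -> measurable C.
Proof.
move=> mZ; apply: smallest_sub; first exact: sigma_algebra_measurable.
move=> _ [r [_ [B [mB ->]]]]; rewrite -[X in measurable X]setTI.
exact: mZ.
Qed.

Local Opaque chain predict.

(* Opaque, so that simplification does not try to evaluate codes. *)
Lemma coding (T : countType) : {f : T -> nat & {g | pcancel f g}}.
Proof. by exists pickle, unpickle; exact: pickleK. Qed.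

Definition code (T : countType) : T -> nat := projT1 (coding T).
Definition decode (T : countType) : nat -> option T :=
  sval (projT2 (coding T)).

Lemma codeK (T : countType) : pcancel (@code T) (@decode T).
Proof. exact: svalP (projT2 (coding T)). Qed.

Arguments code {T} : simpl never.
Arguments decode {T} : simpl never.

(** Bit [n] encodes the event that the state at time q exceeds r, where (q, r) is [coord n]; a
    number that codes no pair falls back on (0, 0). *)
Definition coord n : rat * rat := odflt (0%R, 0%R) (decode n).

Lemma measurable_coord (R : realType) i :
  measurable (eray (ratr (coord i).2) : set (\bar R)).
Proof. exact: measurable_eray. Qed.

Section rational_process.
Variables (R : realType) (p : R -> R -> R.-pker (\bar R) ~> (\bar R)).
Variables (s : R) (x0 : \bar R).
Hypothesis CK : forall a b c x B, (s <= a)%R -> (a <= b)%R -> (b <= c)%R ->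
  measurable B -> p a c x B = \int[p a b x]_y p b c y B.
Hypothesis p_id : forall a x B, (s <= a)%R -> measurable B ->
  p a a x B = \d_x B.

Definition rtime (q : rat) : R := (s + ratr q)%R.

(** The absolute value puts every bit at a time from [s] on, as the chain requires, and changes
    nothing for q >= 0. *)
Let e n : R := rtime `|(coord n).1|%R.
Let A n : set (\bar R) := eray (ratr (coord n).2).

Let e_ge i : (s <= e i)%R.
Proof. by rewrite /e /rtime lerDl ler0q. Qed.

Let mA i : measurable (A i) := measurable_coord R i.

Let eE (c : rat * rat) : (0 <= c.1)%R -> e (code c) = rtime c.1.
Proof. by move=> c0; rewrite /e /coord codeK /= ger0_norm. Qed.

Let AE (c : rat * rat) : A (code c) = eray (ratr c.2).
Proof. by rewrite /A /coord codeK. Qed.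

Local Notation mass := (mass p s x0 e mA).
Local Notation predict := (predict p s x0 e mA).
Local Notation later := (later (R := R) e).

Variables (P : probability (measurableTypeR R) R).
Variable b : nat -> measurableTypeR R -> bool.
Hypothesis mb : forall n, measurable_fun setT (b n).
Hypothesis Pb : forall l, uniq (map fst l) ->
  P [set u | all (fun c => b c.1 u == c.2) l] = mass l.

Implicit Types (q r : rat) (u : measurableTypeR R) (l : seq (rat * rat)).

(** The bits of time [q] are meant to be the indicators of [r < Z q]; the supremum inverts this
    coding as soon as they are decreasing and right-continuous in [r], which holds almost surely. *)
Definition rproc q u : \bar R :=
  ereal_sup [set (ratr r)%:E | r in [set r | b (code (q, r)) u]].
Local Notation Z := rproc.

Lemma rproc_gt q u y :
  y%:E < Z q u <-> exists r, b (code (q, r)) u /\ (y < ratr r)%R.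
Proof.
split=> [/ereal_sup_gt[_ [r br <-]]|[r [br yr]]]; first by exists r.
apply: (@lt_le_trans _ _ (ratr r)%:E); first by rewrite lte_fin.
by apply: ereal_sup_ubound; exists r.
Qed.

Let mbit n c : measurable [set u | b n u = c].
Proof. by have := @mb n measurableT [set c]; rewrite setTI; exact. Qed.

Lemma measurable_rproc q : measurable_fun setT (Z q).
Proof.
apply: measurable_fun_eray => y.
rewrite (_ : _ @^-1` _ = \bigcup_(r in [set r | (y < r)%R])
    [set u | b (code (q, r)) u = true]).
  rewrite bigcup_mkcond; apply: bigcupT_measurable_rat => r.
  by case: ifP => // _; exact: mbit.
apply/seteqP; split => u /=; rewrite /eray/=.
  by move=> /rproc_gt[r [br]]; rewrite ltr_rat => yr; exists r.
by move=> [r yr br]; apply/rproc_gt; exists r; rewrite ltr_rat.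
Qed.

Let nu q := predict [::] (rtime q).

Let two_bits q r r' c c' : (0 <= q)%R -> r != r' ->
  P [set u | b (code (q, r)) u = c /\ b (code (q, r')) u = c'] =
  nu q ((if c then eray (ratr r) else ~` eray (ratr r)) `&`
        (if c' then eray (ratr r') else ~` eray (ratr r'))).
Proof.
move=> q0 rr'.
have := @Pb [:: (code (q, r), c); (code (q, r'), c')].
rewrite mass2//; last by rewrite !eE.
rewrite (eE (c := (q, r)))// /cset [X in if X then _ else _]/= !AE => <-; last first.
  rewrite /= inE andbT; apply: contra rr' => /eqP /(pcan_inj (@codeK _))[->].
  by [].
by congr (P _); apply/seteqP; split => u /= => [[-> ->]|/and3P[/eqP -> /eqP ->]];
    rewrite ?eqxx.
Qed.

Let null_decr q r r' : (0 <= q)%R -> (r < r')%R ->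
  P [set u | b (code (q, r)) u = false /\ b (code (q, r')) u = true] = 0.
Proof.
move=> q0 rr'; rewrite two_bits// ?lt_eqF//.
rewrite (_ : _ `&` _ = set0) ?measure0//.
apply/seteqP; split => y //=; rewrite /eray/= => -[H h]; apply: H.
by apply: lt_trans h; rewrite lte_fin ltr_rat.
Qed.

(** The failure of right-continuity: if the bits are also decreasing, the supremum is then [r]
    itself, although the bit at [r] claims a strict inequality. *)
Let no_right q r := [set u | b (code (q, r)) u = true /\
    forall r', (r < r')%R -> b (code (q, r')) u = false].

Let measurable_no_right q r : measurable (no_right q r).
Proof.
rewrite (_ : no_right q r = [set u | b (code (q, r)) u = true] `&`
    ~` \bigcup_(r' in [set r' | (r < r')%R])
        [set u | b (code (q, r')) u = true]).
  apply: measurableI; first exact: mbit.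
  apply: measurableC; rewrite bigcup_mkcond; apply: bigcupT_measurable_rat => r'.
  by case: ifP => // _; exact: mbit.
apply/seteqP; split => u [/= br H]; split => //.
  by move=> [r' /= /H ->].
by move=> r' rr'; apply/negbTE/negP => br'; apply: H; exists r'.
Qed.

(** Under the law of the state at time [q], the event is contained in [r < y <= v n] for each [n],
    and these sets decrease to the empty set. *)
Let null_right q r : (0 <= q)%R -> P (no_right q r) = 0.
Proof.
move=> q0.
pose v n : rat := (r + n.+1%:R^-1)%R.
pose F n : set (\bar R) := eray (ratr r) `&` ~` eray (ratr (v n)).
have mF n : measurable (F n).
  apply: measurableI; first exact: measurable_eray.
  by apply: measurableC; exact: measurable_eray.
have F0 : nu q (F n) @[n --> \oo] --> nu q (\bigcap_n F n).
  apply: nonincreasing_cvg_mu => //.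
  - by rewrite -ge0_fin_numE//; exact: fin_num_measure.
  - exact: bigcapT_measurable.
  - move=> n m nm; apply/subsetPset => y [yr yv]; split => // yv'; apply: yv.
    apply: le_lt_trans yv'; rewrite lee_fin ler_rat lerD2l lef_pV2 ?posrE//.
    by rewrite ler_nat.
have {F0} F0 : nu q (F n) @[n --> \oo] --> 0.
  rewrite (_ : 0 = nu q (\bigcap_n F n))//; apply/esym.
  rewrite (_ : \bigcap_n F n = set0) ?measure0//; apply/seteqP; split => y //= H.
  have [] := H 0%N I; rewrite /eray/= => ry /negP; rewrite -leNgt => yv.
  have [z yz] : exists z, y = z%:E.
    by case: y ry yv {H} => [z| |]//; exists z.
  move: ry; rewrite yz lte_fin => rz.
  have := @ltr_add_invr R (ratr r) z rz; move=> [n rn].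
  have [_] := H n I; apply; rewrite /eray/= yz lte_fin (le_lt_trans _ rn)//.
  by rewrite /v rmorphD/= fmorphV/= ratr_nat.
apply/eqP; rewrite eq_le measure_ge0 andbT.
rewrite -(cvg_lim _ F0)//; apply: lime_ge; first by apply/cvg_ex; exists 0.
apply: nearW => n.
have rv : r != v n by rewrite lt_eqF// /v ltrDl invr_gt0.
rewrite -(two_bits true false q0 rv); apply: le_measure; rewrite ?inE//.
  rewrite (_ : mkset _ = [set u | b (code (q, r)) u = true] `&`
    [set u | b (code (q, v n)) u = false])//.
  by apply: measurableI; exact: mbit.
by move=> u [/= -> H]; split => //; apply: H; rewrite /v ltrDl invr_gt0.
Qed.

Let bad n : set (measurableTypeR R) :=
  if @decode (rat * rat * rat)%type n is Some (q, r, r') then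
    if (0 <= q)%R && (r < r')%R then
    [set u | b (code (q, r)) u = false /\ b (code (q, r')) u = true] `|`
    no_right q r
    else set0
  else set0.

Let measurable_bad n : measurable (bad n).
Proof.
rewrite /bad; case: (decode n) => // -[[q r] r'].
case: ifP => // _; apply: measurableU => //.
by apply: measurableI; exact: mbit.
Qed.

Let bad0 n : P (bad n) = 0.
Proof.
rewrite /bad; case: (decode n) => [[[q r] r']|]; last exact: measure0.
case: ifP => [/andP[q0 rr']|_]; last exact: measure0.
apply/eqP; rewrite eq_le measure_ge0 andbT.
have m1 : measurable [set u | b (code (q, r)) u = false /\
    b (code (q, r')) u = true] by apply: measurableI; exact: mbit.
rewrite (le_trans (measureU2 _ m1 (measurable_no_right q r)))//.
by rewrite [X in X + _](null_decr q0 rr') [X in _ + X](null_right r q0) adde0.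
Qed.

Let Bad := \bigcup_n bad n.

Let measurable_Bad : measurable Bad.
Proof. exact: bigcupT_measurable. Qed.

Let Bad0 : P Bad = 0.
Proof.
apply/eqP; rewrite eq_le measure_ge0 andbT.
apply: (le_trans (measure_sigma_subadditive P measurable_bad measurable_Bad
  (@subset_refl _ _))).
by rewrite eseries0// => n _ _; exact: bad0.
Qed.

Let bitE q r u : ~ Bad u -> (0 <= q)%R ->
  b (code (q, r)) u <-> (ratr r)%:E < Z q u.
Proof.
move=> nb q0; have nbad r1 r2 : (r1 < r2)%R -> ~ bad (code (q, r1, r2)) u.
  by move=> _ h; apply: nb; exists (code (q, r1, r2)).
split=> [br|/rproc_gt[r' [br']]].
  apply/rproc_gt; apply/not_existsP => H.
  have r1 : (r < r + 1)%R by rewrite ltrDl.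
  apply: (nbad _ _ r1); rewrite /bad codeK q0 r1 /=; right; split => //= r' rr'.
  by apply/negbTE/negP => br'; apply: (H r'); split => //; rewrite ltr_rat.
rewrite ltr_rat => rr'; apply/negPn/negP => /negbTE br.
by apply: (nbad _ _ rr'); rewrite /bad codeK q0 rr' /=; left.
Qed.

Definition revent l : set (measurableTypeR R) :=
  [set u | all (fun c => (ratr c.2)%:E < Z c.1 u) l].

Lemma measurable_revent l : measurable (revent l).
Proof.
elim: l => [|c l ih].
  by rewrite (_ : revent [::] = setT)//; apply/seteqP.
rewrite (_ : revent (c :: l) = Z c.1 @^-1` eray (ratr c.2) `&` revent l).
  apply: measurableI => //; rewrite -[X in measurable X]setTI.
  by apply: measurable_rproc => //; exact: measurable_eray.
by apply/seteqP; split => u /=; rewrite /revent/= => /andP.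
Qed.

(** The bits are known to have the law [mass] only along lists with distinct indices, hence
    [undup]. *)
Let lift l : seq (nat * bool) := [seq (code c, true) | c <- undup l].

Let revent_mass l : all (fun c => 0 <= c.1)%R l -> P (revent l) = mass (lift l).
Proof.
move=> l0; rewrite -Pb; last first.
  rewrite -map_comp map_inj_uniq ?undup_uniq//.
  exact: pcan_inj (@codeK _).
apply: (measure_mod_null _ _ measurable_Bad Bad0).
- exact: measurable_revent.
- elim: (lift l) => [|c l' ih].
    by rewrite (_ : mkset _ = setT)//; apply/seteqP.
  rewrite (_ : mkset _ = [set u | b c.1 u = c.2] `&`
    [set u | all (fun c => b c.1 u == c.2) l']).
    by apply: measurableI => //; exact: mbit.
  by apply/seteqP; split => u /= => [/andP[/eqP]|[/eqP -> ->]].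
- move=> u nb; rewrite /revent /= all_map -(all_undup _ l).
  split => /allP H; apply/allP => c cl; have /= := H c cl;
    (have /= c0 := allP l0 c; rewrite mem_undup in cl; move: (c0 cl) => {}c0);
    case: c c0 {cl} => q r /= q0.
  + by move=> h; apply/eqP/(bitE r nb q0).
  + by move=> /eqP h; apply/(bitE r nb q0).
Qed.

Definition before q l := all (fun c => 0 <= c.1 <= q)%R l.

Let before_ge0 q l : before q l -> all (fun c => 0 <= c.1)%R l.
Proof. by apply: sub_all => c /andP[]. Qed.

Let lift_time q l : before q l ->
  forall c, c \in lift l -> (e c.1 <= rtime q)%R.
Proof.
move=> /allP bl _ /mapP[c + ->]; rewrite mem_undup => /bl/andP[c0 cq] /=.
by rewrite eE// /rtime lerD2l ler_rat.
Qed.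

Let revent_cons q r l : (0 <= q)%R -> before q l ->
  P (revent ((q, r) :: l)) = predict (sort later (lift l)) (rtime q) (eray (ratr r)).
Proof.
move=> q0 bl; rewrite revent_mass/= ?q0 ?(before_ge0 bl)//.
have lt c : c \in lift l -> (e c.1 <= e (code (q, r), true).1)%R.
  by rewrite eE//; exact: lift_time.
transitivity (mass ((code (q, r), true) :: lift l)).
  (* If [(q, r)] is already listed, [undup] drops it, and repeating a constraint at the latest time
     leaves the mass unchanged. *)
  rewrite /lift /=; case: ifPn => // ql.
  by rewrite mass_mem//; apply: map_f; rewrite mem_undup.
by rewrite mass_later// eE// /cset /= AE.
Qed.

Let law q l B : (0 <= q)%R -> before q l -> measurable B ->
  P (revent l `&` Z q @^-1` B) = predict (sort later (lift l)) (rtime q) B.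
Proof.
move=> q0 bl mB; set L := sort later (lift l).
have mE := measurable_revent l.
rewrite -(mrestricted_lawE P mE (measurable_rproc q)).
apply: emeasure_ext => //.
- rewrite mrestricted_lawE preimage_setT setIT.
  by apply: etrans (revent_mass (before_ge0 bl)) _; apply/esym/predict_setT.
- rewrite mrestricted_lawE preimage_setT setIT.
  by rewrite -ge0_fin_numE//; exact: fin_num_measure.
- move=> r; rewrite mrestricted_lawE; apply: etrans _ (revent_cons r q0 bl).
  congr (P _).
  apply/seteqP; split => u; rewrite /revent /eray/=.
    by move=> [h1 h2]; apply/andP.
  by move=> /andP[].
Qed.

Let markov_revent q q' l B : (0 <= q)%R -> (q <= q')%R -> before q l ->
  measurable B ->
  P (revent l `&` Z q' @^-1` B) =
  \int[P]_(u in revent l) p (rtime q) (rtime q') (Z q u) B.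
Proof.
move=> q0 qq' bl mB; have q'0 := le_trans q0 qq'.
have bl' : before q' l.
  by apply: sub_all bl => c /andP[-> /= h]; exact: le_trans qq'.
rewrite law// -(predict_CK x0 CK e_ge mA (t := rtime q))//; last 2 first.
- have lt := lift_time bl.
  have : {subset sort later (lift l) <= lift l} by move=> c; rewrite mem_sort.
  case: (sort later (lift l)) => [_|c l' /(_ c (mem_head _ _))/lt//].
  by rewrite /rtime lerDl ler0q.
- by rewrite /rtime lerD2l ler_rat.
transitivity (\int[mrestricted_law P (measurable_revent l) (measurable_rproc q)]_y
    p (rtime q) (rtime q') y B).
  apply: eq_measure_integral => C mC _; apply/esym.
  by apply: etrans (law q0 bl mC); exact: mrestricted_lawE.
apply: ge0_integral_restricted_law => //; exact: measurable_kernel.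
Qed.

Let revents q : set_system (measurableTypeR R) :=
  [set C | exists l, before q l /\ C = revent l].

Let past_revents q : <<s past_gen Z q >> `<=` <<s revents q >>.
Proof.
apply: smallest_sub; first exact: smallest_sigma_algebra.
move=> _ [r [rq [B [mB ->]]]].
suff : measurable_fun (setT : set (g_sigma_algebraType (revents q))) (Z r).
  by move=> /(_ measurableT B mB); rewrite setTI.
apply: measurable_fun_eray => y; apply: sub_sigma_algebra.
exists [:: (r, y)]; split; first by rewrite /before /= rq.
by apply/seteqP; split => u /=; rewrite /revent /eray /= andbT.
Qed.

(** Both sides are finite measures in [C], and the events [revent l] before [q] form a pi-system
    that generates the past; on them the identity is Chapman-Kolmogorov for the chain. *)
Lemma rproc_markov q q' C B : (0 <= q)%R -> (q <= q')%R ->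
  <<s past_gen Z q >> C -> measurable B ->
  P (C `&` Z q' @^-1` B) = \int[P]_(u in C) p (rtime q) (rtime q') (Z q u) B.
Proof.
move=> q0 qq' sC mB.
have mZB : measurable (Z q' @^-1` B).
  by rewrite -[X in measurable X]setTI; exact: measurable_rproc.
have mp : measurable_fun setT (fun u => p (rtime q) (rtime q') (Z q u) B).
  apply: (measurableT_comp (measurable_kernel _ _ mB)).
  exact: measurable_rproc.
have p0 u : 0 <= p (rtime q) (rtime q') (Z q u) B by [].
change (mrestr P mZB C = mdensity P mp p0 C).
apply: (finite_measure_ext (G := revents q)) => //.
- by move=> _ [l [_ ->]]; exact: measurable_revent.
- move=> _ _ [l [bl ->]] [l' [bl' ->]]; exists (l ++ l'); split.
    by rewrite /before all_cat; apply/andP.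
  by apply/seteqP; split => u; rewrite /revent/= all_cat => /andP.
- by exists [::]; split => //; apply/seteqP.
- by move=> _ [l [bl ->]]; exact: markov_revent.
- by rewrite -ge0_fin_numE//; exact: fin_num_measure.
- exact: past_revents.
Qed.

Lemma rproc_start : P (Z 0%R @^-1` [set x0]) = 1.
Proof.
have mx : measurable [set x0] by exact: emeasurable_set1.
have := @law 0%R [::] [set x0] (lexx _) isT mx.
rewrite (_ : revent [::] = setT); last by apply/seteqP.
rewrite setTI => ->; rewrite (predictE p s x0 e mA _ _ mx).
rewrite (eq_measure_integral (\d_x0)) => [|C mC _]; last exact: chain_nil.
rewrite integral_dirac//; last exact: measurable_kernel.
rewrite diracT mul1e /rtime rmorph0 addr0 [LHS]p_id//.
by rewrite diracE mem_set.
Qed.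

End rational_process.

Lemma exists_rational_process (R : realType)
    (p : R -> R -> R.-pker (\bar R) ~> (\bar R)) (s : R) (x0 : \bar R) :
  (forall a b c x B, (s <= a)%R -> (a <= b)%R -> (b <= c)%R ->
    measurable B -> p a c x B = \int[p a b x]_y p b c y B) ->
  (forall a x B, (s <= a)%R -> measurable B -> p a a x B = \d_x B) ->
  exists (P : probability (measurableTypeR R) R)
    (Z : rat -> measurableTypeR R -> \bar R),
    [/\ forall q, measurable_fun setT (Z q),
      P (Z 0%R @^-1` [set x0]) = 1 &
      forall (q q' : rat) C B, (0 <= q)%R -> (q <= q')%R ->
        <<s past_gen Z q >> C -> measurable B ->
        P (C `&` Z q' @^-1` B) =
        \int[P]_(u in C) p (rtime s q) (rtime s q') (Z q u) B].
Proof.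
move=> CK p_id.
pose e n : R := rtime s `|(coord n).1|%R.
have e_ge i : (s <= e i)%R by rewrite /e /rtime lerDl ler0q.
pose mA i := measurable_coord R i.
have mass_fin l : mass p s x0 e mA l \is a fin_num.
  by exact: fin_num_measure.
have [||||P [b [mb Pb]]] := @exists_bits_of_weights R (fine \o mass p s x0 e mA).
- by rewrite /= mass_nil.
- by move=> l; exact: fine_ge0.
- by move=> l l' /perm_mass ll'; rewrite /= ll'.
- move=> i l il; rewrite /= -fineD//; congr fine.
  exact: (mass_cons x0 CK e_ge mA il).
exists P, (rproc b).
have Pb' l : uniq (map fst l) ->
    P [set u | all (fun c => b c.1 u == c.2) l] = mass p s x0 e mA l.
  by move=> ul; rewrite Pb//= fineK.
split.
- exact: measurable_rproc.
- exact: (rproc_start p_id mb Pb').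
- move=> q q' C B; exact: (rproc_markov CK p_id mb Pb').
Qed.

(** * Convergence in the extended line and the function exp(-y) *)

Section extended_limits.
Variable R : realType.

Lemma ecvgP {I : Type} (F : set_system I) {FF : Filter F} (f : I -> \bar R) l :
  f @ F --> l <->
  (forall a : R, a%:E < l -> \forall i \near F, a%:E < f i) /\
  (forall b : R, l < b%:E -> \forall i \near F, f i < b%:E).
Proof.
split=> [fl|[H1 H2]].
  split=> a al; first exact: (fl _ (open_ereal_gt' al)).
  exact: (fl _ (open_ereal_lt' al)).
case: l H1 H2 => [l| |] H1 H2.
- move=> A /= [e /= e0 eA].
  have h1 := H1 (l - e)%R; have h2 := H2 (l + e)%R.
  rewrite lte_fin ltrBlDr ltrDl in h1; rewrite lte_fin ltrDl in h2.
  change (\forall i \near F, A (f i)); near=> i.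
  have h1i : (l - e)%:E < f i by near: i; exact: h1 e0.
  have h2i : f i < (l + e)%:E by near: i; exact: h2 e0.
  case: (f i) h1i h2i => [r| |]//; rewrite !lte_fin => h1i h2i.
  by apply: eA; rewrite /ball_/= ltr_norml; apply/andP; split; lra.
- by apply/cvgeyPgt => A; apply: H1; rewrite ltry.
- by apply/cvgeNyPlt => A; apply: H2; rewrite ltNyr.
Unshelve. all: by end_near. Qed.

(* The absolute value only serves to make it bounded on the whole line. *)
Definition expNe (y : \bar R) : R := if y is r%:E then expR (- `|r|) else 0%R.

Lemma expNe_ge0 y : (0 <= expNe y)%R.
Proof. by case: y => //= r; exact: expR_ge0. Qed.

Lemma expNe_le1 y : (expNe y <= 1)%R.
Proof. by case: y => //= r; rewrite expR_le1 oppr_le0. Qed.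

Lemma expNe_continuous : continuous expNe.
Proof.
case=> [r| |].
- apply/cvgrPdist_lt => e e0; apply/nbhs_EFin.
  have /cvgrPdist_lt : (fun x : R => expR (- `|x|)) @ r --> expR (- `|r|).
    apply: continuous_cvg; first exact: continuous_expR.
    by apply: cvgN; exact: norm_continuous.
  exact.
- apply/(@cvgrPdist_lt _ _ _ (nbhs (+oo : \bar R)) (@nbhs_filter _ _)) => e e0; exists (- ln e)%R; split; first exact: num_real.
  move=> [r| |]// h; last by rewrite /= subr0 normr0.
  rewrite lte_fin in h; rewrite /= sub0r normrN ger0_norm ?expR_ge0//.
  rewrite -[ltRHS]lnK ?posrE// ltr_expR ltrNl (lt_le_trans h)//.
  exact: ler_norm.
- apply/(@cvgrPdist_lt _ _ _ (nbhs (-oo : \bar R)) (@nbhs_filter _ _)) => e e0; exists (ln e)%R; split; first exact: num_real.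
  move=> [r| |]// h; last by rewrite /= subr0 normr0.
  rewrite lte_fin in h; rewrite /= sub0r normrN ger0_norm ?expR_ge0//.
  rewrite -[ltRHS]lnK ?posrE// ltr_expR (le_lt_trans _ h)//.
  by rewrite lerNl -normrN ler_norm.
Qed.

Lemma measurable_expNe : measurable_fun setT expNe.
Proof.
rewrite (_ : expNe = fun y => if y \is a fin_num then expR (- `|fine y|) else 0%R);
  last by apply/funext => -[].
apply: measurable_fun_ifT => //.
- apply: (measurable_fun_bool true).
  exact: emeasurable_fin_num measurableT (@measurable_id _ _ _).
- apply: measurableT_comp => //; apply: measurableT_comp => //.
  exact: measurableT_comp.
Qed.

Lemma expNe_lt (x y : \bar R) : 0 <= x -> x < y -> (expNe y < expNe x)%R.
Proof.
case: x => [x| |]//; case: y => [y| |]//; rewrite ?lee_fin ?lte_fin => x0 xy /=.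
  by rewrite ltr_expR ltrN2 !ger0_norm// (le_trans x0)// ltW.
exact: expR_gt0.
Qed.

Lemma expNeD (x y : \bar R) : 0 <= x -> 0 <= y ->
  expNe (x + y) = (expNe x * expNe y)%R.
Proof.
case: x => [x| |]//; case: y => [y| |]//; rewrite ?lee_fin => x0 y0 /=;
  rewrite ?mul0r ?mulr0//.
by rewrite !ger0_norm ?addr_ge0// opprD expRD.
Qed.

End extended_limits.

(** * Laplace functionals of the branching kernels *)

Definition bounded_measurable (R : realType) d (T : measurableType d) (g : T -> R) :=
  measurable_fun setT g /\ exists M, forall y, (`|g y| <= M)%R.

Lemma bounded_measurable_integrable (R : realType) d (T : measurableType d)
    (mu : {measure set T -> \bar R}) (g : T -> R) :
  mu setT < +oo -> bounded_measurable g -> mu.-integrable setT (EFin \o g).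
Proof.
move=> muoo [mg [M gM]]; apply: measurable_bounded_integrable => //.
exists M; split; first exact: num_real.
by move=> x Mx y _ /=; rewrite (le_trans (gM y))// ltW.
Qed.

Lemma expNe_bounded (R : realType) : bounded_measurable (@expNe R).
Proof.
split; first exact: measurable_expNe.
by exists 1%R => y; rewrite ger0_norm ?expNe_ge0// expNe_le1.
Qed.

Section kernel_expectation.
Variables (R : realType) (k : R -> R -> R.-pker (\bar R) ~> (\bar R)).
Implicit Types (g : \bar R -> R) (a b c : R) (x y z : \bar R).

Definition kexp g a b y : R := fine (\int[k a b y]_z (g z)%:E).

Lemma kernel_fin a b y : k a b y setT < +oo.
Proof. by rewrite prob_kernel ltry. Qed.

Lemma kernel_integrable g a b y : bounded_measurable g ->
  (k a b y).-integrable setT (EFin \o g).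
Proof. by apply: bounded_measurable_integrable; exact: kernel_fin. Qed.

Lemma kexpE g a b y : bounded_measurable g ->
  \int[k a b y]_z (g z)%:E = (kexp g a b y)%:E.
Proof.
move=> bg; rewrite /kexp fineK//; apply: integrable_fin_num => //.
exact: kernel_integrable.
Qed.

Lemma kexp_ge0 g a b y : (forall z, 0 <= g z)%R -> (0 <= kexp g a b y)%R.
Proof.
by move=> g0; apply: fine_ge0; apply: integral_ge0 => z _; rewrite lee_fin.
Qed.

Lemma kexp_le g h a b y : bounded_measurable g -> bounded_measurable h ->
  (forall z, g z <= h z)%R -> (kexp g a b y <= kexp h a b y)%R.
Proof.
move=> bg bh gh; rewrite -lee_fin -!kexpE//; apply: le_integral => //.
- exact: kernel_integrable.
- exact: kernel_integrable.
- by move=> z _; rewrite lee_fin.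
Qed.

Lemma kexp_cst (r : R) a b y : kexp (fun=> r) a b y = r.
Proof. by rewrite /kexp integral_cst//= prob_kernel mule1. Qed.

Lemma bounded_measurable_cst (r : R) : bounded_measurable (fun _ : \bar R => r).
Proof. by split => //; exists `|r|%R. Qed.

Lemma measurable_kexp g a b : bounded_measurable g ->
  measurable_fun setT (kexp g a b).
Proof.
move=> bg; apply: measurableT_comp => //.
under eq_fun do rewrite integralE.
have mg : measurable_fun setT (EFin \o g) by apply/measurable_EFinP; case: bg.
by apply: emeasurable_funB; apply: measurable_fun_integral_kernel => //;
  (try exact: measurable_kernel); [exact: measurable_funepos|exact: measurable_funeneg].
Qed.

Lemma kexp_bounded g a b : bounded_measurable g -> bounded_measurable (kexp g a b).
Proof.
move=> bg; split; first exact: measurable_kexp.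
case: (bg) => mg [M gM]; exists M => y; rewrite ler_norml; apply/andP; split.
  rewrite -[leLHS](kexp_cst _ a b y); apply: kexp_le => //.
    exact: bounded_measurable_cst.
  by move=> z; have := gM z; rewrite ler_norml => /andP[].
rewrite -[leRHS](kexp_cst _ a b y); apply: kexp_le => //.
  exact: bounded_measurable_cst.
by move=> z; have := gM z; rewrite ler_norml => /andP[].
Qed.

End kernel_expectation.

Lemma integral_diracE (R : realType) (g : \bar R -> R) (y : \bar R) :
  measurable_fun setT g -> \int[\d_y]_z (g z)%:E = (g y)%:E.
Proof.
move=> mg; have mg' : measurable_fun setT (EFin \o g) by exact/measurable_EFinP.
by rewrite (integral_dirac y measurableT mg') diracT mul1e.
Qed.

Section branching_kernels_theory.
Variables (R : realType) (k : R -> R -> R.-pker (\bar R) ~> (\bar R)).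
Hypothesis bk : branching_kernels k.
Implicit Types (g h : \bar R -> R) (a b c : R) (x y z : \bar R).
Local Notation kexp := (kexp k).

Lemma kernel_neg0 a b y : (0 <= a)%R -> (a <= b)%R -> 0 <= y ->
  k a b y [set z | z < 0] = 0.
Proof. by case: bk => H _; exact: H. Qed.

Lemma kernel_id a y B : (0 <= a)%R -> 0 <= y -> measurable B ->
  k a a y B = \d_y B.
Proof. by case: bk => _ [H _]; exact: H. Qed.

Lemma kernel_CK a b c y B : (0 <= a)%R -> (a <= b)%R -> (b <= c)%R -> 0 <= y ->
  measurable B -> k a c y B = \int[k a b y]_z k b c z B.
Proof. by case: bk => _ [_ [H _]]; exact: H. Qed.

Lemma kernel_branching a b (x y : R) B : (0 <= a)%R -> (a <= b)%R -> (0 <= x)%R ->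
  (0 <= y)%R -> measurable B ->
  Defs.conv (k a b x%:E) (k a b y%:E) B = k a b (x + y)%:E B.
Proof. by case: bk => _ [_ [_ [_ [H _]]]]; exact: H. Qed.

Lemma kernel0 a b B : (0 <= a)%R -> (a <= b)%R -> measurable B ->
  k a b 0 B = \d_(0 : \bar R) B.
Proof. by case: bk => _ [_ [_ [_ [_ [H _]]]]]; exact: H. Qed.

Lemma kernely a b B : (0 <= a)%R -> (a <= b)%R -> measurable B ->
  k a b +oo B = \d_(+oo : \bar R) B.
Proof. by case: bk => _ [_ [_ [_ [_ [_ H]]]]]; exact: H. Qed.

Lemma kernel_ge0_ae a b y (f : \bar R -> \bar R) : (0 <= a)%R -> (a <= b)%R ->
  0 <= y -> (k a b y).-integrable setT f ->
  \int[k a b y]_z f z = \int[k a b y]_(z in [set z | 0 <= z]) f z.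
Proof.
move=> a0 ab y0 fi; have mN : measurable [set z : \bar R | z < 0].
  by rewrite -set_itvNyo; exact: emeasurable_itv.
rewrite (negligible_integral mN measurableT fi (kernel_neg0 a0 ab y0)).
by congr (\int[_]_(z in _) _); apply/seteqP; split => z /=;
  [move=> [_ /negP]; rewrite -leNgt|move=> z0; split => //; apply/negP; rewrite -leNgt].
Qed.

Lemma kexp_nonneg g a b y : (0 <= a)%R -> (a <= b)%R -> 0 <= y ->
  bounded_measurable g ->
  \int[k a b y]_(z in [set z | 0 <= z]) (g z)%:E = (kexp g a b y)%:E.
Proof.
by move=> a0 ab y0 bg; rewrite -kexpE// kernel_ge0_ae//; exact: kernel_integrable.
Qed.

Lemma kexp_le_nonneg g h a b y : (0 <= a)%R -> (a <= b)%R -> 0 <= y ->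
  bounded_measurable g -> bounded_measurable h ->
  (forall z, 0 <= z -> (g z <= h z)%R) -> (kexp g a b y <= kexp h a b y)%R.
Proof.
move=> a0 ab y0 bg bh gh; rewrite -lee_fin -!kexp_nonneg//.
have m0 : measurable [set z : \bar R | 0 <= z].
  by rewrite -set_itvcy; exact: emeasurable_itv.
apply: le_integral => //.
- by apply: integrableS (kernel_integrable _ _ _ _ bg).
- by apply: integrableS (kernel_integrable _ _ _ _ bh).
- by move=> z; rewrite inE/= lee_fin; exact: gh.
Qed.

Lemma kexp_eq_nonneg g h a b y : (0 <= a)%R -> (a <= b)%R -> 0 <= y ->
  bounded_measurable g -> bounded_measurable h ->
  (forall z, 0 <= z -> g z = h z) -> kexp g a b y = kexp h a b y.
Proof.
move=> a0 ab y0 bg bh gh.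
by apply/eqP; rewrite eq_le !kexp_le_nonneg// => z z0; rewrite gh.
Qed.

(** Weak continuity (K3) along an arbitrary filter: both times and the state may move together,
    provided that they end up in [DeltaX]. *)
Lemma kexp_cvg g (I : Type) (F : set_system I) {FF : Filter F}
    (a b y : I -> R) (a0 b0 y0 : R) :
  bounded_measurable g -> {within [set y | 0 <= y], continuous g} ->
  (\forall i \near F, 0 <= a i /\ a i <= b i /\ 0 <= y i)%R ->
  a @ F --> a0 -> b @ F --> b0 -> y @ F --> y0 ->
  (0 <= a0)%R -> (a0 <= b0)%R -> (0 <= y0)%R ->
  kexp g (a i) (b i) (y i)%:E @[i --> F] --> kexp g a0 b0 y0%:E.
Proof.
move=> bg cg near_ok aa bb yy a00 ab00 y00.
have [_ [_ [_ [K3 _]]]] := bk.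
have /subspace_continuousP/(_ (a0, b0, y0)) := K3 g cg.
move=> /(_ (conj a00 (conj ab00 y00))).
rewrite /from_subspace /= kexp_nonneg// => H.
have path : (a i, b i, y i) @[i --> F] --> within (@DeltaX R) (nbhs (a0, b0, y0)).
  move=> A /= wA.
  have h : (a i, b i, y i) @[i --> F] --> (a0, b0, y0).
    exact: (cvg_pair (cvg_pair aa bb) yy).
  have := h _ wA; rewrite /nbhs/= => hA.
  change (\forall i \near F, A (a i, b i, y i)).
  have hA' : \forall i \near F, DeltaX (a i, b i, y i) -> A (a i, b i, y i) := hA.
  by near=> i; apply: (near hA' i) => //; apply: (near near_ok i).
suff h : (kexp g (a i) (b i) (y i)%:E)%:E @[i --> F] --> (kexp g a0 b0 y0%:E)%:E.
  exact: (fine_cvg h).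
apply: cvg_trans (cvg_comp _ _ path H); apply: near_eq_cvg; near=> i.
have [ai [bi yi]] : (0 <= a i /\ a i <= b i /\ 0 <= y i)%R by near: i.
by rewrite /= kexp_nonneg// lee_fin.
Unshelve. all: by end_near. Qed.

Lemma kexp_id g a y : (0 <= a)%R -> 0 <= y -> measurable_fun setT g ->
  kexp g a a y = g y.
Proof.
move=> a0 y0 mg; rewrite /kexp (eq_measure_integral (\d_y)).
  by rewrite integral_diracE.
by move=> B mB _; exact: kernel_id.
Qed.

Lemma kexp_zero g a b : (0 <= a)%R -> (a <= b)%R -> measurable_fun setT g ->
  kexp g a b 0 = g 0.
Proof.
move=> a0 ab mg; rewrite /kexp (eq_measure_integral (\d_(0 : \bar R))).
  by rewrite integral_diracE.
by move=> B mB _; exact: kernel0.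
Qed.

Lemma kexp_y g a b : (0 <= a)%R -> (a <= b)%R -> measurable_fun setT g ->
  kexp g a b +oo = g +oo.
Proof.
move=> a0 ab mg; rewrite /kexp (eq_measure_integral (\d_(+oo : \bar R))).
  by rewrite integral_diracE.
by move=> B mB _; exact: kernely.
Qed.

Lemma integral_kgiry (p : R.-pker (\bar R) ~> (\bar R)) y (f : \bar R -> \bar R) :
  \int[kgiry p measurableT y]_z f z = \int[p y]_z f z.
Proof.
by apply: eq_measure_integral => B mB _; rewrite /kgiry /= /kres /mrestr setIT.
Qed.

Lemma kexp_CK g a b c y : (0 <= a)%R -> (a <= b)%R -> (b <= c)%R -> 0 <= y ->
  bounded_measurable g -> (forall z, 0 <= g z)%R ->
  kexp (kexp g b c) a b y = kexp g a c y.
Proof.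
move=> a0 ab bc y0 bg g0; have mg : measurable_fun setT (EFin \o g).
  by apply/measurable_EFinP; case: bg.
have H := @giry_int_bind _ _ _ _ _ (kgiry (k a b) measurableT y) _
  (measurable_kgiry (k b c) measurableT) _ mg (fun z => g0 z).
apply: EFin_inj; rewrite -!kexpE//; last exact: kexp_bounded.
transitivity (\int[kgiry (k a b) measurableT y]_z
    \int[kgiry (k b c) measurableT z]_w (g w)%:E).
  rewrite integral_kgiry; apply: eq_integral => z _.
  by rewrite integral_kgiry kexpE.
rewrite /giry_int in H; rewrite -H.
apply: eq_measure_integral => B mB _; rewrite [LHS]giry_bindE//.
rewrite integral_kgiry (kernel_CK a0 ab bc y0 mB).
by apply: eq_integral => z _; rewrite /kgiry /= /kres /mrestr setIT.
Qed.

(** The convolution is the image under addition of the product measure, and exp(-(u + v)) factors,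
    so Fubini splits the integral. *)
Lemma kexp_expNeD a b (x y : R) : (0 <= a)%R -> (a <= b)%R -> (0 <= x)%R ->
  (0 <= y)%R -> kexp (@expNe R) a b (x + y)%:E =
    (kexp (@expNe R) a b x%:E * kexp (@expNe R) a b y%:E)%R.
Proof.
move=> a0 ab x0 y0; have be := expNe_bounded R.
have me := @measurable_expNe R.
have e0 z : 0 <= (expNe z)%:E by rewrite lee_fin expNe_ge0.
have mE : measurable_fun setT (EFin \o @expNe R) by exact/measurable_EFinP.
pose mu1 := kgiry (k a b) measurableT x%:E.
pose mu2 := kgiry (k a b) measurableT y%:E.
pose add (z : \bar R * \bar R) := z.1 + z.2.
have madd : measurable_fun setT add by exact: emeasurable_funD.
have law B : measurable B -> giry_map madd (giry_prod (mu1, mu2)) B =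
    k a b (x + y)%:E B.
  move=> mB; rewrite -(kernel_branching a0 ab x0 y0 mB) /Defs.conv.
  have mi : measurable_fun setT (fun w => (\1_B (add w))%:E : \bar R).
    apply/measurable_EFinP; apply: measurableT_comp madd.
    exact: measurable_indic.
  have i0 w : 0 <= (\1_B (add w))%:E :> \bar R by rewrite lee_fin.
  have := giry_int_prod1 mu1 mu2 mi i0; rewrite /giry_int => H.
  rewrite -(integral_kgiry (k a b)).
  under eq_integral do rewrite -(integral_kgiry (k a b)).
  rewrite -H.
  rewrite -[RHS]/(giry_int _ ((fun z => (\1_B z)%:E) \o add)) -giry_int_map//.
    by rewrite /giry_int integral_indic// setIT.
  exact/measurable_EFinP/measurable_indic.
apply: EFin_inj; rewrite EFinM -!kexpE//.
transitivity (giry_int (giry_map madd (giry_prod (mu1, mu2))) (EFin \o @expNe R)).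
  by apply: eq_measure_integral => B mB _; apply/esym/law.
have mEadd : measurable_fun setT ((EFin \o @expNe R) \o add).
  exact: measurableT_comp.
have e0add w : 0 <= ((EFin \o @expNe R) \o add) w by exact: e0.
rewrite giry_int_map// giry_int_prod1// /giry_int.
pose h (u : \bar R) := kexp (fun v => expNe (u + v)) a b y%:E.
have bv (u : \bar R) : bounded_measurable (fun v => expNe (u + v)).
  have mu : measurable_fun setT ((fun v : \bar R => u + v)).
    by apply: emeasurable_funD.
  split; first exact: (measurableT_comp me mu).
  by exists 1%R => v; rewrite ger0_norm ?expNe_ge0// expNe_le1.
have hE u : \int[mu2]_v (EFin \o @expNe R \o add) (u, v) = (h u)%:E.
  by rewrite integral_kgiry -kexpE.
have bh : bounded_measurable h.
  split.
    have mF := @measurable_fun_fubini_tonelli_F _ _ _ _ _ mu2 _ mEadd e0add.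
    apply/measurable_EFinP.
    by apply: eq_measurable_fun mF => u _; exact: hE.
  exists 1%R => u; rewrite ger0_norm; last by apply: kexp_ge0 => v; exact: expNe_ge0.
  rewrite -[leRHS](kexp_cst k 1 a b y%:E); apply: kexp_le => //.
    exact: bounded_measurable_cst.
  by move=> v; exact: expNe_le1.
rewrite integral_kgiry (eq_integral (EFin \o h)); last by move=> u _; exact: hE.
have bM r : bounded_measurable (fun v : \bar R => r * expNe v)%R.
  split; first exact: measurable_funM.
  exists `|r|%R => v; rewrite normrM ler_piMr// ger0_norm ?expNe_ge0//.
  exact: expNe_le1.
have kM r u : kexp (fun v => r * expNe v)%R a b u = (r * kexp (@expNe R) a b u)%R.
  apply: EFin_inj; rewrite -kexpE// EFinM -kexpE//.
  under eq_integral do rewrite EFinM.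
  by rewrite integralZl//; exact: kernel_integrable.
rewrite kexpE// -!kexpE// !kexpE// -EFinM mulrC -kM; congr EFin.
(* The factorisation holds for u, v >= 0, and the kernels do not charge negative points. *)
apply: (kexp_eq_nonneg a0 ab _ bh (bM _)) => // u u0.
rewrite mulrC -kM; apply: (kexp_eq_nonneg a0 ab _ (bv u) (bM _)) => //.
by move=> v v0; rewrite expNeD.
Qed.

End branching_kernels_theory.

Section laplace.
Variables (R : realType) (k : R -> R -> R.-pker (\bar R) ~> (\bar R)).
Hypothesis bk : branching_kernels k.
Implicit Types (g h : \bar R -> R) (a b c r : R) (x y z : \bar R).

Lemma kexp_affine (al be : R) g a b y : bounded_measurable g ->
  kexp k (fun z => al + be * g z)%R a b y = (al + be * kexp k g a b y)%R.
Proof.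
move=> bg; have ig := kernel_integrable k a b y bg.
rewrite /kexp.
under eq_integral do rewrite EFinD EFinM.
rewrite integralD//.
- rewrite integralZl// integral_cst//= prob_kernel mule1 kexpE//.
- by apply: kernel_integrable; exact: bounded_measurable_cst.
- exact: integrableZl.
Qed.

Lemma bounded_measurable_affine (al be : R) g : bounded_measurable g ->
  bounded_measurable (fun z => al + be * g z)%R.
Proof.
move=> [mg [M gM]]; split.
  by apply: measurable_funD => //; exact: measurable_funM.
exists (`|al| + `|be| * M)%R => z; rewrite (le_trans (ler_normD _ _))// lerD2l.
by rewrite normrM ler_wpM2l.
Qed.

Definition lap a b y : R := kexp k (@expNe R) a b y.

Lemma bounded_lap a b : bounded_measurable (lap a b).
Proof. by apply: kexp_bounded; exact: expNe_bounded. Qed.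

Lemma lap_ge0 a b y : (0 <= lap a b y)%R.
Proof. by apply: kexp_ge0 => z; exact: expNe_ge0. Qed.

Lemma lap_le1 a b y : (lap a b y <= 1)%R.
Proof.
rewrite -[leRHS](kexp_cst k 1 a b y); apply: kexp_le; [exact: expNe_bounded| |].
  exact: bounded_measurable_cst.
by move=> z; exact: expNe_le1.
Qed.

Lemma lap_CK a b c y : (0 <= a)%R -> (a <= b)%R -> (b <= c)%R -> 0 <= y ->
  kexp k (lap b c) a b y = lap a c y.
Proof.
move=> a0 ab bc y0; apply: (kexp_CK bk) => //; first exact: expNe_bounded.
exact: expNe_ge0.
Qed.

Lemma lap_id a y : (0 <= a)%R -> 0 <= y -> lap a a y = expNe y.
Proof. by move=> a0 y0; apply: (kexp_id bk) => //; exact: measurable_expNe. Qed.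

Lemma lap_y a b : (0 <= a)%R -> (a <= b)%R -> lap a b +oo = 0%R.
Proof. by move=> a0 ab; apply: (kexp_y bk) => //; exact: measurable_expNe. Qed.

Lemma lap_cvg (I : Type) (F : set_system I) {FF : Filter F}
    (a b y : I -> R) (a0 b0 y0 : R) :
  (\forall i \near F, 0 <= a i /\ a i <= b i /\ 0 <= y i)%R ->
  a @ F --> a0 -> b @ F --> b0 -> y @ F --> y0 ->
  (0 <= a0)%R -> (a0 <= b0)%R -> (0 <= y0)%R ->
  lap (a i) (b i) (y i)%:E @[i --> F] --> lap a0 b0 y0%:E.
Proof.
move=> *; apply: (kexp_cvg bk) => //; first exact: expNe_bounded.
exact/continuous_subspaceT/expNe_continuous.
Qed.

Section fixed_times.
Variables (a b : R).
Hypotheses (a0 : (0 <= a)%R) (ab : (a <= b)%R).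

Lemma lap0 : lap a b 0 = 1%R.
Proof.
rewrite /lap (kexp_zero bk)//; last exact: measurable_expNe.
by rewrite /expNe /= normr0 oppr0 expR0.
Qed.

Lemma lapD (x y : R) : (0 <= x)%R -> (0 <= y)%R ->
  lap a b (x + y)%:E = (lap a b x%:E * lap a b y%:E)%R.
Proof. exact: (kexp_expNeD bk). Qed.

Lemma lapMn (x : R) n : (0 <= x)%R -> lap a b (n%:R * x)%:E = (lap a b x%:E ^+ n)%R.
Proof.
move=> x0; elim: n => [|n ih]; first by rewrite mul0r lap0 expr0.
by rewrite -natr1 mulrDl mul1r lapD ?mulr_ge0// ih exprSr.
Qed.

(** A zero at [x] would by multiplicativity be a zero at every [x / n.+1], against continuity at 0,
    where the value is 1. *)
Lemma lap_gt0 (x : R) : (0 <= x)%R -> (0 < lap a b x%:E)%R.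
Proof.
move=> x0; rewrite lt_neqAle lap_ge0 andbT eq_sym; apply/negP => /eqP l0.
have z n : lap a b (x / n.+1%:R)%:E = 0%R.
  have : (lap a b (x / n.+1%:R)%:E ^+ n.+1)%R = 0%R.
    by rewrite -lapMn ?divr_ge0// mulrCA mulfV ?mulr1// pnatr_eq0.
  by move/eqP; rewrite expf_eq0 => /andP[_ /eqP].
have c0 : lap a b (x / n.+1%:R)%:E @[n --> \oo] --> lap a b 0%:E.
  apply: lap_cvg => //; try exact: cvg_cst.
  - by apply: nearW => n; rewrite divr_ge0.
  - rewrite -[X in _ --> X](mulr0 x); apply: cvgM; first exact: cvg_cst.
    exact: cvg_harmonic.
have zE : (fun n => lap a b (x / n.+1%:R)%:E) = (fun=> 0%R) by exact/funext.
rewrite zE lap0 in c0.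
have /eqP : (1 = 0 :> R)%R by apply: (cvg_unique _ c0) => //; exact: cvg_cst.
by rewrite oner_eq0.
Qed.

Lemma lap_le x y : 0 <= x -> x <= y -> (lap a b y <= lap a b x)%R.
Proof.
case: x => [x| |]//; case: y => [y| |]//; rewrite ?lee_fin => x0 xy.
- rewrite -(subrK x y) lapD ?subr_ge0// ler_piMl ?lap_ge0//; exact: lap_le1.
- by rewrite lap_y// lap_ge0.
Qed.

(** For large [n] the point [y / n] lies below [x], where monotonicity squeezes the value to 1; the
    n-th power carries this back to [y]. *)
Lemma lap_eq1 (x y : R) : (0 < x)%R -> (0 <= y)%R -> lap a b x%:E = 1%R ->
  lap a b y%:E = 1%R.
Proof.
move=> x0 y0 l1; pose n := (Num.truncn (y / x)).+1.
have yn : (y / n%:R <= x)%R.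
  by rewrite ler_pdivrMr ?ltr0n// mulrC -ler_pdivrMr// ltW// truncnS_gt.
have : lap a b (y / n%:R)%:E = 1%R.
  apply/eqP; rewrite eq_le lap_le1 -[X in (X <= _)%R]l1.
  apply: lap_le; rewrite lee_fin; [|exact: yn].
  by apply: divr_ge0; [exact: y0|exact: ler0n].
by move=> h; rewrite -(expr1n _ n) -h -lapMn ?divr_ge0// mulrCA mulfV ?mulr1// pnatr_eq0.
Qed.

End fixed_times.

(** Otherwise let [r0] be the first time with [lap a r0 1 = 1]. It is attained by continuity in
    time, and exceeds [a] because [lap a a 1] is exp(-1). For [r] in [a, r0) it turns out that
    [lap r r0 1 = 1], and letting [r] increase to [r0] contradicts [lap r0 r0 1 = exp(-1)]. *)
Lemma lap1_lt1 a b : (0 <= a)%R -> (a <= b)%R -> (lap a b 1%:E < 1)%R.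
Proof.
move=> a0 ab; rewrite lt_neqAle lap_le1 andbT; apply/negP => /eqP lab1.
pose A := [set r | a <= r /\ lap a r 1%:E = 1]%R.
have A0 : A !=set0 by exists b.
have lA : lbound A a by move=> r [].
have hA : has_inf A by split => //; exists a.
pose r0 := inf A.
have ar0 : (a <= r0)%R by exact: lb_le_inf.
have l01 : lap a a 1%:E != 1%R.
  by rewrite lap_id//= normr1 lt_eqF// expR_lt1 oppr_lt0.
have lr0 : lap a r0 1%:E = 1%R.
  apply/eqP; rewrite eq_le lap_le1 leNgt; apply/negP => lr0.
  have : \forall r \near r0, (a <= r)%R -> (lap a r 1%:E < 1)%R.
    have : lap a r 1%:E @[r --> within [set r | (a <= r)%R] (nbhs r0)] --> lap a r0 1%:E.
      apply: lap_cvg => //; try exact: cvg_cst.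
        by near=> r; split => //; split => //; near: r; exact: withinT.
      exact: cvg_within.
    move=> /(_ [set z | (z < 1)%R]); apply; exact: lt_nbhsl.
  move=> /nbhs_ballP[e /= e0 eH].
  have [r [ar lr1] rr0] := inf_adherent e0 hA.
  have r0r : (r0 <= r)%R by apply: ge_inf => //; exists a.
  have : (lap a r 1%:E < 1)%R.
    by apply: eH => //; rewrite /ball/= ltr_norml; apply/andP; split; lra.
  by rewrite lr1 ltxx.
have {}ar0 : (a < r0)%R.
  by rewrite lt_neqAle ar0 andbT; apply: contra l01 => /eqP e; rewrite {2}e lr0.
(* If not, [lap r r0] is below 1 away from 0, yet its mean under [k a r 1] is [lap a r0 1 = 1]. So
   [k a r 1] sits at 0 and [lap a r 1 = 1], against the minimality of [r0]. *)
have H r : (a <= r)%R -> (r < r0)%R -> lap r r0 1%:E = 1%R.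
  move=> ar rr0; have r00 : (0 <= r)%R by exact: le_trans ar.
  apply/eqP; rewrite eq_le lap_le1 leNgt; apply/negP => l1.
  suff lr : lap a r 1%:E = 1%R.
    by have : (r0 <= r)%R; [apply: ge_inf; [exists a|]|rewrite leNgt rr0].
  apply/eqP; rewrite eq_le lap_le1; apply/ler_addgt0Pl => e e0.
  have le1 : (lap r r0 e%:E < 1)%R.
    rewrite lt_neqAle lap_le1 andbT; apply/negP => /eqP h.
    by move: l1; rewrite (lap_eq1 r00 (ltW rr0) e0 ler01 h) ltxx.
  (* With this slope, [1 - e - C + C * lap r r0 z] lies below exp(-z): for z >= e it is at most -e,
     since [lap r r0 z <= 1 - 1 / C], and for z < e it is at most 1 - e. Its mean under [k a r 1] is
     1 - e. *)
  pose C := ((1 - lap r r0 e%:E)^-1)%R.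
  have C0 : (0 < C)%R by rewrite invr_gt0 subr_gt0.
  have : (kexp k (fun z => (1 - e - C) + C * lap r r0 z) a r 1%:E <= lap a r 1%:E)%R.
    apply: (kexp_le_nonneg bk) => //.
    - exact/bounded_measurable_affine/bounded_lap.
    - exact: expNe_bounded.
    move=> z z0; have [ez|ze] := leP e%:E z.
      have : (lap r r0 z <= lap r r0 e%:E)%R.
        by apply: lap_le => //; [exact: ltW|rewrite lee_fin ltW].
      rewrite -(ler_pM2l C0) => h.
      have CE : (C * (1 - lap r r0 e%:E) = 1)%R.
        by rewrite mulVf// subr_eq0 eq_sym lt_eqF.
      by have := expNe_ge0 z; move: CE; rewrite mulrBr; lra.
    have h1 : (C * lap r r0 z <= C)%R by rewrite ler_piMr ?lap_le1// ltW.
    have : (1 - e <= expNe z)%R; last by lra.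
    case: z z0 ze {h1} => [z| |]//; rewrite lee_fin lte_fin => z0 ze /=.
    rewrite ger0_norm//; have := @expR_ge1Dx R (- z); lra.
  rewrite kexp_affine; last exact: bounded_lap.
  by rewrite lap_CK ?lee_fin ?lr0//; [lra|exact: ltW].
have nr : \forall r \near r0^'-, (0 <= r /\ r <= r0 /\ 0 <= (1 : R))%R.
  near=> r; have ar : (a <= r)%R by near: r; exact: nbhs_left_ge.
  have rr0 : (r <= r0)%R by near: r; exact: nbhs_left_le.
  by split; [exact: le_trans ar|split].
have c0 : lap r r0 1%:E @[r --> r0^'-] --> lap r0 r0 1%:E.
  apply: (lap_cvg (y := fun=> 1%R) nr) => //; try exact: cvg_cst.
  - exact: cvg_at_left_filter cvg_id.
  - by apply: le_trans (ltW ar0).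
have c1 : lap r r0 1%:E @[r --> r0^'-] --> (1 : R)%R.
  apply: cvg_near_cst; near=> r; apply: H; last by near: r; exact: nbhs_left_lt.
  by near: r; exact: nbhs_left_ge.
have /eqP : lap r0 r0 1%:E = 1%R by exact: (cvg_unique _ c0 c1).
apply/negP; rewrite lap_id ?lee_fin//; last by apply: le_trans (ltW ar0).
by rewrite /= normr1 lt_eqF// expR_lt1 oppr_lt0.
Unshelve. all: by end_near. Qed.

Lemma lap_lt1 a b x : (0 <= a)%R -> (a <= b)%R -> 0 < x -> (lap a b x < 1)%R.
Proof.
move=> a0 ab; case: x => [x| |]//; last by rewrite lap_y.
rewrite lte_fin => x0; rewrite lt_neqAle lap_le1 andbT; apply/negP => /eqP l1.
by have := lap1_lt1 a0 ab; rewrite (lap_eq1 a0 ab x0 ler01 l1) ltxx.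
Qed.

Lemma lap_lt a b x y : (0 <= a)%R -> (a <= b)%R -> 0 <= x -> x < y ->
  (lap a b y < lap a b x)%R.
Proof.
move=> a0 ab; case: x => [x| |]//; case: y => [y| |]//; rewrite ?lee_fin ?lte_fin => x0 xy.
  have -> : lap a b y%:E = (lap a b (y - x)%:E * lap a b x%:E)%R.
    by rewrite -lapD// ?subr_ge0 ?(ltW xy)// subrK.
  rewrite gtr_pMl.
    by apply: lap_lt1 => //; rewrite lte_fin subr_gt0.
  exact: lap_gt0.
by rewrite (lap_y a0 ab) lap_gt0.
Qed.

Lemma lap_small a b (e : R) : (0 <= a)%R -> (a <= b)%R -> (0 < e)%R ->
  exists n : nat, (lap a b n%:R%:E < e)%R.
Proof.
move=> a0 ab e0.
have : (lap a b 1%:E ^+ n)%R @[n --> \oo] --> (0 : R)%R.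
  by apply: cvg_expr; rewrite ger0_norm ?lap_ge0//; exact: lap1_lt1.
move=> /cvgrPdist_lt/(_ _ e0)[n _ /(_ n (leqnn n))].
rewrite sub0r normrN ger0_norm ?exprn_ge0 ?lap_ge0// -(lapMn a0 ab)// mulr1.
by exists n.
Qed.

Lemma lap_near1 a b (e : R) : (0 <= a)%R -> (a <= b)%R -> (0 < e)%R ->
  exists2 d : R, (0 < d)%R & (1 - e < lap a b d%:E)%R.
Proof.
move=> a0 ab e0.
have : lap a b n.+1%:R^-1%:E @[n --> \oo] --> lap a b 0%:E.
  apply: lap_cvg => //; try exact: cvg_cst.
    by apply: nearW => n; rewrite invr_ge0.
  exact: cvg_harmonic.
rewrite (lap0 a0 ab) => /cvgrPdist_lt/(_ _ e0)[n _ /(_ n (leqnn n))].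
move=> /ltr_normlW h; exists n.+1%:R^-1%R; first by rewrite invr_gt0.
by rewrite ltrBlDr -ltrBlDl.
Qed.

(** At a finite limit this is (K3). At oo, [|g - g oo|] is bounded by [e / 2 + C exp(-z)], whose
    mean is [e / 2 + C * lap (a i) (b i) (y i)]. Once [y i] exceeds [n], the last factor is at most
    [lap (a i) (b i) n], which is close to [lap a0 b0 n], and this is small for a suitable [n]. *)
Lemma kexp_feller g (I : Type) (F : set_system I) {FF : Filter F}
    (a b : I -> R) (y : I -> \bar R) (a0 b0 : R) (y0 : \bar R) :
  bounded_measurable g -> continuous g ->
  (\forall i \near F, (0 <= a i)%R /\ (a i <= b i)%R /\ 0 <= y i) ->
  a @ F --> a0 -> b @ F --> b0 -> y @ F --> y0 ->
  (0 <= a0)%R -> (a0 <= b0)%R -> 0 <= y0 ->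
  kexp k g (a i) (b i) (y i) @[i --> F] --> kexp k g a0 b0 y0.
Proof.
move=> bg cg ok aa bb yy a00 ab00 y00; case: y0 yy y00 => [r| |]// yy r0.
  have fyy : fine (y i) @[i --> F] --> r by exact: fine_cvg yy.
  have yfin : \forall i \near F, y i \is a fin_num.
    have [H1 H2] := (ecvgP _ _).1 yy.
    near=> i; have h1 : (r - 1)%:E < y i.
      by near: i; apply: H1; rewrite lte_fin ltrBlDr ltrDl.
    have h2 : y i < (r + 1)%:E by near: i; apply: H2; rewrite lte_fin ltrDl.
    by case: (y i) h1 h2.
  have ok' : \forall i \near F, (0 <= a i /\ a i <= b i /\ 0 <= fine (y i))%R.
    near=> i; have [ai [abi yi]] : (0 <= a i)%R /\ (a i <= b i)%R /\ 0 <= y i.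
      by near: i.
    by split => //; split => //; exact: fine_ge0.
  have h := kexp_cvg bk bg (continuous_subspaceT cg) ok' aa bb fyy a00 ab00 r0.
  apply: (cvg_trans _ (h FF)); apply: near_eq_cvg; near=> i.
  by rewrite /= fineK//; near: i.
rewrite (kexp_y bk a00 ab00 bg.1); apply/cvgrPdist_le => e e0.
have [mg [M gM]] := bg.
have M0 : (0 <= M)%R by exact: le_trans (gM 0).
have e20 : (0 < e / 2)%R by rewrite divr_gt0.
have /(@cvgrPdist_lt _ _ _ (nbhs (+oo : \bar R)) (@nbhs_filter _ _))
  /(_ _ e20) [A [_ HA]] := cg +oo.
pose A' : R := Num.max A 0%R.
pose C := (2 * M * expR A')%R.
have C0 : (0 <= C)%R by rewrite !mulr_ge0// expR_ge0.
have dist z : 0 <= z -> (`|g z - g +oo%E| <= e / 2 + C * expNe z)%R.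
  move=> z0; have [Az|zA] := ltP A%:E z.
    rewrite distrC (le_trans (ltW (HA z Az)))// lerDl mulr_ge0//.
    exact: expNe_ge0.
  apply: (@le_trans _ _ (2 * M)%R).
    rewrite (le_trans (ler_normB _ _))// mulr_natl mulr2n; exact: lerD.
  apply: ler_wpDl; first exact: ltW.
  case: z z0 zA => [z| |]//; rewrite !lee_fin => z0 zA.
  rewrite /C /= -mulrA -expRD ler_peMr ?mulr_ge0//.
  rewrite -[leLHS]expR0 ler_expR ger0_norm// subr_ge0.
  by rewrite /A' le_max zA.
(* [C + 1] rather than [C], which is 0 when [M] is. *)
pose e' := (e / 2 / (C + 1))%R.
have C1 : (0 < C + 1)%R by rewrite ltr_wpDl.
have e'0 : (0 < e')%R by rewrite divr_gt0.
have [n lapn] := lap_small a00 ab00 e'0.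
have cl : lap (a i) (b i) n%:R%:E @[i --> F] --> lap a0 b0 n%:R%:E.
  apply: lap_cvg => //; last exact: cvg_cst.
  by near=> i; have [? []] : (0 <= a i)%R /\ (a i <= b i)%R /\ 0 <= y i by near: i.
have lapn' : \forall i \near F, (lap (a i) (b i) n%:R%:E < e')%R.
  exact: (cl _ (lt_nbhsl lapn)).
have yn : \forall i \near F, n%:R%:E < y i.
  by have [H1 _] := (ecvgP _ _).1 yy; apply: H1; rewrite ltry.
near=> i.
have [ai [abi yi]] : (0 <= a i)%R /\ (a i <= b i)%R /\ 0 <= y i by near: i.
have li : (lap (a i) (b i) n%:R%:E < e')%R by near: i.
have ni : n%:R%:E < y i by near: i.
have Cl : (C * lap (a i) (b i) (y i) <= e / 2)%R.
  have : (lap (a i) (b i) (y i) <= e')%R.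
    by apply: le_trans (ltW li); apply: lap_le => //; rewrite ?lee_fin// ltW.
  move=> /(ler_wpM2l C0) /le_trans; apply.
  by rewrite /e' mulrCA ler_piMr ?(ltW e20)// ler_pdivrMr// mul1r lerDl.
have up : (kexp k g (a i) (b i) (y i) <=
    kexp k (fun z => (g +oo%E + e / 2) + C * expNe z)%R (a i) (b i) (y i))%R.
  apply: (kexp_le_nonneg bk) => //.
    exact/bounded_measurable_affine/expNe_bounded.
  by move=> z /dist; rewrite ler_norml => /andP[_]; lra.
have lo : (kexp k (fun z => (g +oo%E - e / 2) + (- C) * expNe z)%R (a i) (b i) (y i)
    <= kexp k g (a i) (b i) (y i))%R.
  apply: (kexp_le_nonneg bk) => //.
    exact/bounded_measurable_affine/expNe_bounded.
  by move=> z /dist; rewrite ler_norml => /andP[+ _]; lra.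
rewrite kexp_affine in up; last exact: expNe_bounded.
rewrite kexp_affine in lo; last exact: expNe_bounded.
rewrite -/(lap _ _ _) in up lo.
rewrite ler_norml; apply/andP; split; lra.
Unshelve. all: by end_near. Qed.

End laplace.

(** * Upcrossings of nonnegative supermartingales *)

Section upcrossings.
Variables (R : realType) (a b : R).
Implicit Types (st : bool) (m : R) (s : seq R).

(* Number of upcrossings of [a, b]; [st] tells whether a passage below [a] has
   already been seen. *)
Fixpoint upc st s : nat := if s is m :: s' then
  if st then (if b <= m then (upc false s').+1 else upc true s')%R
  else (if m <= a then upc true s' else upc false s')%R
  else 0.

Lemma upc_st s : (upc false s <= upc true s <= (upc false s).+1)%N.
Proof.
elim: s => //= m s /andP[ih1 ih2].
case: ifPn => [bm|_]; case: ifPn => [ma|_]; rewrite ?ih1 ?ih2 ?leqnn ?leqnSn//.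
Qed.

Lemma upc_cons st m s : (upc st s <= upc st (m :: s))%N.
Proof.
have /andP[h1 h2] := upc_st s.
by case: st => /=; case: ifP.
Qed.

Lemma upc_subseq st s1 s2 : subseq s1 s2 -> (upc st s1 <= upc st s2)%N.
Proof.
elim: s2 st s1 => [|m s2 ih] st [|m1 s1]//; rewrite /subseq -/subseq.
case: ifPn => [/eqP -> h|_ h].
  by case: st => /=; case: ifP => _; rewrite ?ltnS; exact: ih.
apply: (leq_trans (ih st _ h)); exact: upc_cons.
Qed.

End upcrossings.

Section dubins.
Context d (U : measurableType d) (R : realType).
Variables (P : probability U R) (F : rat -> set_system U) (M : rat -> U -> R).
Variables (T : rat) (a b : R).
Hypothesis F_meas : forall q C, F q C -> measurable C.
Hypothesis FI : forall q C D, F q C -> F q D -> F q (C `&` D).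
Hypothesis FC : forall q C, F q C -> F q (~` C).
Hypothesis F_mono : forall q q' C, (q <= q')%R -> F q C -> F q' C.
Hypothesis F_le : forall q c, F q [set u | (M q u <= c)%R].
Hypothesis F_ge : forall q c, F q [set u | (c <= M q u)%R].
Hypothesis mM : forall q, measurable_fun setT (M q).
Hypothesis M0 : forall q u, (0 <= M q u)%R.
Hypothesis martM : forall q q' C, (0 <= q)%R -> (q <= q')%R -> (q' <= T)%R ->
  F q C -> \int[P]_(u in C) (M q' u)%:E <= \int[P]_(u in C) (M q u)%:E.
Hypotheses (a0 : (0 <= a)%R) (ab : (a < b)%R).

Let b0 : (0 < b)%R. Proof. exact: le_lt_trans ab. Qed.

Definition upevent st K (L : seq rat) : set U :=
  [set u | (K <= upc a b st [seq M q u | q <- L])%N].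

Let upevent_true K q L : upevent true K.+1 (q :: L) =
  ([set u | (b <= M q u)%R] `&` upevent false K L) `|`
  (~` [set u | (b <= M q u)%R] `&` upevent true K.+1 L).
Proof.
apply/seteqP; split => u; rewrite /upevent/=.
  by case: ifPn => [bM|/negP bM]; [left|right].
by case=> -[+ h]; [move=> ->|move=> /negP/negbTE ->].
Qed.

Let upevent_false K q L : upevent false K (q :: L) =
  ([set u | (M q u <= a)%R] `&` upevent true K L) `|`
  (~` [set u | (M q u <= a)%R] `&` upevent false K L).
Proof.
apply/seteqP; split => u; rewrite /upevent/=.
  by case: ifPn => [bM|/negP bM]; [left|right].
by case=> -[+ h]; [move=> ->|move=> /negP/negbTE ->].
Qed.

Let upevent0 st L : upevent st 0 L = setT.
Proof. by apply/seteqP. Qed.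

Let upevent_nil st K : upevent st K.+1 [::] = set0.
Proof. by apply/seteqP; split => u; rewrite /upevent/=. Qed.

Lemma measurable_upevent st K L : measurable (upevent st K L).
Proof.
have ml q := F_meas (F_le q a); have mg q := F_meas (F_ge q b).
elim: L st K => [|q L ih] st [|K]; rewrite ?upevent0//.
  by rewrite upevent_nil.
case: st; rewrite ?upevent_true ?upevent_false.
  by apply: measurableU; apply: measurableI => //; exact: measurableC.
by apply: measurableU; apply: measurableI => //; exact: measurableC.
Qed.

Let split_event (C A E1 E2 : set U) : measurable C -> measurable A ->
  measurable E1 -> measurable E2 ->
  P (C `&` ((A `&` E1) `|` (~` A `&` E2))) =
  P ((C `&` A) `&` E1) + P ((C `&` ~` A) `&` E2).
Proof.
move=> mC mA mE1 mE2; have mA' := measurableC mA.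
rewrite -measureU.
- by congr (P _); rewrite setIUr !setIA.
- by do 2?apply: measurableI.
- by do 2?apply: measurableI.
- by apply/seteqP; split => u //= [[[_ ?] _] [[]]].
Qed.

Let mME D q : measurable_fun D (fun u => (M q u)%:E).
Proof. by apply: measurable_funTS; exact/measurable_EFinP. Qed.

Let intM_split q C A : measurable C -> measurable A ->
  \int[P]_(u in C `&` A) (M q u)%:E + \int[P]_(u in C `&` ~` A) (M q u)%:E =
  \int[P]_(u in C) (M q u)%:E.
Proof.
move=> mC mA; have mA' := measurableC mA.
rewrite -ge0_integral_setU//.
- by rewrite -setIUr setUv setIT.
- exact: measurableI.
- exact: measurableI.
- by move=> u _; rewrite lee_fin.
- by rewrite disj_set2E setIACA setICr setI0.
Qed.

Let mulr_split (c : R) (x y z w : \bar R) : (0 <= c)%R -> 0 <= z -> 0 <= w ->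
  x <= c%:E * z -> y <= c%:E * w -> x + y <= c%:E * (z + w).
Proof. by move=> c0 z0 w0 xz yw; rewrite ge0_muleDr//; exact: leeD. Qed.

(** The two bounds are proved together, as they feed each other at each grid point. While a passage
    above [b] is awaited, the event where it occurs has probability at most 1/b times the integral
    of [M q] over it; while a passage below [a] is awaited, that integral is at most [a] times the
    probability. Each full upcrossing thus costs a factor [a / b]. *)
Lemma dubins K L q0 C : (0 <= q0)%R -> path (fun q q' => q <= q')%R q0 L ->
  all (fun q => q <= T)%R L -> F q0 C ->
  P (C `&` upevent false K L) <= ((a / b) ^+ K)%:E * P C /\
  P (C `&` upevent true K.+1 L) <=
    ((a / b) ^+ K / b)%:E * \int[P]_(u in C) (M q0 u)%:E.
Proof.
have r0 : (0 <= a / b)%R by rewrite divr_ge0// ltW.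
have i0 q D : 0 <= \int[P]_(u in D) (M q u)%:E.
  by apply: integral_ge0 => u _; rewrite lee_fin.
have c0 K' : (0 <= (a / b) ^+ K' / b)%R by rewrite divr_ge0 ?exprn_ge0// ltW.
elim: L K q0 C => [|q L ih] K q0 C q00 /=.
  move=> _ _ FCC; split; last first.
    rewrite upevent_nil setI0 measure0.
    by rewrite mule_ge0 ?lee_fin.
  case: K => [|K]; first by rewrite upevent0 setIT expr0 mul1e.
  rewrite upevent_nil setI0 measure0.
  by rewrite mule_ge0 ?lee_fin ?exprn_ge0.
move=> /andP[q0q pL] /andP[qT LT] FCC; have q0' := le_trans q00 q0q.
have mC := F_meas FCC; have FqC := F_mono q0q FCC.
split; last first.
  have mA := F_meas (F_ge q b); have mA' := measurableC mA.
  rewrite upevent_true split_event//; last 2 first.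
  - exact: measurable_upevent.
  - exact: measurable_upevent.
  (* The supermartingale property moves the integral from [q0] to the next grid point [q], where it
     can be split along [b <= M q]. *)
  apply: le_trans (lee_wpmul2l _ (martM q00 q0q qT FCC)); last by rewrite lee_fin.
  rewrite -(intM_split q mC mA); apply: mulr_split => //.
    have [h _] := ih K q _ q0' pL LT (FI FqC (F_ge q b)).
    apply: (le_trans h); rewrite EFinM -muleA.
    apply: lee_wpmul2l; first by rewrite lee_fin exprn_ge0.
    rewrite -(@lee_pmul2l _ b%:E) ?lte_fin// muleA -EFinM mulfV ?gt_eqF// mul1e.
    rewrite -integral_cst//; last exact: measurableI.
    apply: ge0_le_integral => //.
    - exact: measurableI.
    - by move=> u _; rewrite lee_fin ltW.
    - by move=> u [_ /=]; rewrite lee_fin.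
  by have [_ h] := ih K q _ q0' pL LT (FI FqC (FC (F_ge q b))).
case: K => [|K].
  by rewrite upevent0 setIT expr0 mul1e.
have mA := F_meas (F_le q a); have mA' := measurableC mA.
rewrite upevent_false split_event//; last 2 first.
- exact: measurable_upevent.
- exact: measurable_upevent.
have PC : P (C `&` [set u | (M q u <= a)%R]) + P (C `&` ~` [set u | (M q u <= a)%R]) = P C.
  exact: (giry_splitC P mA mC).
rewrite -PC; apply: mulr_split => //; first by rewrite exprn_ge0.
  have [_ h] := ih K q _ q0' pL LT (FI FqC (F_le q a)).
  apply: (le_trans h).
  have -> : ((a / b) ^+ K.+1 = (a / b) ^+ K / b * a)%R.
    by rewrite exprSr -mulrA (mulrC _ a).
  rewrite [in leRHS]EFinM -muleA.
  apply: lee_wpmul2l; first by rewrite lee_fin.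
  rewrite -integral_cst//; last exact: measurableI.
  apply: ge0_le_integral => //.
  - exact: measurableI.
  - by move=> u _; rewrite lee_fin.
  - by move=> u [_ /=]; rewrite lee_fin.
by have [h _] := ih K.+1 q _ q0' pL LT (FI FqC (FC (F_le q a))).
Qed.

(** Increasing finite grids that exhaust the rationals of [0, T], so that upcrossings along all
    rationals form a countable increasing union. *)
Definition crossing_grid n : seq rat :=
  sort <=%O (undup [seq q <- pmap decode (iota 0 n) | 0 <= q <= T]%R).

Lemma crossing_grid_sorted n : sorted <%O (crossing_grid n).
Proof. by rewrite sort_lt_sorted undup_uniq. Qed.

Lemma mem_crossing_grid n q : (q \in crossing_grid n) =
  (0 <= q <= T)%R && (q \in pmap decode (iota 0 n)).
Proof. by rewrite mem_sort mem_undup mem_filter. Qed.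

Lemma subseq_lt_sorted (s1 s2 : seq rat) : sorted <%O s1 -> sorted <%O s2 ->
  {subset s1 <= s2} -> subseq s1 s2.
Proof.
move=> h1 h2 s12; have -> : s1 = [seq x <- s2 | x \in s1].
  apply: lt_sorted_eq => //; first exact: (sorted_filter lt_trans).
  by move=> x; rewrite mem_filter; case: (boolP (x \in s1)) => //= /s12.
exact: filter_subseq.
Qed.

Lemma crossing_grid_subseq m n : (m <= n)%N ->
  subseq (crossing_grid m) (crossing_grid n).
Proof.
move=> mn; apply: subseq_lt_sorted => [||q]; rewrite ?crossing_grid_sorted//.
rewrite !mem_crossing_grid => /andP[-> /=].
by rewrite -(subnKC mn) iotaD pmap_cat mem_cat => ->.
Qed.

Definition crossings K : set U := \bigcup_n upevent false K (crossing_grid n).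

Lemma measurable_crossings K : measurable (crossings K).
Proof. by apply: bigcupT_measurable => n; exact: measurable_upevent. Qed.

Lemma crossings_le K : F 0%R setT -> P (crossings K) <= ((a / b) ^+ K)%:E.
Proof.
move=> FT; have c : P (upevent false K (crossing_grid n)) @[n --> \oo] -->
    P (crossings K).
  apply: nondecreasing_cvg_mu.
  - by move=> n; exact: measurable_upevent.
  - exact: measurable_crossings.
  - move=> m n mn; apply/subsetPset => u; rewrite /upevent/= => /leq_trans; apply.
    by apply: upc_subseq; apply: map_subseq; exact: crossing_grid_subseq.
apply: (cvge_to_le c); apply: nearW => n; have sg := crossing_grid_sorted n.
have Pp : path (fun q q' => q <= q')%R 0%R (crossing_grid n).
  rewrite (path_sortedE le_trans); apply/andP; split.
    by apply/allP => q; rewrite mem_crossing_grid => /andP[/andP[]].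
  exact: sort_le_sorted.
have PT : all (fun q => q <= T)%R (crossing_grid n).
  by apply/allP => q; rewrite mem_crossing_grid => /andP[/andP[]].
have [h _] := dubins K (lexx _) Pp PT FT.
by move: h; rewrite setTI probability_setT mule1.
Qed.

Lemma crossingsP K (L : seq rat) u : sorted <%O L ->
  all (fun q => 0 <= q <= T)%R L ->
  (K <= upc a b false [seq M q u | q <- L])%N -> crossings K u.
Proof.
move=> sL LT KL; pose n := (\max_(q <- L) code q).+1; exists n => //.
apply: (leq_trans KL); apply: upc_subseq; apply: map_subseq.
apply: subseq_lt_sorted => [//||q qL]; first exact: crossing_grid_sorted.
rewrite mem_crossing_grid; apply/andP; split; first exact: (allP LT _ qL).
rewrite mem_pmap; apply/mapP.
exists (code q); last by rewrite codeK.
rewrite mem_iota add0n /= ltnS; exact: (@leq_bigmax_seq _ _ xpredT code).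
Qed.

End dubins.

Section supermartingale_regularity.
Context d (U : measurableType d) (R : realType).
Variables (P : probability U R) (F : rat -> set_system U) (M : rat -> U -> R).
Variables (T : rat).
Hypothesis F_meas : forall q C, F q C -> measurable C.
Hypothesis FI : forall q C D, F q C -> F q D -> F q (C `&` D).
Hypothesis FC : forall q C, F q C -> F q (~` C).
Hypothesis F_mono : forall q q' C, (q <= q')%R -> F q C -> F q' C.
Hypothesis F_le : forall q c, F q [set u | (M q u <= c)%R].
Hypothesis F_ge : forall q c, F q [set u | (c <= M q u)%R].
Hypothesis mM : forall q, measurable_fun setT (M q).
Hypothesis M0 : forall q u, (0 <= M q u)%R.
Hypothesis martM : forall q q' C, (0 <= q)%R -> (q <= q')%R -> (q' <= T)%R ->
  F q C -> \int[P]_(u in C) (M q' u)%:E <= \int[P]_(u in C) (M q u)%:E.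
Hypothesis FT : F 0%R setT.

Definition no_crossing (m : rat -> R) (a b : R) K := forall L : seq rat,
  sorted <%O L -> all (fun q => 0 <= q <= T)%R L ->
  (upc a b false [seq m q | q <- L] < K)%N.

Let null_of_le (A : set U) (e : nat -> R) : measurable A ->
  e @ \oo --> (0 : R)%R -> (forall n, P A <= (e n)%:E) -> P A = 0.
Proof.
move=> mA e0 Ae; apply/eqP; rewrite eq_le measure_ge0 andbT.
have c : (e n)%:E @[n --> \oo] --> (0 : R)%:E by apply: cvg_EFin => //; exact: nearW.
by apply: (cvge_to_ge c); exact: nearW.
Qed.

Lemma oscillation_null (a b : R) : (0 <= a)%R -> (a < b)%R ->
  exists N, [/\ measurable N, P N = 0 &
    forall u, ~ N u -> exists K, no_crossing (M ^~ u) a b K].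
Proof.
move=> a0 ab; have b0 := le_lt_trans a0 ab.
exists (\bigcap_K crossings M T a b K).
have mN : measurable (\bigcap_K crossings M T a b K).
  by apply: bigcapT_measurable => K; exact: (measurable_crossings _ _ _ F_meas F_le F_ge).
split => //.
  apply: (null_of_le (e := fun n => ((a / b) ^+ n)%R)) => //.
    apply: cvg_expr; rewrite ger0_norm ?divr_ge0 ?(ltW b0)//.
    by rewrite ltr_pdivrMr// mul1r.
  move=> n; apply: le_trans (crossings_le F_meas FI FC F_mono F_le F_ge mM M0 martM a0 ab n FT).
  apply: le_measure; rewrite ?inE//; first exact: (measurable_crossings _ _ _ F_meas F_le F_ge).
  exact: bigcap_inf.
move=> u /= Nu; have [K HK] : exists K, ~ crossings M T a b K u.
  by apply/existsNP => H; apply: Nu => K _; exact: H.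
exists K => L sL LT; rewrite ltnNge; apply/negP => h; apply: HK.
exact: (crossingsP sL LT h).
Qed.

(** A single upcrossing of [[a, b]] has probability at most [a / b], which tends to 0 with [a]. So
    almost every path has some level [a] below which it cannot go and still return to [b]. *)
Lemma absorption_null (b : R) : (0 < b)%R ->
  exists N, [/\ measurable N, P N = 0 &
    forall u, ~ N u -> exists2 a : R, (0 < a)%R & no_crossing (M ^~ u) a b 1].
Proof.
(* The shift by 2 keeps [a n < b] for every [n]. *)
move=> b0; pose a n := (b / n.+2%:R)%R.
have a0 n : (0 < a n)%R by rewrite divr_gt0.
have ab n : (a n < b)%R by rewrite ltr_pdivrMr// ltr_pMr// ltr1n.
exists (\bigcap_n crossings M T (a n) b 1).
have mN : measurable (\bigcap_n crossings M T (a n) b 1).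
  by apply: bigcapT_measurable => K; exact: (measurable_crossings _ _ _ F_meas F_le F_ge).
split => //.
  apply: (null_of_le (e := fun n => n.+2%:R^-1%R)) => //.
    by have := @cvg_harmonic R; rewrite -cvg_shiftS.
  move=> n; rewrite [leRHS](_ : _ = ((a n / b) ^+ 1)%:E); last first.
    by rewrite expr1 /a mulrAC mulfV ?mul1r// gt_eqF.
  apply: le_trans (crossings_le F_meas FI FC F_mono F_le F_ge mM M0 martM (ltW (a0 n)) (ab n) 1 FT).
  apply: le_measure; rewrite ?inE//; first exact: (measurable_crossings _ _ _ F_meas F_le F_ge).
  exact: bigcap_inf.
move=> u /= Nu; have [n Hn] : exists n, ~ crossings M T (a n) b 1 u.
  by apply/existsNP => H; apply: Nu => K _; exact: H.
exists (a n) => // L sL LT; rewrite ltnNge; apply/negP => h; apply: Hn.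
exact: (crossingsP sL LT h).
Qed.

End supermartingale_regularity.

(** * Regularity of paths along the rationals *)

Section no_oscillation.
Variable R : realType.

Definition frequently {I : Type} (F : set_system I) (A : set I) :=
  forall B, F B -> exists i, B i /\ A i.

Lemma not_frequently {I : Type} (F : set_system I) {FF : Filter F} (A : set I) :
  ~ frequently F A -> F (~` A).
Proof.
move=> /existsNP[B /not_implyP[FB H]].
by apply: filterS FB => i Bi Ai; apply: H; exists i.
Qed.

Lemma frequently_near {I : Type} (F : set_system I) {FF : Filter F} (A B : set I) :
  frequently F A -> (\forall i \near F, A i -> B i) -> frequently F B.
Proof.
move=> fA nB C FC; have [i [[Ci ABi] Ai]] := fA _ (filterI FC nB).
by exists i; split => //; exact: ABi.
Qed.

Lemma lte_EFin_dense (x : \bar R) (b : R) : x < b%:E ->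
  exists2 c : R, x < c%:E & (c < b)%R.
Proof.
case: x => [x| |]// => [|_].
  rewrite lte_fin => xb; exists ((x + b) / 2)%R; rewrite ?lte_fin; lra.
by exists (b - 1)%R; [rewrite ltNyr|lra].
Qed.

Lemma gte_EFin_dense (x : \bar R) (a : R) : a%:E < x ->
  exists2 c : R, c%:E < x & (a < c)%R.
Proof.
case: x => [x| |]// => [|_].
  rewrite lte_fin => xb; exists ((a + x) / 2)%R; rewrite ?lte_fin; lra.
by exists (a + 1)%R; [rewrite ltry|lra].
Qed.

(** The limit is the supremum of the reals that [f] eventually exceeds: if [f] is often at least
    some [b] above it, then [f] is eventually above any smaller [c], and such a [c] can still be
    taken above the supremum. *)
Lemma cvg_no_oscillation {I : Type} (F : set_system I) {FF : ProperFilter F}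
    (f : I -> \bar R) :
  (forall a b : R, (a < b)%R -> ~ (frequently F [set i | f i <= a%:E] /\
    frequently F [set i | b%:E <= f i])) ->
  exists l : \bar R, f @ F --> l.
Proof.
move=> H; pose A := [set x | exists2 a : R, x = a%:E & F [set i | a%:E < f i]].
exists (ereal_sup A); apply/ecvgP; split => [a /ereal_sup_gt[_ [a' -> Fa'] aa']|b].
  by apply: filterS Fa' => i /=; exact: lt_trans.
move=> /lte_EFin_dense[c Ac cb].
have [fc|/not_frequently nfc] := pselect (frequently F [set i | f i <= c%:E]).
  have [fb|/not_frequently nfb] := pselect (frequently F [set i | b%:E <= f i]).
    by case: (H _ _ cb).
  by apply: filterS nfb => i /= /negP; rewrite -ltNge.
have : c%:E <= ereal_sup A.
  apply: ereal_sup_ubound; exists c => //.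
  by apply: filterS nfc => i /= /negP; rewrite -ltNge.
by rewrite leNgt Ac.
Qed.

End no_oscillation.

Section rational_neighborhoods.
Variables (R : realType) (s : R).

(** The trace of [G] on the grid s + Q, indexed by the rational. It is stated for a general [G] in
    order to cover left and right neighbourhoods. *)
Definition rat_near (G : set_system R) : set_system rat :=
  [set A | \forall x \near G, forall q, rtime s q = x -> A q].

Global Instance rat_near_filter (G : set_system R) {FG : Filter G} :
  Filter (rat_near G).
Proof.
split; rewrite /rat_near/=.
- exact: nearW.
- move=> A B FA FB; apply: (@filterS _ G _ _ _ _ (@filterI _ G _ _ _ FA FB)).
  by move=> x [Ax Bx] q qx; split; [exact: Ax|exact: Bx].
- by move=> A B AB; apply: (@filterS _ G) => x Ax q /Ax /AB.
Qed.

Lemma rat_near_time (G : set_system R) {FG : Filter G} :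
  rtime s q @[q --> rat_near G] --> G.
Proof.
by move=> A GA; rewrite /fmap/= /rat_near/=; apply: (@filterS _ G _ _ _ _ GA) => x Ax q /= ->.
Qed.

Lemma rtime_dense (x y : R) : (x < y)%R -> exists q, (x < rtime s q < y)%R.
Proof.
move=> xy; have : (x - s < y - s)%R by rewrite ltrD2r.
move=> /rat_in_itvoo[q]; rewrite in_itv/= => /andP[h1 h2].
by exists q; rewrite /rtime -ltrBlDl h1 -ltrBrDl.
Qed.

Lemma rtime_le q q' : (rtime s q <= rtime s q')%R = (q <= q')%R.
Proof. by rewrite /rtime lerD2l ler_rat. Qed.

Lemma rtime_lt q q' : (rtime s q < rtime s q')%R = (q < q')%R.
Proof. by rewrite /rtime ltrD2l ltr_rat. Qed.

Lemma rtime_ge q : (s <= rtime s q)%R = (0 <= q)%R.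
Proof. by rewrite /rtime lerDl ler0q. Qed.

Lemma near_right_delta (t : R) (A : set R) :
  (\forall x \near t^'+, A x) <->
  exists2 d : R, (0 < d)%R & forall x, (t < x < t + d)%R -> A x.
Proof.
split=> [|[d d0 H]].
  rewrite near_withinE => /nbhs_ballP[d /= d0 H]; exists d => // x /andP[tx xd].
  by apply: H => //=; rewrite /ball/= ltr_norml; apply/andP; split; lra.
near=> x; apply: H; apply/andP; split; near: x; first exact: nbhs_right_gt.
by apply: nbhs_right_lt; rewrite ltrDl.
Unshelve. all: by end_near. Qed.

Lemma near_left_delta (t : R) (A : set R) :
  (\forall x \near t^'-, A x) <->
  exists2 d : R, (0 < d)%R & forall x, (t - d < x < t)%R -> A x.
Proof.
split=> [|[d d0 H]].
  rewrite near_withinE => /nbhs_ballP[d /= d0 H]; exists d => // x /andP[tx xd].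
  by apply: H => //=; rewrite /ball/= ltr_norml; apply/andP; split; lra.
near=> x; apply: H; apply/andP; split; near: x; last exact: nbhs_left_lt.
by apply: nbhs_left_gt; rewrite ltrBlDr ltrDl.
Unshelve. all: by end_near. Qed.

Global Instance rat_right_proper (t : R) : ProperFilter (rat_near t^'+).
Proof.
apply: Build_ProperFilter_ex => A /near_right_delta[d d0 H].
have [q qt] : exists q, (t < rtime s q < t + d)%R.
  by apply: rtime_dense; rewrite ltrDl.
by exists q; exact: H qt _ erefl.
Qed.

Global Instance rat_left_proper (t : R) : ProperFilter (rat_near t^'-).
Proof.
apply: Build_ProperFilter_ex => A /near_left_delta[d d0 H].
have [q qt] : exists q, (t - d < rtime s q < t)%R.
  by apply: rtime_dense; rewrite ltrBlDr ltrDl.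
by exists q; exact: H qt _ erefl.
Qed.

Lemma frequently_right (t d : R) (A : set rat) : (0 < d)%R ->
  frequently (rat_near t^'+) A -> exists q, (t < rtime s q < t + d)%R /\ A q.
Proof.
move=> d0 fA; apply: (fA [set q | (t < rtime s q < t + d)%R]).
by apply/near_right_delta; exists d => // x tx q /= ->.
Qed.

Lemma frequently_left (t d : R) (A : set rat) : (0 < d)%R ->
  frequently (rat_near t^'-) A -> exists q, (t - d < rtime s q < t)%R /\ A q.
Proof.
move=> d0 fA; apply: (fA [set q | (t - d < rtime s q < t)%R]).
by apply/near_left_delta; exists d => // x tx q /= ->.
Qed.

Section crossing_chains.
Variables (m : rat -> R) (a b : R) (t : R).

Let sorted_cons2 (q1 q2 : rat) L : (q1 < q2)%R -> sorted <%O L ->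
  (forall q, q \in L -> q2 < q)%R -> sorted <%O [:: q1, q2 & L].
Proof.
move=> q12 sL H; rewrite /= q12 /= (path_sortedE lt_trans) sL andbT.
by apply/allP => q /H.
Qed.

(** The list grows towards [t]: each new pair is taken between [t] and all the times already chosen,
    hence precedes them. *)
Lemma right_chain K (d : R) : (0 < d)%R ->
  frequently (rat_near t^'+) [set q | (m q <= a)%R] ->
  frequently (rat_near t^'+) [set q | (b <= m q)%R] ->
  exists L, [/\ sorted <%O L, forall q, q \in L -> (t < rtime s q < t + d)%R &
    (K <= upc a b false [seq m q | q <- L])%N].
Proof.
move=> d0 fa fb; elim: K => [|K [L [sL Lt KL]]]; first by exists [::].
have [d' [d'0 d'd Ld']] : exists d' : R, [/\ (0 < d')%R, (d' <= d)%R &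
    forall q, q \in L -> (t + d' <= rtime s q)%R].
  elim: L Lt {sL KL} => [_|q L ih Lt]; first by exists d.
  have [|d' [d'0 d'd Ld']] := ih; first by move=> q' q'L; apply: Lt; rewrite inE q'L orbT.
  exists (Num.min d' (rtime s q - t))%R; split.
  - by rewrite lt_min d'0 subr_gt0; have /andP[] := Lt q (mem_head _ _).
  - by rewrite ge_min d'd.
  - move=> q'; rewrite inE => /predU1P[->|q'L]; rewrite -lerBrDl ge_min ?lexx ?orbT//.
    by rewrite lerBrDl Ld'.
have [q2 [/andP[q2t q2d] bq2]] := frequently_right d'0 fb.
have q2d0 : (0 < rtime s q2 - t)%R by rewrite subr_gt0.
have [q1 [/andP[q1t q1d] aq1]] := frequently_right q2d0 fa.
have q12 : (q1 < q2)%R by rewrite -rtime_lt; lra.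
exists [:: q1, q2 & L]; split.
- apply: sorted_cons2 => // q qL; rewrite -rtime_lt.
  by apply: lt_le_trans q2d _; exact: Ld'.
- move=> q; rewrite !inE => /predU1P[->|/predU1P[->|/Lt//]];
    apply/andP; split => //; lra.
- by rewrite /= aq1 bq2 ltnS.
Qed.

(** Here the new pair comes first in time and the remaining crossings are found between it and [t],
    so the induction needs all widths [d]. *)
Lemma left_chain K (d : R) : (0 < d)%R ->
  frequently (rat_near t^'-) [set q | (m q <= a)%R] ->
  frequently (rat_near t^'-) [set q | (b <= m q)%R] ->
  exists L, [/\ sorted <%O L, forall q, q \in L -> (t - d < rtime s q < t)%R &
    (K <= upc a b false [seq m q | q <- L])%N].
Proof.
move=> + fa fb; elim: K d => [|K ih] d d0; first by exists [::].
have [q1 [/andP[q1d q1t] aq1]] := frequently_left d0 fa.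
have q1d0 : (0 < t - rtime s q1)%R by rewrite subr_gt0.
have [q2 [/andP[q2d q2t] bq2]] := frequently_left q1d0 fb.
have q2d0 : (0 < t - rtime s q2)%R by rewrite subr_gt0.
have [L [sL Lt KL]] := ih _ q2d0.
have q12 : (q1 < q2)%R by rewrite -rtime_lt; lra.
exists [:: q1, q2 & L]; split.
- by apply: sorted_cons2 => // q /Lt/andP[+ _]; rewrite -rtime_lt; lra.
- move=> q; rewrite !inE => /predU1P[->|/predU1P[->|/Lt/andP[h1 h2]]];
    apply/andP; split => //; lra.
- by rewrite /= aq1 bq2 ltnS.
Qed.

End crossing_chains.
End rational_neighborhoods.

Section path_regularity.
Variables (R : realType) (k : R -> R -> R.-pker (\bar R) ~> (\bar R)).
Hypothesis bk : branching_kernels k.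
Variables (s : R) (s0 : (0 <= s)%R) (z : rat -> \bar R).
Local Notation tm := (rtime s).

Definition lap_path (T q : rat) : R := lap k (tm q) (tm T) (z q).

(** Integer horizons and rational levels make these countably many conditions. The first excludes
    oscillation; the second says that a martingale close to 0, that is a state close to oo, does not
    come back; the third says the same for states close to 0. *)
Definition regular_path := forall n : nat, let T := n%:R : rat in
  [/\ forall a b : rat, (0 <= a)%R -> (a < b)%R ->
        exists K, no_crossing T (lap_path T) (ratr a) (ratr b) K,
      forall b : rat, (0 < b)%R -> exists2 a : R, (0 < a)%R &
        no_crossing T (lap_path T) a (ratr b) 1 &
      forall b : rat, (0 < b)%R -> exists2 a : R, (0 < a)%R &
        no_crossing T (fun q => 1 - lap_path T q)%R a (ratr b) 1].

Hypothesis z0 : forall q, (0 <= q)%R -> 0 <= z q.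
Hypothesis reg : regular_path.

Lemma exists_horizon (t : R) : exists n : nat, (t < tm n%:R)%R.
Proof.
exists (Num.truncn (t - s)).+1.
by rewrite /rtime ratr_nat -ltrBlDl truncnS_gt.
Qed.

Lemma tm_ge0 q : (0 <= q)%R -> (0 <= tm q)%R.
Proof. by move=> q0; apply: le_trans s0 _; rewrite rtime_ge. Qed.

(** * Left and right limits treated at once *)

Section one_sided.
Variables (t : R) (G : set_system R).
Hypothesis FG : Filter G.
Hypothesis PG : ProperFilter (rat_near s G).
Hypothesis st : (s <= t)%R.
Hypothesis Gt : x @[x --> G] --> t.
Hypothesis Gs : \forall x \near G, (s <= x)%R.
Hypothesis chain : forall (m : rat -> R) (a b : R) K (d : R), (0 < d)%R ->
  frequently (rat_near s G) [set q | (m q <= a)%R] ->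
  frequently (rat_near s G) [set q | (b <= m q)%R] ->
  exists L, [/\ sorted <%O L,
    forall q, q \in L -> (s <= tm q)%R /\ (tm q < t + d)%R &
    (K <= upc a b false [seq m q | q <- L])%N].

Local Notation Gq := (rat_near s G).

Let tm_cvg : tm q @[q --> Gq] --> t.
Proof. by apply: cvg_trans Gt; exact: rat_near_time. Qed.

Let near0 : \forall q \near Gq, (0 <= q)%R.
Proof.
have : \forall q \near Gq, (s <= tm q)%R by exact: rat_near_time Gs.
by apply: filterS => q; rewrite rtime_ge.
Qed.

Let near_lt q' : (t < tm q')%R -> \forall q \near Gq, (q < q')%R.
Proof.
move=> tq'; have : \forall q \near Gq, (tm q < tm q')%R.
  exact: (tm_cvg (lt_nbhsl tq')).
by apply: filterS => q; rewrite rtime_lt.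
Qed.

Let t0 : (0 <= t)%R. Proof. exact: le_trans st. Qed.

Let lap_lim q' (c : R) : (0 <= c)%R -> (t < tm q')%R ->
  lap k (tm q) (tm q') c%:E @[q --> Gq] --> lap k t (tm q') c%:E.
Proof.
move=> c0 tq'; apply: (lap_cvg bk) => //; try exact: cvg_cst.
- near=> q; have q0 : (0 <= q)%R by near: q; exact: near0.
  have qq' : (q < q')%R by near: q; exact: near_lt.
  by split; [exact: tm_ge0|rewrite rtime_le ltW].
- exact: ltW.
Unshelve. all: by end_near. Qed.

Let rat_between (x y : R) : (x < y)%R -> exists q : rat, (x < ratr q < y)%R.
Proof. by move=> /rat_in_itvoo[q]; rewrite in_itv/=; exists q. Qed.

(** If [z] is often at most [c] and often at least [d > c] near [t], put rationals [a < b] in the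
    gap between [lap t T d] and [lap t T c]. By continuity in time the gap persists near [t], and
    the Laplace path crosses [[a, b]] as often as desired. *)
Lemma one_sided_limit : exists l : \bar R, z @ Gq --> l.
Proof.
apply: cvg_no_oscillation => c d cd [fc fd].
have [n tn] := exists_horizon t.
have c0 : (0 <= c)%R.
  have [p [p0]] := fc _ near0; rewrite /= => zpc.
  by rewrite -lee_fin; apply: le_trans zpc; exact: z0.
have d0 : (0 <= d)%R by exact: le_trans (ltW cd).
have := lap_lt bk t0 (ltW tn) (x := c%:E) (y := d%:E); rewrite lee_fin lte_fin.
move=> /(_ c0 cd)/rat_between[b /andP[db bc]].
have [a /andP[da ab]] := rat_between db.
have a0 : (0 <= a)%R by rewrite -(ler0q R) (le_trans _ (ltW da))// lap_ge0.
have nq : \forall q \near Gq, (0 <= q)%R /\ (q < n%:R)%R.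
  by near=> q; split; near: q; [exact: near0|exact: near_lt].
have fb : frequently Gq [set q | ratr b <= lap_path n%:R q]%R.
  apply: (frequently_near fc).
  have nb : \forall q \near Gq, (ratr b < lap k (tm q) (tm n%:R) c%:E)%R.
    exact: (lap_lim c0 tn (lt_nbhsr bc)).
  near=> q; rewrite /= => zqc.
  have [q0 qn] : (0 <= q)%R /\ (q < n%:R)%R by near: q.
  apply: (@le_trans _ _ (lap k (tm q) (tm n%:R) c%:E)).
    by apply: ltW; near: q.
  apply: (lap_le bk) => //.
  - exact: tm_ge0.
  - by rewrite rtime_le ltW.
  - exact: z0.
have fa : frequently Gq [set q | lap_path n%:R q <= ratr a]%R.
  apply: (frequently_near fd).
  have na : \forall q \near Gq, (lap k (tm q) (tm n%:R) d%:E < ratr a)%R.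
    exact: (lap_lim d0 tn (lt_nbhsl da)).
  near=> q; rewrite /= => zqd.
  have [q0 qn] : (0 <= q)%R /\ (q < n%:R)%R by near: q.
  apply: (@le_trans _ _ (lap k (tm q) (tm n%:R) d%:E)); last first.
    by apply: ltW; near: q.
  apply: (lap_le bk) => //.
  - exact: tm_ge0.
  - by rewrite rtime_le ltW.
rewrite ltr_rat in ab.
have [/(_ a b a0 ab)[K HK] _ _] := reg n.
have dn : (0 < tm n%:R - t)%R by rewrite subr_gt0.
have [L [sL Lt KL]] := chain K dn fa fb.
have := HK L sL; rewrite ltnNge KL => H; apply: notF; apply: H.
apply/allP => q /Lt[sq qn]; rewrite -(rtime_ge s) sq /= -(rtime_le s).
by apply/ltW; rewrite addrC subrK in qn.
Unshelve. all: by end_near. Qed.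

Lemma one_sided_ge0 (l : \bar R) : z @ Gq --> l -> 0 <= l.
Proof.
move=> zl; apply: (cvge_to_ge zl); near=> q; apply: z0; near: q; exact: near0.
Unshelve. all: by end_near. Qed.

Let two_step (m : rat -> R) (a b : R) (q q' : rat) n :
  no_crossing n%:R m a b 1 -> (0 <= q)%R -> (q < q')%R -> (q' <= n%:R)%R ->
  (m q <= a)%R -> (m q' < b)%R.
Proof.
move=> H q0 qq' q'n mqa; rewrite ltNge; apply/negP => bm.
have := H [:: q; q']; rewrite /= qq' mqa bm /= ltnn => /(_ isT).
rewrite q0 q'n (ltW (lt_le_trans qq' q'n)) (le_trans q0 (ltW qq')).
by move=> /(_ isT).
Qed.

Let lap_small_near n : (t < tm n%:R)%R -> z @ Gq --> +oo ->
  forall a : R, (0 < a)%R -> \forall q \near Gq, (lap_path n%:R q <= a)%R.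
Proof.
move=> tn zy a a0; have [N lN] := lap_small bk t0 (ltW tn) a0.
have zN := zy; move/cvgeyPge : zN => /(_ N%:R) zN.
have lap_N := lap_lim (ler0n R N) tn (lt_nbhsl lN).
near=> q; have q0 : (0 <= q)%R by near: q; exact: near0.
have qn : (q < n%:R)%R by near: q; exact: near_lt.
have h : (lap k (tm q) (tm n%:R) N%:R%:E < a)%R by near: q; exact: lap_N.
apply/ltW/(le_lt_trans _ h); apply: (lap_le bk) => //.
- exact: tm_ge0.
- by rewrite rtime_le ltW.
- by near: q; exact: zN.
Unshelve. all: by end_near. Qed.

Let lap_near1_near n : (t < tm n%:R)%R -> z @ Gq --> (0 : \bar R) ->
  forall a : R, (0 < a)%R -> \forall q \near Gq, (1 - lap_path n%:R q <= a)%R.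
Proof.
move=> tn zz a a0; have [d d0 ld] := lap_near1 bk t0 (ltW tn) a0.
have zd : \forall q \near Gq, z q < d%:E.
  have /(ecvgP z) [_] := zz; apply; by rewrite lte_fin.
have lap_d := lap_lim (ltW d0) tn (lt_nbhsr ld).
near=> q; have q0 : (0 <= q)%R by near: q; exact: near0.
have qn : (q < n%:R)%R by near: q; exact: near_lt.
have h : (1 - a < lap k (tm q) (tm n%:R) d%:E)%R by near: q; exact: lap_d.
suff : (1 - a <= lap_path n%:R q)%R by lra.
apply/ltW/(lt_le_trans h); apply: (lap_le bk) => //.
- exact: tm_ge0.
- by rewrite rtime_le ltW.
- exact: z0.
- by apply: ltW; near: q; exact: zd.
Unshelve. all: by end_near. Qed.

(** For each rational [b > 0], [m] falls below the corresponding level [a] at times as close to [t]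
    as desired, in particular before [q'], and cannot reach [b] afterwards. *)
Let absorbing (m : rat -> R) q' n :
  (t < tm q')%R -> (q' <= n%:R)%R ->
  (forall b : rat, (0 < b)%R -> exists2 a : R, (0 < a)%R &
        no_crossing n%:R m a (ratr b) 1) ->
  (forall a : R, (0 < a)%R -> \forall q \near Gq, (m q <= a)%R) ->
  (m q' <= 0)%R.
Proof.
move=> tq' q'n nc ma; rewrite leNgt; apply/negP => /rat_between[b /andP[b0 bm]].
have [|a a0 H] := nc b; first by rewrite -(ltr0q R).
have [q [q0 qa qq']] : exists q, [/\ (0 <= q)%R, (m q <= a)%R & (q < q')%R].
  near Gq => q; exists q; split; near: q; [exact: near0|exact: ma|exact: near_lt].
by have := two_step H q0 qq' q'n qa; rewrite ltNge (ltW bm).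
Unshelve. all: by end_near. Qed.

(** The Laplace path tends to 0 along the filter and so vanishes at [q'], but [lap] is positive at
    finite points. *)
Lemma one_sided_absorbing_y q' : z @ Gq --> +oo -> (t < tm q')%R -> z q' = +oo.
Proof.
move=> zy tq'; have [n q'n] := exists_horizon (tm q').
rewrite rtime_lt in q'n.
have q'0 : (0 <= q')%R by rewrite -(rtime_ge s) (le_trans st)// ltW.
have tn : (t < tm n%:R)%R by rewrite (lt_trans tq')// rtime_lt.
have [_ /absorbing nc _] := reg n.
have := nc _ tq' (ltW q'n) (lap_small_near tn zy); rewrite /lap_path leNgt.
case: (z q') (z0 q'0) => [r| |]// r0; rewrite (lap_gt0 bk)//.
- exact: tm_ge0.
- by rewrite rtime_le ltW.
Qed.

(** One minus the Laplace path tends to 0 and so vanishes at [q'], but [lap] is below 1 away from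
    0. *)
Lemma one_sided_absorbing_0 q' : z @ Gq --> (0 : \bar R) -> (t < tm q')%R -> z q' = 0.
Proof.
move=> zz tq'; have [n q'n] := exists_horizon (tm q').
rewrite rtime_lt in q'n.
have q'0 : (0 <= q')%R by rewrite -(rtime_ge s) (le_trans st)// ltW.
have tn : (t < tm n%:R)%R by rewrite (lt_trans tq')// rtime_lt.
have [_ _ /absorbing nc] := reg n.
have := nc _ tq' (ltW q'n) (lap_near1_near tn zz).
apply: contraTeq => zq'; rewrite -ltNge subr_gt0; apply: (lap_lt1 bk).
- exact: tm_ge0.
- by rewrite rtime_le ltW.
- by rewrite lt_neqAle eq_sym zq' z0.
Qed.

End one_sided.
End path_regularity.

Section path_extension.
Variables (R : realType) (k : R -> R -> R.-pker (\bar R) ~> (\bar R)).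
Hypothesis bk : branching_kernels k.
Variables (s : R) (s0 : (0 <= s)%R) (z : rat -> \bar R).
Hypothesis z0 : forall q, (0 <= q)%R -> 0 <= z q.
Hypothesis reg : regular_path k s z.

Definition rat_extension (t : R) : \bar R := lim (z @ rat_near s t^'+).
Local Notation Y := rat_extension.

Let cvg_right (t : R) : x @[x --> t^'+] --> t.
Proof. exact: cvg_within. Qed.

Let cvg_left (t : R) : x @[x --> t^'-] --> t.
Proof. exact: cvg_within. Qed.

Let right_ge t : (s <= t)%R -> \forall x \near t^'+, (s <= x)%R.
Proof.
move=> st; near=> x; rewrite (le_trans st)// ltW//; near: x; exact: nbhs_right_gt.
Unshelve. all: by end_near. Qed.

Let left_ge t : (s < t)%R -> \forall x \near t^'-, (s <= x)%R.
Proof. by move=> st; near=> x; near: x; exact: nbhs_left_ge.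
Unshelve. all: by end_near. Qed.

Let chain_right t : (s <= t)%R -> forall (m : rat -> R) (a b : R) K (d : R), (0 < d)%R ->
  frequently (rat_near s t^'+) [set q | (m q <= a)%R] ->
  frequently (rat_near s t^'+) [set q | (b <= m q)%R] ->
  exists L, [/\ sorted <%O L,
    forall q, q \in L -> (s <= rtime s q)%R /\ (rtime s q < t + d)%R &
    (K <= upc a b false [seq m q | q <- L])%N].
Proof.
move=> st m a b K d d0 fa fb; have [L [sL Lt KL]] := right_chain K d0 fa fb.
by exists L; split => // q /Lt/andP[tq qd]; split => //; rewrite (le_trans st)// ltW.
Qed.

Let chain_left t : (s < t)%R -> forall (m : rat -> R) (a b : R) K (d : R), (0 < d)%R ->
  frequently (rat_near s t^'-) [set q | (m q <= a)%R] ->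
  frequently (rat_near s t^'-) [set q | (b <= m q)%R] ->
  exists L, [/\ sorted <%O L,
    forall q, q \in L -> (s <= rtime s q)%R /\ (rtime s q < t + d)%R &
    (K <= upc a b false [seq m q | q <- L])%N].
Proof.
move=> st m a b K d d0 fa fb.
have ts0 : (0 < t - s)%R by rewrite subr_gt0.
have [L [sL Lt KL]] := left_chain K ts0 fa fb.
by exists L; split => // q /Lt/andP[tq qd]; split; lra.
Qed.

Lemma rat_extension_right t : (s <= t)%R -> z @ rat_near s t^'+ --> Y t.
Proof.
move=> st.
have [l zl] := one_sided_limit bk s0 z0 reg _ (@rat_right_proper _ s t) st
  (@cvg_right t) (right_ge st) (chain_right st).
apply: cvgP; exact: zl.
Qed.

Lemma rat_extension_ge0 t : (s <= t)%R -> 0 <= Y t.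
Proof.
move=> st; exact: (one_sided_ge0 z0 _ (@rat_right_proper _ s t) (right_ge st)
  (rat_extension_right st)).
Qed.

Lemma rat_extension_eq t (l : \bar R) : z @ rat_near s t^'+ --> l -> Y t = l.
Proof. by move/cvg_lim; apply; exact: ereal_hausdorff. Qed.

(** The value of [Y] at [x] is a limit of [z] just after [x], so bounds on [z] pass to [Y] wherever
    they hold to the right of [x]. The second hypothesis provides this near the limit, for right and
    left neighbourhoods alike. *)
Lemma rat_extension_cvg (G : set_system R) {FG : Filter G} (l : \bar R) :
  (\forall x \near G, (s <= x)%R) ->
  (forall A, G A -> \forall x \near G, \forall y \near x^'+, A y) ->
  z @ rat_near s G --> l -> Y @ G --> l.
Proof.
move=> Gs Gr /ecvgP[H1 H2]; apply/ecvgP; split => [a|b].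
- move=> /gte_EFin_dense[c /H1 cl ac]; have := Gr _ cl.
  apply: filter_app; apply: filter_app Gs; apply: nearW => x sx cx.
  apply: (@lt_le_trans _ _ c%:E); first by rewrite lte_fin.
  apply: (cvge_to_ge (rat_extension_right sx)).
  by apply: filterS cx => y cy q /cy/ltW.
- move=> /lte_EFin_dense[c /H2 cl ac]; have := Gr _ cl.
  apply: filter_app; apply: filter_app Gs; apply: nearW => x sx cx.
  apply: (@le_lt_trans _ _ c%:E); last by rewrite lte_fin.
  apply: (cvge_to_le (rat_extension_right sx)).
  by apply: filterS cx => y cy q /cy/ltW.
Qed.

Lemma rat_extension_right_continuous t : (s <= t)%R -> Y @ t^'+ --> Y t.
Proof.
move=> st; apply: rat_extension_cvg; [exact: right_ge| |exact: rat_extension_right].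
move=> A /near_right_delta[d d0 H]; apply/near_right_delta; exists d => // x /andP[tx xd].
apply/near_right_delta; exists (t + d - x)%R; first by rewrite subr_gt0.
by move=> y /andP[xy yd]; apply: H; apply/andP; split; lra.
Qed.

Lemma rat_extension_left t : (s < t)%R -> exists l : \bar R, z @ rat_near s t^'- --> l.
Proof.
move=> st; exact: (one_sided_limit bk s0 z0 reg _ (@rat_left_proper _ s t) (ltW st)
  (@cvg_left t) (left_ge st) (chain_left st)).
Qed.

Lemma rat_extension_left_cvg t (l : \bar R) : (s < t)%R -> z @ rat_near s t^'- --> l ->
  Y @ t^'- --> l.
Proof.
move=> st; apply: rat_extension_cvg; first exact: left_ge.
move=> A /near_left_delta[d d0 H]; apply/near_left_delta; exists d => // x /andP[tx xd].
apply/near_right_delta; exists (t - x)%R; first by rewrite subr_gt0.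
by move=> y /andP[xy yd]; apply: H; apply/andP; split; lra.
Qed.

Let rat_extension_const t u l : (t <= u)%R ->
  (forall q, (t < rtime s q)%R -> z q = l) -> Y u = l.
Proof.
move=> tu zl; apply: rat_extension_eq; apply: cvg_near_cst.
apply: filterS (nbhs_right_gt u) => x ux q qx.
by apply/zl; rewrite qx (le_lt_trans tu).
Qed.

Lemma rat_extension_absorbing t u : (s <= t)%R -> (t <= u)%R ->
  Y t = 0 \/ Y t = +oo -> Y u = Y t.
Proof.
move=> st tu; have := rat_extension_right st => + H; case: H => -> zY.
- apply: rat_extension_const tu _ => q; exact: (one_sided_absorbing_0 bk s0 z0 reg
    _ (@rat_right_proper _ s t) st (@cvg_right t) (right_ge st) zY).
- apply: rat_extension_const tu _ => q; exact: (one_sided_absorbing_y bk s0 z0 reg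
    _ (@rat_right_proper _ s t) st (@cvg_right t) (right_ge st) zY).
Qed.

Lemma rat_extension_left_absorbing t u (l : \bar R) : (s < t)%R -> (t <= u)%R ->
  z @ rat_near s t^'- --> l -> l = 0 \/ l = +oo -> Y u = l.
Proof.
move=> st tu + H; case: H => -> zY.
- apply: rat_extension_const tu _ => q; exact: (one_sided_absorbing_0 bk s0 z0 reg
    _ (@rat_left_proper _ s t) (ltW st) (@cvg_left t) (left_ge st) zY).
- apply: rat_extension_const tu _ => q; exact: (one_sided_absorbing_y bk s0 z0 reg
    _ (@rat_left_proper _ s t) (ltW st) (@cvg_left t) (left_ge st) zY).
Qed.

(** Before [s] the path is held at [Y s]: this keeps it cadlag, normalised at negative times and
    compatible with absorption, and leaves the coordinates from [s] on untouched. *)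
Lemma rat_extension_Dpath : is_Dpath (fun r => Y (Num.max s r)).
Proof.
have sm r : (s <= Num.max s r)%R by rewrite le_max lexx.
have mle t u : (t <= u)%R -> (Num.max s t <= Num.max s u)%R.
  by move=> tu; rewrite ge_max sm /= le_max tu orbT.
have left_lt r : (r <= s)%R -> Y (Num.max s x) @[x --> r^'-] --> Y s.
  move=> rs; apply: cvg_near_cst; near=> x; congr Y; apply/max_idPl.
  by rewrite (le_trans _ rs)// ltW//; near: x; exact: nbhs_left_lt.
have left_gt r : (s < r)%R -> exists2 l : \bar R, z @ rat_near s r^'- --> l &
    Y (Num.max s x) @[x --> r^'-] --> l.
  move=> sr; have [l zl] := rat_extension_left sr; exists l => //.
  apply: cvg_trans (rat_extension_left_cvg sr zl); apply: near_eq_cvg.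
  near=> x; congr Y; apply/esym/max_idPr; near: x; exact: left_ge.
split; [|split; [|split; [|split; [|split]]]].
- by move=> t t0; congr Y; rewrite !(max_idPl _)// (le_trans (ltW t0)).
- by move=> t _; exact: rat_extension_ge0.
- move=> t t0; have [st|ts] := leP s t.
    apply: cvg_trans (rat_extension_right_continuous st).
    apply: near_eq_cvg; near=> x; congr Y; apply/esym/max_idPr; near: x; exact: right_ge.
  apply: cvg_near_cst; near=> x; congr Y.
  by apply/max_idPl; near: x; exact: nbhs_right_le.
- move=> t t0; have [st|ts] := ltP s t; last by apply: cvgP (left_lt _ ts).
  by have [l _ Yl] := left_gt _ st; apply: cvgP Yl.
- by move=> t t0 H u tu; apply: rat_extension_absorbing H => //; exact: mle.
- move=> t t0 + u tu; have [st|ts] := ltP s t.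
    have [l zl Yl] := left_gt _ st; rewrite (cvg_lim (@ereal_hausdorff R) Yl).
    by apply: rat_extension_left_absorbing zl; rewrite // le_max tu orbT.
  rewrite (cvg_lim (@ereal_hausdorff R) (left_lt _ ts)).
  exact: rat_extension_absorbing.
Unshelve. all: by end_near. Qed.

End path_extension.

(** * The process in continuous time *)

Section nonnegative_extension.
Variables (R : realType) (k : R -> R -> R.-pker (\bar R) ~> (\bar R)).
Hypothesis bk : branching_kernels k.

(* Branching kernels are only constrained on [0, oo]; stopping the process at
   negative points yields a consistent family on the whole extended line. *)
Definition kstop (p : R.-pker (\bar R) ~> (\bar R)) (y : \bar R) : {measure set (\bar R) -> \bar R} :=
  if 0 <= y then p y else dirac y.

Let measurable_kstop p B : measurable B -> measurable_fun setT (kstop p ^~ B).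
Proof.
move=> mB; rewrite (_ : kstop p ^~ B = fun y => if 0 <= y then p y B else \d_y B).
  apply: measurable_fun_ifT => //.
  - exact: measurable_fun_lee.
  - exact: measurable_kernel.
  - by apply/measurable_EFinP; exact: measurable_indic.
by apply/funext => y; rewrite /kstop; case: ifP.
Qed.

HB.instance Definition _ p := isKernel.Build _ _ _ _ _ (kstop p) (measurable_kstop p).

Let kstop_prob p y : kstop p y setT = 1.
Proof. by rewrite /kstop; case: ifP => _; [exact: prob_kernel|exact: diracT]. Qed.

HB.instance Definition _ p := Kernel_isProbability.Build _ _ _ _ _ (kstop p) (kstop_prob p).

Definition pstop a b : R.-pker (\bar R) ~> (\bar R) := kstop (k a b).

Lemma pstopE a b y B : 0 <= y -> pstop a b y B = k a b y B.
Proof. by rewrite /pstop /= /kstop => ->. Qed.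

Lemma pstop_neg a b y B : y < 0 -> pstop a b y B = \d_y B.
Proof. by rewrite ltNge /pstop /= /kstop; case: ifP. Qed.

Lemma pstop_id a y B : (0 <= a)%R -> measurable B -> pstop a a y B = \d_y B.
Proof.
move=> a0 mB; have [y0|/pstop_neg//] := leP 0 y.
by rewrite pstopE// (kernel_id bk).
Qed.

Lemma pstop_CK a b c y B : (0 <= a)%R -> (a <= b)%R -> (b <= c)%R -> measurable B ->
  pstop a c y B = \int[pstop a b y]_z pstop b c z B.
Proof.
move=> a0 ab bc mB; have mp := measurable_kernel (pstop b c) _ mB.
have [y0|y0] := leP 0 y; last first.
  rewrite pstop_neg// (eq_measure_integral (\d_y)); last first.
    by move=> C mC _; rewrite pstop_neg.
  by rewrite (integral_dirac y measurableT mp) diracT mul1e pstop_neg.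
rewrite pstopE// (kernel_CK bk a0 ab bc)//.
rewrite [RHS](eq_measure_integral (k a b y)); last by move=> C mC _; rewrite pstopE.
apply: ae_eq_integral => //.
  exact: measurable_kernel.
exists [set z | z < 0]; split; last 2 first.
- exact: (kernel_neg0 bk).
- move=> z /= /not_implyP[_ H]; rewrite ltNge; apply/negP => z0.
  by apply: H; rewrite pstopE.
by rewrite -set_itvNyo; exact: emeasurable_itv.
Qed.

(** Clamping at 0 intertwines the stopped kernel with the branching one: a stopped negative point is
    sent to 0, where the branching process stays as well. *)
Lemma pstop_max a b y B : (0 <= a)%R -> (a <= b)%R -> measurable B ->
  pstop a b y (Order.max 0 @^-1` B) = k a b (Order.max 0 y) B.
Proof.
move=> a0 ab mB.
have mmax : measurable_fun setT (Order.max (0 : \bar R)) by exact: measurable_maxe.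
have mB' : measurable (Order.max (0 : \bar R) @^-1` B).
  by rewrite -[X in measurable X]setTI; exact: mmax.
have [y0|y0] := leP 0 y; last first.
  rewrite pstop_neg// (kernel0 bk)// !diracE; congr ((_ : bool)%:R%:E).
  by apply/idP/idP; rewrite !inE /= (max_idPl (ltW y0)).
rewrite pstopE//; apply: (@measure_mod_null _ _ _ _ [set z | z < 0]) => //.
- by rewrite -set_itvNyo; exact: emeasurable_itv.
- exact: (kernel_neg0 bk).
- by move=> z /= /negP; rewrite -leNgt => z0; rewrite (max_idPr z0).
Qed.

End nonnegative_extension.

Section skeleton.
Variables (R : realType) (k : R -> R -> R.-pker (\bar R) ~> (\bar R)).
Hypothesis bk : branching_kernels k.

Lemma exists_branching_skeleton (s : R) (x0 : \bar R) : (0 <= s)%R -> 0 <= x0 ->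
  exists (P : probability (measurableTypeR R) R)
      (Z : rat -> measurableTypeR R -> \bar R),
    [/\ forall q, measurable_fun setT (Z q), forall q u, 0 <= Z q u,
      P (Z 0%R @^-1` [set x0]) = 1 &
      forall q q' C B, (0 <= q)%R -> (q <= q')%R ->
        <<s past_gen Z q >> C -> measurable B ->
        P (C `&` Z q' @^-1` B) =
        \int[P]_(u in C) k (rtime s q) (rtime s q') (Z q u) B].
Proof.
move=> s0 x00.
have [P [Z [mZ Z0 ZM]]] := exists_rational_process x0
  (fun a b c y B (sa : (s <= a)%R) ab bc mB =>
     pstop_CK bk y (le_trans s0 sa) ab bc mB)
  (fun a y B (sa : (s <= a)%R) mB => pstop_id bk y (le_trans s0 sa) mB).
(* Clamping makes the process nonnegative everywhere, not just almost surely, and its past is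
   contained in that of [Z]. *)
pose Z' q u := Order.max 0 (Z q u).
have mmax : measurable_fun setT (Order.max (0 : \bar R)) by exact: measurable_maxe.
have mZ' q : measurable_fun setT (Z' q) by exact: measurableT_comp.
exists P, Z'; split => //.
- by move=> q u; rewrite /Z' le_max lexx.
- apply/eqP; rewrite eq_le probability_le1 /=; last first.
    by rewrite -[X in measurable X]setTI; apply: mZ'.
  rewrite -{1}Z0; apply: le_measure; rewrite ?inE.
  + by rewrite -[X in measurable X]setTI; apply: mZ.
  + by rewrite -[X in measurable X]setTI; apply: mZ'.
  + by move=> u /= Zu; rewrite /Z' Zu (max_idPr x00).
- move=> q q' C B q0 qq' sC mB.
  have mB' : measurable (Order.max (0 : \bar R) @^-1` B).
    by rewrite -[X in measurable X]setTI; exact: mmax.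
  have sC' : <<s past_gen Z q >> C.
    apply: (smallest_sub _ _ sC); first exact: smallest_sigma_algebra.
    move=> _ [r [rq [D [mD ->]]]]; apply: sub_sigma_algebra; exists r; split => //.
    exists (Order.max (0 : \bar R) @^-1` D); split => //.
    by rewrite -[X in measurable X]setTI; exact: mmax.
  rewrite (_ : Z' q' @^-1` B = Z q' @^-1` (Order.max (0 : \bar R) @^-1` B))//.
  rewrite (ZM _ _ _ _ q0 qq' sC' mB'); apply: eq_integral => u _.
  rewrite (pstop_max bk)//; last by rewrite rtime_le.
  by rewrite (le_trans s0)// rtime_ge.
Qed.

End skeleton.

Section transition.
Context d (U : measurableType d) (R : realType).
Variables (P : probability U R) (C : set U) (mC : measurable C).

Definition prestr : set U -> \bar R := mrestr P mC.

HB.instance Definition _ := Measure.on prestr.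

Let prestr_setT : prestr setT <= 1.
Proof. by rewrite /prestr /mrestr probability_le1//; exact: measurableI. Qed.

HB.instance Definition _ :=
  Measure_isSubProbability.Build _ _ _ prestr prestr_setT.

Definition grestr : giry U R := prestr.

Lemma integral_grestr (f : U -> \bar R) : measurable_fun setT f ->
  (forall u, 0 <= f u) -> \int[grestr]_u f u = \int[P]_(u in C) f u.
Proof. exact: ge0_integral_mrestr. Qed.

Variables (kap : R.-pker (\bar R) ~> (\bar R)) (X : U -> \bar R).
Hypothesis mX : measurable_fun setT X.

Let mkX : measurable_fun setT (kgiry kap measurableT \o X).
Proof. exact: measurableT_comp (measurable_kgiry kap measurableT) mX. Qed.

Definition transition_law : giry (\bar R) R := giry_bind grestr mkX.

Lemma transition_lawE B : measurable B ->
  transition_law B = \int[P]_(u in C) kap (X u) B.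
Proof.
move=> mB; rewrite [LHS]giry_bindE//= integral_grestr.
- by apply: eq_integral => u _; rewrite kgiryE setIT.
- have := measurableT_comp (measurable_kernel kap _ mB) mX.
  by apply: eq_measurable_fun => u _; rewrite /= kgiryE setIT.
- by move=> u; exact: measure_ge0.
Qed.

Lemma integral_transition_law (g : \bar R -> \bar R) : measurable_fun setT g ->
  (forall y, 0 <= g y) ->
  \int[transition_law]_y g y = \int[P]_(u in C) \int[kap (X u)]_y g y.
Proof.
move=> mg g0.
have := @giry_int_bind _ _ _ _ _ grestr _ mkX g mg g0.
rewrite /giry_int /transition_law => ->.
rewrite integral_grestr.
- by apply: eq_integral => u _; rewrite /= integral_kgiry.
- have := measurableT_comp (measurable_fun_integral_kernel
    (fun B mB => measurable_kernel kap B mB) g0 mg) mX.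
  by apply: eq_measurable_fun => u _; rewrite /= integral_kgiry.
- by move=> u; apply: integral_ge0.
Qed.

(** Passes from sets to nonnegative functions: the hypothesis says that the law of [Y] on [C] is
    [transition_law]. *)
Lemma integral_transition (Y : U -> \bar R) (g : \bar R -> \bar R) :
  measurable_fun setT Y ->
  (forall B, measurable B -> P (C `&` Y @^-1` B) = \int[P]_(u in C) kap (X u) B) ->
  measurable_fun setT g -> (forall y, 0 <= g y) ->
  \int[P]_(u in C) g (Y u) = \int[P]_(u in C) \int[kap (X u)]_y g y.
Proof.
move=> mY H mg g0; rewrite -integral_transition_law//.
rewrite -(ge0_integral_restricted_law P mC mY mg g0).
apply: eq_measure_integral => B mB _.
by rewrite [LHS]mrestricted_lawE [RHS]transition_lawE//; exact: H.
Qed.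

End transition.

Lemma no_crossing_eq (R : realType) (T : rat) (m m' : rat -> R) a b K :
  (forall q, (0 <= q <= T)%R -> m q = m' q) ->
  no_crossing T m a b K -> no_crossing T m' a b K.
Proof.
move=> mm' H L sL LT; rewrite -(_ : [seq m q | q <- L] = [seq m' q | q <- L]); last first.
  by apply/eq_in_map => q /(allP LT); exact: mm'.
exact: H.
Qed.

Lemma ae_forall_count d (U : measurableType d) (R : realType)
    (P : {measure set U -> \bar R}) (I : countType) (A : I -> U -> Prop) :
  (forall i, {ae P, forall u, A i u}) -> {ae P, forall u, forall i, A i u}.
Proof.
move=> H; have : {ae P, forall u, forall n, if unpickle n is Some i then A i u else True}.
  by apply: ae_foralln => n; case: (unpickle n) => [i|]; [exact: H|exact: aeW].
by apply: filterS => u Hu i; have := Hu (pickle i); rewrite pickleK.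
Qed.

(** * Almost sure regularity of the rational process *)

Section skeleton_regularity.
Variables (R : realType) (k : R -> R -> R.-pker (\bar R) ~> (\bar R)).
Hypothesis bk : branching_kernels k.
Variables (s : R) (s0 : (0 <= s)%R).
Context d (U : measurableType d) (P : probability U R).
Variable Z : rat -> U -> \bar R.
Hypothesis mZ : forall q, measurable_fun setT (Z q).
Hypothesis Z0 : forall q u, 0 <= Z q u.
Hypothesis ZM : forall q q' C B, (0 <= q)%R -> (q <= q')%R ->
  <<s past_gen Z q >> C -> measurable B ->
  P (C `&` Z q' @^-1` B) =
  \int[P]_(u in C) k (rtime s q) (rtime s q') (Z q u) B.
Local Notation tm := (rtime s).

Lemma skeleton_kexp q q' C g : (0 <= q)%R -> (q <= q')%R ->
  <<s past_gen Z q >> C -> bounded_measurable g -> (forall y, 0 <= g y)%R ->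
  \int[P]_(u in C) (g (Z q' u))%:E =
  \int[P]_(u in C) (kexp k g (tm q) (tm q') (Z q u))%:E.
Proof.
move=> q0 qq' sC bg g0.
under [RHS]eq_integral do rewrite -kexpE//.
apply: (@integral_transition _ _ _ _ _ (past_measurable mZ sC) (k (tm q) (tm q')) (Z q)
  (mZ q) (Z q') (EFin \o g) (mZ q')).
- by move=> B mB; exact: ZM.
- by apply/measurable_EFinP; case: bg.
- by move=> y; rewrite lee_fin.
Qed.

Section affine_martingale.
Variables (al be : R) (T : rat).
Hypothesis albe : forall l, (0 <= l <= 1)%R -> (0 <= al + be * l)%R.

(** The upcrossing results speak of all rational times; [max 0 q] freezes the filtration and the
    martingale before time 0. *)
Let F (q : rat) : set_system U := <<s past_gen Z (Num.max 0 q)%R >>.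
Let g (a : R) (y : \bar R) : R := (al + be * lap k a (tm T) y)%R.
Let M (q : rat) (u : U) : R := g (tm (Num.max 0 q)%R) (Z (Num.max 0 q)%R u).

Let g0 a y : (0 <= g a y)%R.
Proof. by apply: albe; rewrite lap_ge0 lap_le1. Qed.

Let bg a : bounded_measurable (g a).
Proof. by apply: bounded_measurable_affine; exact: bounded_lap. Qed.

Let F_meas q C : F q C -> measurable C.
Proof. exact: past_measurable. Qed.

Let F_sigma q : sigma_algebra setT (F q).
Proof. exact: smallest_sigma_algebra. Qed.

Let FC q C : F q C -> F q (~` C).
Proof. by have [_ + _] := F_sigma q => /[apply]; rewrite setTD. Qed.

Let FI q C D : F q C -> F q D -> F q (C `&` D).
Proof.
move=> FqC FqD.
exact: (@measurableI _ (g_sigma_algebraType (past_gen Z (Num.max 0 q)%R)) C D).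
Qed.

Let F_mono q q' C : (q <= q')%R -> F q C -> F q' C.
Proof.
move=> qq'; apply: smallest_sub; first exact: F_sigma.
move=> _ [r [/andP[r0 rq] [B [mB ->]]]]; apply: sub_sigma_algebra; exists r.
split; last by exists B.
by rewrite r0 (le_trans rq)// ge_max le_max lexx /= le_max qq' orbT.
Qed.

Let F_pre q (A : set R) : measurable A -> F q (M q @^-1` A).
Proof.
move=> mA; apply: sub_sigma_algebra; exists (Num.max 0 q)%R; split.
  by rewrite le_max !lexx.
exists (g (tm (Num.max 0 q)%R) @^-1` A); split => //.
by rewrite -[X in measurable X]setTI; apply: (bg _).1.
Qed.

Let F_le q c : F q [set u | (M q u <= c)%R].
Proof.
rewrite (_ : [set u | _] = M q @^-1` `]-oo, c]%classic); first exact: F_pre.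
by apply/seteqP; split => u /=; rewrite in_itv.
Qed.

Let F_ge q c : F q [set u | (c <= M q u)%R].
Proof.
rewrite (_ : [set u | _] = M q @^-1` `[c, +oo[%classic); first exact: F_pre.
by apply/seteqP; split => u /=; rewrite in_itv/= andbT.
Qed.

Let mM q : measurable_fun setT (M q).
Proof. exact: (measurableT_comp (bg _).1). Qed.

Let M0 q u : (0 <= M q u)%R. Proof. exact: g0. Qed.

Let martM q q' C : (0 <= q)%R -> (q <= q')%R -> (q' <= T)%R ->
  F q C -> \int[P]_(u in C) (M q' u)%:E <= \int[P]_(u in C) (M q u)%:E.
Proof.
move=> q0 qq' q'T; have q'0 := le_trans q0 qq'.
rewrite /F /M (max_r q0) (max_r q'0) => FC'.
(* Equality holds here: the mean of [lap] at [q'] given the state at [q] is [lap] at [q], and affine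
   functions pass through [kexp]. *)
rewrite (skeleton_kexp q0 qq' FC' (bg _) (g0 _)) le_eqVlt; apply/orP; left; apply/eqP.
apply: eq_integral => u _; congr EFin; rewrite /g kexp_affine; last exact: bounded_lap.
rewrite (lap_CK bk)// ?rtime_le//.
by rewrite (le_trans s0)// rtime_ge.
Qed.

Let FT : F 0%R setT.
Proof. by rewrite -setC0; apply: FC; case: (F_sigma 0%R). Qed.

Let back u a b K : no_crossing T (M ^~ u) a b K ->
  no_crossing T (fun q => al + be * lap_path k s (Z ^~ u) T q)%R a b K.
Proof. by apply: no_crossing_eq => q /andP[q0 _]; rewrite /M /g max_r. Qed.

Lemma affine_oscillation a b : (0 <= a)%R -> (a < b)%R ->
  {ae P, forall u, exists K,
    no_crossing T (fun q => al + be * lap_path k s (Z ^~ u) T q)%R a b K}.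
Proof.
move=> a0 ab.
have [N [mN N0 H]] := oscillation_null F_meas FI FC F_mono F_le F_ge mM M0 martM FT a0 ab.
exists N; split => // u /=; apply: contra_notP => /H[K uK].
by exists K; exact: back.
Qed.

Lemma affine_absorption b : (0 < b)%R ->
  {ae P, forall u, exists2 a : R, (0 < a)%R &
    no_crossing T (fun q => al + be * lap_path k s (Z ^~ u) T q)%R a b 1}.
Proof.
move=> b0.
have [N [mN N0 H]] := absorption_null F_meas FI FC F_mono F_le F_ge mM M0 martM FT b0.
exists N; split => // u /=; apply: contra_notP => /H[a a0 ua].
by exists a => //; exact: back.
Qed.

End affine_martingale.

Lemma skeleton_regular_path :
  {ae P, forall u, regular_path k s (Z ^~ u)}.
Proof.
(* The two affine functionals are [l] and [1 - l]: the Laplace martingale detects the approach to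
   oo, its complement the approach to 0. *)
have p01 l : (0 <= l <= 1)%R -> (0 <= 0 + 1 * l :> R)%R by lra.
have p11 l : (0 <= l <= 1)%R -> (0 <= 1 + -1 * l :> R)%R by lra.
have h1 (i : nat * (rat * rat)) : {ae P, forall u, (0 <= i.2.1)%R -> (i.2.1 < i.2.2)%R ->
    exists K, no_crossing i.1%:R (lap_path k s (Z ^~ u) i.1%:R) (ratr i.2.1) (ratr i.2.2) K}.
  have [a0|a0] := leP 0%R i.2.1; last by apply: aeW => u.
  have [ab|ab] := ltP i.2.1 i.2.2; last by apply: aeW => u.
  have a0' : (0 <= ratr i.2.1 :> R)%R by rewrite ler0q.
  have ab' : (ratr i.2.1 < ratr i.2.2 :> R)%R by rewrite ltr_rat.
  have := affine_oscillation i.1%:R p01 a0' ab'.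
  apply: filterS => u [K HK] _ _; exists K; apply: no_crossing_eq HK => q _.
  by rewrite add0r mul1r.
have h2 (i : nat * rat) : {ae P, forall u, (0 < i.2)%R -> exists2 a : R, (0 < a)%R &
    no_crossing i.1%:R (lap_path k s (Z ^~ u) i.1%:R) a (ratr i.2) 1}.
  have [b0|b0] := ltP 0%R i.2; last by apply: aeW => u.
  have b0' : (0 < ratr i.2 :> R)%R by rewrite ltr0q.
  have := affine_absorption i.1%:R p01 b0'.
  apply: filterS => u [a a0 HK] _; exists a => //; apply: no_crossing_eq HK => q _.
  by rewrite add0r mul1r.
have h3 (i : nat * rat) : {ae P, forall u, (0 < i.2)%R -> exists2 a : R, (0 < a)%R &
    no_crossing i.1%:R (fun q => 1 - lap_path k s (Z ^~ u) i.1%:R q)%R a (ratr i.2) 1}.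
  have [b0|b0] := ltP 0%R i.2; last by apply: aeW => u.
  have b0' : (0 < ratr i.2 :> R)%R by rewrite ltr0q.
  have := affine_absorption i.1%:R p11 b0'.
  apply: filterS => u [a a0 HK] _; exists a => //; apply: no_crossing_eq HK => q _.
  by rewrite mulN1r.
apply: filterS3 (ae_forall_count h1) (ae_forall_count h2) (ae_forall_count h3).
move=> u H1 H2 H3 n T; split.
- by move=> a b; exact: (H1 (n, (a, b))).
- by move=> b; exact: (H2 (n, b)).
- by move=> b; exact: (H3 (n, b)).
Qed.

End skeleton_regularity.

Lemma bounded_cvg_integral d (U : measurableType d) (R : realType)
    (mu : {measure set U -> \bar R}) (D : set U) (f_ : nat -> U -> R) (f : U -> R) (M : R) :
  mu setT < +oo -> measurable D ->
  (forall n, measurable_fun D (f_ n)) -> measurable_fun D f ->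
  (forall n u, D u -> `|f_ n u| <= M)%R ->
  (forall u, D u -> f_ n u @[n --> \oo] --> f u) ->
  \int[mu]_(u in D) (f_ n u)%:E @[n --> \oo] --> \int[mu]_(u in D) (f u)%:E.
Proof.
move=> muoo mD mf_ mf f_M f_f.
apply: (@dominated_cvg _ _ _ mu D mD (fun n u => (f_ n u)%:E) (fun u => (f u)%:E)
  (fun=> M%:E)).
- by move=> n; exact/measurable_EFinP.
- by move=> u Du; apply: cvg_EFin; [exact: nearW|exact: f_f].
- by [].
- apply: (integrableS measurableT) => //.
  have : bounded_measurable (fun _ : U => M) by split => //; exists `|M|%R.
  exact: bounded_measurable_integrable.
- by move=> n u Du; rewrite abse_EFin lee_fin f_M.
Qed.

(** * Measures on [0, oo] are determined by continuous functions *)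

Section nonnegative_measures.
Variable R : realType.
Implicit Types m : {measure set (\bar R) -> \bar R}.

(** The positive part of [exp(-c) - exp(-y)], written with an absolute value to make its continuity
    immediate. For c, y >= 0 it is positive exactly when y > c, so [1 - (1 - phi) ^+ n] tends to the
    indicator of that ray. *)
Let phi (c : R) (y : \bar R) : R :=
  (((expNe c%:E - expNe y) + `|expNe c%:E - expNe y|) / 2)%R.

Let phiE c y : phi c y = Num.max 0%R (expNe c%:E - expNe y)%R.
Proof.
rewrite /phi; have [h|h] := leP 0%R (expNe c%:E - expNe y)%R.
  by rewrite ger0_norm//; move: (_ - _)%R => r; lra.
by rewrite ltr0_norm// subrr mul0r.
Qed.

Let test (c : R) n (y : \bar R) : R := (1 - (1 - phi c y) ^+ n)%R.

Let phi01 c y : (0 <= phi c y <= 1)%R.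
Proof.
apply/andP; split; first by rewrite phiE le_max lexx.
by rewrite phiE ge_max ler01 lerBlDr (le_trans (expNe_le1 _))// lerDl expNe_ge0.
Qed.

Let test01 c n y : (0 <= test c n y <= 1)%R.
Proof.
have /andP[p0 p1] := phi01 c y.
have h : (0 <= (1 - phi c y) ^+ n <= 1)%R.
  by rewrite exprn_ge0 ?subr_ge0// exprn_ile1 ?subr_ge0// gerBl.
by rewrite /test; lra.
Qed.

Let continuous_phi c : continuous (phi c).
Proof.
move=> y; apply: cvgM; last exact: cvg_cst.
have h : (fun z => expNe c%:E - expNe z)%R z @[z --> y] --> (expNe c%:E - expNe y)%R.
  by apply: cvgB; [exact: cvg_cst|exact: expNe_continuous].
by apply: cvgD => //; exact: cvg_norm.
Qed.

Let continuous_test c n : continuous (test c n).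
Proof.
move=> y; apply: cvgB; first exact: cvg_cst.
elim: n => [|n ih].
  by under eq_fun do rewrite expr0; rewrite expr0; exact: cvg_cst.
under eq_fun do rewrite exprS; rewrite exprS; apply: cvgM => //.
by apply: cvgB; [exact: cvg_cst|exact: continuous_phi].
Qed.

Let measurable_phi c : measurable_fun setT (phi c).
Proof.
rewrite (_ : phi c = fun y => Num.max 0%R (expNe c%:E - expNe y)%R).
  by apply: measurable_maxr => //; apply: measurable_funB => //; exact: measurable_expNe.
by apply/funext => y; exact: phiE.
Qed.

Let measurable_test c n : measurable_fun setT (test c n).
Proof.
apply: measurable_funB => //; apply: measurable_funX.
by apply: measurable_funB => //; exact: measurable_phi.
Qed.

Let test_cvg c y : test c n y @[n --> \oo] -->
  (\1_[set z : \bar R | expNe z < expNe c%:E]%R y : R).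
Proof.
rewrite indicE; have [yc|cy] := boolP (y \in _).
  rewrite inE /= in yc; rewrite -[X in _ --> X]subr0; apply: cvgB; first exact: cvg_cst.
  apply: cvg_expr; have /andP[p0 p1] := phi01 c y.
  rewrite ger0_norm ?subr_ge0// gtrBl phiE lt_max subr_gt0 yc orbT//.
apply: cvg_near_cst; apply: nearW => n; rewrite /test phiE.
rewrite notin_setE /= in cy; rewrite max_l ?subr0 ?expr1n ?subrr//.
by rewrite subr_le0 leNgt; exact/negP.
Qed.

(** Rays at nonnegative levels are reached as limits of the continuous [test] functions. As [expNe]
    is decreasing only on [0, oo], the set [expNe z < expNe c] agrees with the ray up to negative
    points, which carry no mass. *)
Lemma nonneg_measure_ext m1 m2 : m1 setT < +oo -> m2 setT < +oo ->
  m1 [set y | y < 0] = 0 -> m2 [set y | y < 0] = 0 ->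
  (forall g : \bar R -> R, bounded_measurable g -> continuous g -> (forall y, 0 <= g y)%R ->
    \int[m1]_y (g y)%:E = \int[m2]_y (g y)%:E) ->
  forall B, measurable B -> m1 B = m2 B.
Proof.
move=> m1oo m2oo m10 m20 H.
have mneg : measurable [set y : \bar R | y < 0].
  by rewrite -set_itvNyo; exact: emeasurable_itv.
have mS c : measurable [set z : \bar R | expNe z < expNe c%:E]%R.
  rewrite (_ : [set _ | _] = @expNe R @^-1` `]-oo, expNe c%:E[%classic).
    by rewrite -[X in measurable X]setTI; exact: measurable_expNe.
  by apply/seteqP; split => z /=; rewrite in_itv.
have mT : m1 setT = m2 setT.
  have := H (fun=> 1%R) (bounded_measurable_cst 1) (fun y => @cvg_cst _ _ _ _ _).
  by rewrite !integral_cst// !mul1e; apply.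
have raylaw m c : m [set y | y < 0] = 0 -> (0 <= c)%R ->
    m (eray c) = m [set z : \bar R | expNe z < expNe c%:E]%R.
  move=> m0 c0; apply: (measure_mod_null _ _ mneg m0) => //.
    exact: measurable_eray.
  move=> y /negP; rewrite -leNgt => y0; split => [cy|].
    by apply: expNe_lt; rewrite ?lee_fin.
  rewrite /eray; apply: contraTT; rewrite -!leNgt le_eqVlt => /predU1P[->//|yc].
  exact/ltW/expNe_lt.
have raylaw_neg m c : m [set y | y < 0] = 0 -> (c < 0)%R -> m (eray c) = m setT.
  move=> m0 c0; apply: (measure_mod_null _ _ mneg m0) => //.
    exact: measurable_eray.
  move=> y /= /negP; rewrite -leNgt => y0; split => // _.
  by rewrite /eray/= (lt_le_trans _ y0)// lte_fin.
have lim_law m c : m setT < +oo -> \int[m]_y (test c n y)%:E @[n --> \oo] -->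
    m [set z : \bar R | expNe z < expNe c%:E]%R.
  move=> moo; rewrite -(setIT [set z | _]) -integral_indic//.
  apply: (@bounded_cvg_integral _ _ _ _ _ _ _ 1%R) => //.
  by move=> n y _; have /andP[t0 t1] := test01 c n y; rewrite ger0_norm.
apply: emeasure_ext => // q; have [q0|q0] := leP 0%R (ratr q : R); last first.
  by rewrite !raylaw_neg.
rewrite !raylaw//; have := lim_law m1 (ratr q) m1oo.
rewrite (_ : (fun n => _) = fun n => \int[m2]_y (test (ratr q) n y)%:E).
  move=> h; exact: (cvg_unique (@ereal_hausdorff R) h (lim_law m2 _ m2oo)).
apply/funext => n; apply: H.
- split; first exact: measurable_test.
  by exists 1%R => y; have /andP[t0 t1] := test01 (ratr q) n y; rewrite ger0_norm.
- exact: continuous_test.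
- by move=> y; have /andP[] := test01 (ratr q) n y.
Qed.

End nonnegative_measures.

(** * The random path and its past *)

Section path_map.
Variables (R : realType) (k : R -> R -> R.-pker (\bar R) ~> (\bar R)).
Hypothesis bk : branching_kernels k.
Variables (s : R) (s0 : (0 <= s)%R).
Context d (U : measurableType d) (P : probability U R).
Variable Z : rat -> U -> \bar R.
Hypothesis mZ : forall q, measurable_fun setT (Z q).
Hypothesis Z0 : forall q u, 0 <= Z q u.
Hypothesis ZM : forall q q' C B, (0 <= q)%R -> (q <= q')%R ->
  <<s past_gen Z q >> C -> measurable B ->
  P (C `&` Z q' @^-1` B) =
  \int[P]_(u in C) k (rtime s q) (rtime s q') (Z q u) B.
Variables (N : set U) (mN : measurable N) (PN : P N = 0).
Hypothesis regN : forall u, ~ N u -> regular_path k s (Z ^~ u).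
Local Notation tm := (rtime s).

(** On the exceptional set [N] the path is the constant 0, so that the map has values in the path
    space everywhere. *)
Definition path_map (u : U) : Dpath R := if pselect (N u) is right nNu then
  MkDpath (rat_extension_Dpath bk s0 (fun q _ => Z0 q u) (regN nNu))
  else MkDpath (@is_Dpath0 R).

Lemma path_map_good u t : ~ N u -> (s <= t)%R ->
  Xc t (path_map u) = rat_extension s (Z ^~ u) t.
Proof. by rewrite /path_map; case: pselect => // nN _ st; rewrite /Xc /= (max_r st). Qed.

Lemma path_map_bad u : N u -> path_map u = MkDpath (@is_Dpath0 R).
Proof. by rewrite /path_map; case: pselect. Qed.

Lemma path_map_cvg u t : ~ N u -> (s <= t)%R ->
  Z q u @[q --> rat_near s t^'+] --> Xc t (path_map u).
Proof.
move=> nN st; rewrite path_map_good//.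
exact: (rat_extension_right bk s0 (fun q _ => Z0 q u) (regN nN)).
Qed.

Lemma path_map_ge0 u t : (s <= t)%R -> 0 <= Xc t (path_map u).
Proof.
move=> st; have [Nu|nN] := pselect (N u); first by rewrite path_map_bad.
by rewrite path_map_good//; exact: (rat_extension_ge0 bk s0 (fun q _ => Z0 q u) (regN nN)).
Qed.

(* The sets whose preimages are determined, up to [N], by the skeleton
   immediately after time [t]. *)
Definition past_sets (t : R) : set_system (Dpath R) :=
  [set A | forall q, (t < tm q)%R -> exists2 C, <<s past_gen Z q >> C &
    forall u, ~ N u -> A (path_map u) <-> C u].

Lemma past_sets_sigma t : sigma_algebra setT (past_sets t).
Proof.
split.
- by move=> q _; exists set0 => //; exact: sigma_algebra0.
- move=> A HA q /HA[C sC AC]; exists (~` C).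
    by have [_ + _] := smallest_sigma_algebra setT (past_gen Z q) => /(_ _ sC); rewrite setTD.
  by move=> u /AC[h1 h2]; rewrite setTD; split; exact: contra_not.
- move=> A HA q tq; have {}HA n := cid2 (HA n q tq).
  exists (\bigcup_n (projT1 (HA n))).
    have [_ _] := smallest_sigma_algebra setT (past_gen Z q); apply => n.
    by case: (HA n).
  move=> u nN; split => -[n _ h]; exists n => //; move: h; case: (HA n) => /= C _ AC.
    exact: (AC _ nN).1.
  exact: (AC _ nN).2.
Qed.

(** The right limit at [r] exceeds [c] exactly when, for some rational [c' > c] and some rational
    time [q0] after [r], all [Z q1] with [q1] strictly between exceed [c']. The times [q0] may be
    taken up to [q], and only countably many events are involved. *)
Let eray_past (r t c : R) : (s <= r)%R -> (r <= t)%R ->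
  past_sets t (Xc r @^-1` eray c).
Proof.
move=> sr rt q tq; have rq : (r < tm q)%R by exact: le_lt_trans tq.
pose V := g_sigma_algebraType (past_gen Z q).
pose E (i : rat * rat) (q1 : rat) : set V :=
  if (r < tm q1 < tm i.2)%R then Z q1 @^-1` eray (ratr i.1) else setT.
pose C : set V := \bigcup_(i : rat * rat)
  (if (c < ratr i.1)%R && (r < tm i.2 <= tm q)%R then ~` (\bigcup_q1 ~` (E i q1)) else set0).
exists C.
  apply: (@countable_bigcupT_measurable _ V) => // i.
  case: ifP => [/andP[_ /andP[ri iq]]|_]; last exact: measurable0.
  apply: measurableC; apply: (@countable_bigcupT_measurable _ V) => // q1.
  apply: measurableC; rewrite /E; case: ifP => [/andP[rq1 q1i]|_]; last exact: measurableT.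
  apply: sub_sigma_algebra; exists q1; split.
    rewrite -(rtime_ge s) (le_trans sr (ltW rq1)) /= -(rtime_le s).
    exact: le_trans (ltW q1i) iq.
  by exists (eray (ratr i.1)); split => //; exact: measurable_eray.
move=> u nN; have zY := path_map_cvg nN sr; split.
- rewrite /= /eray /= => /gte_EFin_dense[c1 c1Y cc1].
  have [c' /[!in_itv]/= /andP[cc' c'c1]] := rat_in_itvoo cc1.
  have : \forall q1 \near rat_near s r^'+, (ratr c')%:E < Z q1 u.
    have [H _] := (ecvgP _ _).1 zY; apply: H; apply: le_lt_trans c1Y.
    by rewrite lee_fin ltW.
  move=> /near_right_delta[e e0 H].
  have [|q0 /andP[rq0 q0e]] := @rtime_dense _ s r (Num.min (r + e) (tm q))%R.
    by rewrite lt_min rq ltrDl e0.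
  move: q0e; rewrite lt_min => /andP[q0e q0q].
  exists (c', q0) => //=; rewrite cc' rq0 (ltW q0q) /= => -[q1 _]; apply.
  rewrite /E /=; case: ifP => // /andP[rq1 q1q0]; apply: (H (tm q1)) => //.
  by rewrite rq1 (lt_trans q1q0).
- move=> -[[c' q0] _] /=; case: ifP => // /andP[cc' /andP[rq0 q0q]] H.
  rewrite /eray /=; apply: (@lt_le_trans _ _ (ratr c')%:E); first by rewrite lte_fin.
  apply: (cvge_to_ge zY); apply/near_right_delta; exists (tm q0 - r)%R.
    by rewrite subr_gt0.
  move=> x rx q1 q1x; apply: contrapT => nc; apply: H; exists q1 => //.
  rewrite /E /= q1x; move: rx; rewrite addrC subrK => -> /=.
  by rewrite /eray/= => h; apply: nc; exact: ltW.
Qed.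

Lemma past_sets_coord r t B : (s <= r)%R -> (r <= t)%R -> measurable B ->
  past_sets t (Xc r @^-1` B).
Proof.
move=> sr rt mB.
have : measurable_fun (setT : set (g_sigma_algebraType (past_sets t))) (Xc r).
  apply: measurable_fun_eray => q; apply: sub_sigma_algebra; exact: eray_past.
move=> /(_ measurableT B mB); rewrite setTI /measurable /=.
by rewrite (sigma_algebra_id (past_sets_sigma t)).
Qed.

Lemma past_sets_G t : (s <= t)%R -> G_ `[s, t]%classic `<=` past_sets t.
Proof.
move=> st; apply: smallest_sub; first exact: past_sets_sigma.
move=> _ [r [+ [B [mB ->]]]]; rewrite /= in_itv /= => /andP[sr rt].
exact: past_sets_coord.
Qed.

Lemma past_sets_measurable t A : past_sets t A -> measurable (path_map @^-1` A).
Proof.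
have [n tn] := exists_horizon s t => /(_ _ tn)[C sC AC].
rewrite (_ : path_map @^-1` A = (C `\` N) `|`
    (if pselect (A (MkDpath (@is_Dpath0 R))) then N else set0)).
  apply: measurableU; last by case: ifP.
  by apply: measurableD => //; exact: past_measurable mZ sC.
apply/seteqP; split => u /=.
- have [Nu|nN Au] := pselect (N u); last by left; split => //; exact/AC.
  by rewrite path_map_bad// => A0; right; case: pselect.
- move=> [[/AC + nN]|]; first exact.
  by case: pselect => //= A0 Nu; rewrite path_map_bad.
Qed.

Lemma measurable_path_map : measurable_fun setT (path_map : U -> Omega s).
Proof.
apply: (@measurability _ _ _ (Omega s) _ _ (Ggen `[s, +oo[%classic)) => //.
move=> _ [_ [r [+ [B [mB ->]]]] <-]; rewrite /= in_itv /= andbT setTI => sr.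
exact: (past_sets_measurable (past_sets_coord sr (lexx r) mB)).
Qed.

End path_map.

Lemma exists_right_times (R : realType) (s t u : R) : (t <= u)%R ->
  exists q q' : nat -> rat, [/\ forall m, (t < rtime s (q m))%R,
    forall m, (q m <= q' m)%R, q @ \oo --> rat_near s t^'+ &
    q' @ \oo --> rat_near s u^'+].
Proof.
move=> tu; have h0 m : (0 < m.+1%:R^-1 :> R)%R by rewrite invr_gt0.
have /choice[q qq] : forall m, exists q, (t < rtime s q < t + m.+1%:R^-1)%R.
  by move=> m; apply: rtime_dense; rewrite ltrDl.
have qt m : (t < rtime s (q m))%R by case/andP: (qq m).
have qt' m : (rtime s (q m) < t + m.+1%:R^-1)%R by case/andP: (qq m).
(* Shifting [u] by the distance from [t] to the time of [q m] ensures [q m <= q' m] even when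
   [t = u], and keeps [q' m] strictly after [u]. *)
have /choice[q' qq'] : forall m, exists q',
    (u + (rtime s (q m) - t) < rtime s q' < u + m.+1%:R^-1)%R.
  by move=> m; apply: rtime_dense; rewrite ltrD2l ltrBlDl.
have qu m : (u + (rtime s (q m) - t) < rtime s (q' m))%R by case/andP: (qq' m).
have qu' m : (rtime s (q' m) < u + m.+1%:R^-1)%R by case/andP: (qq' m).
have small (e : R) : (0 < e)%R -> \forall m \near \oo, (m.+1%:R^-1 < e)%R.
  move=> e0; have /cvgrPdist_lt/(_ _ e0) h := @cvg_harmonic R.
  near=> m; have : (`|0 - harmonic m| < e)%R by near: m.
  by rewrite sub0r normrN ger0_norm ?harmonic_ge0.
exists q, q'; split => //.
- by move=> m; rewrite -(rtime_le s); have := qu m; have := qt m; lra.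
- move=> A /near_right_delta[e e0 H]; have := small _ e0.
  rewrite nearE; apply: filterS => m me; apply: (H _ _ _ erefl).
  by rewrite qt /= (lt_trans (qt' m))// ltrD2l.
- move=> A /near_right_delta[e e0 H]; have := small _ e0.
  rewrite nearE; apply: filterS => m me; apply: (H _ _ _ erefl).
  rewrite (lt_trans (qu' m)) ?ltrD2l// andbT (lt_trans _ (qu m))//.
  by rewrite ltrDl subr_gt0.
Unshelve. all: by end_near. Qed.

Section path_law.
Variables (R : realType) (k : R -> R -> R.-pker (\bar R) ~> (\bar R)).
Hypothesis bk : branching_kernels k.
Variables (s : R) (s0 : (0 <= s)%R).
Context d (U : measurableType d) (P : probability U R).
Variable Z : rat -> U -> \bar R.
Hypothesis mZ : forall q, measurable_fun setT (Z q).
Hypothesis Z0 : forall q u, 0 <= Z q u.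
Hypothesis ZM : forall q q' C B, (0 <= q)%R -> (q <= q')%R ->
  <<s past_gen Z q >> C -> measurable B ->
  P (C `&` Z q' @^-1` B) =
  \int[P]_(u in C) k (rtime s q) (rtime s q') (Z q u) B.
Variables (N : set U) (mN : measurable N) (PN : P N = 0).
Hypothesis regN : forall u, ~ N u -> regular_path k s (Z ^~ u).
Local Notation tm := (rtime s).
Local Notation Psi := (path_map bk s0 Z0 regN).

Let Poo : P setT < +oo. Proof. by rewrite probability_setT ltry. Qed.

Let time_cvg t (q : nat -> rat) : q @ \oo --> rat_near s t^'+ -> tm \o q @ \oo --> t.
Proof.
move=> qt; apply: (cvg_comp _ _ qt).
apply: cvg_trans; first exact: rat_near_time.
exact: cvg_within.
Qed.

Let mcoord t : (s <= t)%R -> measurable_fun setT (fun u => Xc t (Psi u)).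
Proof.
move=> st _ B mB; rewrite setTI.
exact: (past_sets_measurable mZ mN (past_sets_coord bk s0 Z0 regN st (lexx t) mB)).
Qed.

Lemma bounded_integral_diff (f : U -> R) D : bounded_measurable f -> measurable D ->
  \int[P]_(u in D) (f u)%:E = \int[P]_(u in D `\` N) (f u)%:E.
Proof.
move=> bf mD; apply: negligible_integral => //.
apply: (integrableS measurableT) => //.
exact: bounded_measurable_integrable.
Qed.

Lemma bounded_measurable_comp (g : \bar R -> R) (f : U -> \bar R) :
  bounded_measurable g -> measurable_fun setT f -> bounded_measurable (g \o f).
Proof.
by move=> [mg [M gM]] mf; split; [exact: measurableT_comp|exists M => u; exact: gM].
Qed.

(** Up to [N], the event [A] lies in the past of [Z] at each rational time after [t], so the Markov
    property of [Z] applies between [q m] and [q' m]. As these decrease to [t] and [v], the left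
    side converges by continuity of [g], the right side by the Feller property jointly in times and
    state. *)
Lemma path_map_transition t v A (g : \bar R -> R) : (s <= t)%R -> (t <= v)%R ->
  past_sets bk s0 Z0 regN t A ->
  bounded_measurable g -> continuous g -> (forall y, 0 <= g y)%R ->
  \int[P]_(u in Psi @^-1` A) (g (Xc v (Psi u)))%:E =
  \int[P]_(u in Psi @^-1` A) (kexp k g t v (Xc t (Psi u)))%:E.
Proof.
move=> st tv pA bg cg g0; have sv := le_trans st tv.
have t0 := le_trans s0 st.
have mA := past_sets_measurable mZ mN pA.
have [q [q' [qt qq' qc q'c]]] := exists_right_times s tv.
have bk' : bounded_measurable (kexp k g t v) by exact: kexp_bounded.
rewrite (bounded_integral_diff (bounded_measurable_comp bg (mcoord sv)))//.
rewrite (bounded_integral_diff (bounded_measurable_comp bk' (mcoord st)))//.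
have mD := measurableD mA mN.
have [mg [M gM]] := bg.
have H1 : \int[P]_(u in Psi @^-1` A `\` N) (g (Z (q' m) u))%:E @[m --> \oo] -->
    \int[P]_(u in Psi @^-1` A `\` N) (g (Xc v (Psi u)))%:E.
  apply: (@bounded_cvg_integral _ _ _ _ _ _ _ M) => //.
  - by move=> m; apply: measurable_funTS; exact: measurableT_comp.
  - by apply: measurable_funTS; apply: measurableT_comp => //; exact: mcoord.
  - move=> u [_ nN]; have h : Z (q' m) u @[m --> \oo] --> Xc v (Psi u).
      exact: (cvg_comp _ (Z ^~ u) q'c (path_map_cvg nN sv)).
    exact: (cvg_comp _ _ h (cg _)).
have H2 : \int[P]_(u in Psi @^-1` A `\` N)
      (kexp k g (tm (q m)) (tm (q' m)) (Z (q m) u))%:E @[m --> \oo] -->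
    \int[P]_(u in Psi @^-1` A `\` N) (kexp k g t v (Xc t (Psi u)))%:E.
  apply: (@bounded_cvg_integral _ _ _ _ _ _ _ M) => //.
  - move=> m; apply: measurable_funTS; apply: measurableT_comp => //.
    exact: measurable_kexp.
  - apply: measurable_funTS; apply: measurableT_comp; last exact: mcoord.
    exact: measurable_kexp.
  - move=> m u _; rewrite ger0_norm ?kexp_ge0// -[leRHS](kexp_cst k M (tm (q m)) (tm (q' m)) (Z (q m) u)).
    apply: kexp_le => //; first exact: bounded_measurable_cst.
    by move=> z; rewrite (le_trans (ler_norm _)).
  - move=> u [_ nN]; apply: (kexp_feller bk) => //.
    + apply: nearW => m; split; first by rewrite (le_trans t0)// ltW.
      by split => //; rewrite rtime_le.
    + exact: time_cvg.
    + exact: time_cvg.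
    + exact: (cvg_comp _ (Z ^~ u) qc (path_map_cvg nN st)).
    + exact: path_map_ge0.
apply: (cvg_unique (@ereal_hausdorff R) H1); apply: cvg_trans H2.
apply: near_eq_cvg; apply: nearW => m.
have qm0 : (0 <= q m)%R by rewrite -(rtime_ge s) (le_trans st)// ltW.
have [C sC AC] := pA _ (qt m).
have -> : Psi @^-1` A `\` N = C `\` N.
  by apply/seteqP; split => u [Au nN]; split => //; exact/(AC _ nN).
have mC := past_measurable mZ sC.
rewrite -(bounded_integral_diff (bounded_measurable_comp bg (mZ (q' m))))//.
have bkm := kexp_bounded k (tm (q m)) (tm (q' m)) bg.
rewrite -(bounded_integral_diff (bounded_measurable_comp bkm (mZ (q m))))//.
by rewrite /= (skeleton_kexp mZ ZM qm0 (qq' m) sC).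
Qed.

(** The right limit at [s] is compared with [Z 0] in law only: the mean of [g (Z (q m))] is that of
    [kexp] from [s] to [q m] at [Z 0], which tends to [g (Z 0)] as the interval shrinks. *)
Lemma path_map_start (g : \bar R -> R) :
  bounded_measurable g -> continuous g -> (forall y, 0 <= g y)%R ->
  \int[P]_u (g (Xc s (Psi u)))%:E = \int[P]_u (g (Z 0%R u))%:E.
Proof.
move=> bg cg g0; have ss := lexx s.
have tm0 : tm 0%R = s by rewrite /rtime rmorph0 addr0.
have [q [_ [qt _ qc _]]] := exists_right_times s ss.
rewrite (bounded_integral_diff (bounded_measurable_comp bg (mcoord ss)))//.
rewrite (bounded_integral_diff (bounded_measurable_comp bg (mZ 0%R)))//.
have mD := measurableD measurableT mN.
have [mg [M gM]] := bg.
have H1 : \int[P]_(u in setT `\` N) (g (Z (q m) u))%:E @[m --> \oo] -->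
    \int[P]_(u in setT `\` N) (g (Xc s (Psi u)))%:E.
  apply: (@bounded_cvg_integral _ _ _ _ _ _ _ M) => //.
  - by move=> m; apply: measurable_funTS; exact: measurableT_comp.
  - by apply: measurable_funTS; apply: measurableT_comp => //; exact: mcoord.
  - move=> u [_ nN]; have h : Z (q m) u @[m --> \oo] --> Xc s (Psi u).
      exact: (cvg_comp _ (Z ^~ u) qc (path_map_cvg nN ss)).
    exact: (cvg_comp _ _ h (cg _)).
have H2 : \int[P]_(u in setT `\` N)
      (kexp k g (tm 0%R) (tm (q m)) (Z 0%R u))%:E @[m --> \oo] -->
    \int[P]_(u in setT `\` N) (g (Z 0%R u))%:E.
  apply: (@bounded_cvg_integral _ _ _ _ _ _ _ M) => //.
  - move=> m; apply: measurable_funTS; apply: measurableT_comp => //.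
    exact: measurable_kexp.
  - by apply: measurable_funTS; apply: measurableT_comp.
  - move=> m u _; rewrite ger0_norm ?kexp_ge0// -[leRHS](kexp_cst k M (tm 0%R) (tm (q m)) (Z 0%R u)).
    apply: kexp_le => //; first exact: bounded_measurable_cst.
    by move=> z; rewrite (le_trans (ler_norm _)).
  - move=> u [_ nN]; rewrite -(kexp_id bk s0 (Z0 0%R u) mg) tm0.
    apply: (kexp_feller bk) => //; last 3 first.
    + exact: cvg_cst.
    + exact: time_cvg.
    + exact: cvg_cst.
    by apply: nearW => m; split => //; split => //; rewrite ltW.
apply: (cvg_unique (@ereal_hausdorff R) H1); apply: cvg_trans H2.
apply: near_eq_cvg; apply: nearW => m.
have qm0 : (0 <= q m)%R by rewrite -(rtime_ge s) ltW.
rewrite -(bounded_integral_diff (bounded_measurable_comp bg (mZ (q m))))//.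
have bkm := kexp_bounded k (tm 0%R) (tm (q m)) bg.
rewrite -(bounded_integral_diff (bounded_measurable_comp bkm (mZ 0%R)))//.
rewrite /= (skeleton_kexp mZ ZM (lexx _) qm0)//.
exact: (@measurableT _ (g_sigma_algebraType (past_gen Z 0%R))).
Qed.

Let mneg : measurable [set y : \bar R | y < 0].
Proof. by rewrite -set_itvNyo; exact: emeasurable_itv. Qed.

Let coord_neg t D : (s <= t)%R ->
  P (D `&` (fun u => Xc t (Psi u)) @^-1` [set y | y < 0]) = 0.
Proof.
move=> st; rewrite (_ : _ `&` _ = set0) ?measure0//.
by apply/seteqP; split => u //= -[_]; rewrite ltNge path_map_ge0.
Qed.

(** As measures in [B] both sides are finite and do not charge negative points, so nonnegative
    continuous test functions suffice. *)
Lemma path_map_kernel t v A B : (s <= t)%R -> (t <= v)%R ->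
  past_sets bk s0 Z0 regN t A -> measurable B ->
  P (Psi @^-1` A `&` (fun u => Xc v (Psi u)) @^-1` B) =
  \int[P]_(u in Psi @^-1` A) k t v (Xc t (Psi u)) B.
Proof.
move=> st tv pA mB; have sv := le_trans st tv.
have mA := past_sets_measurable mZ mN pA.
have t0 := le_trans s0 st.
rewrite -(transition_lawE P mA (k t v) (mcoord st) mB).
rewrite -(mrestricted_lawE P mA (mcoord sv) B).
apply: (@nonneg_measure_ext _ (mrestricted_law P mA (mcoord sv))
  (transition_law P mA (k t v) (mcoord st))) => //.
- rewrite mrestricted_lawE; apply: le_lt_trans Poo; apply: le_measure; rewrite ?inE//.
  by apply: measurableI => //; exact: measurableT.
- have h := @sprobability_setT _ _ _ (transition_law P mA (k t v) (mcoord st)).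
  by apply: (le_lt_trans h); exact: ltry.
- by rewrite [LHS]mrestricted_lawE; exact: coord_neg.
- rewrite [LHS]transition_lawE//; apply: integral0_eq => u _.
  by rewrite (kernel_neg0 bk)// path_map_ge0.
- move=> g bg cg g0; have mg : measurable_fun setT (EFin \o g) by apply/measurable_EFinP; case: bg.
  have g0' y : 0 <= (EFin \o g) y by rewrite lee_fin.
  rewrite [LHS](ge0_integral_restricted_law P mA (mcoord sv) mg g0').
  rewrite [RHS](integral_transition_law P mA (k t v) (mcoord st) mg g0').
  rewrite [LHS](path_map_transition st tv pA bg cg g0).
  by apply: eq_integral => u _; rewrite kexpE.
Qed.

Lemma path_map_start_law B : measurable B ->
  P ((fun u => Xc s (Psi u)) @^-1` B) = P (Z 0%R @^-1` B).
Proof.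
move=> mB; rewrite -[X in P X = _]setTI -[X in _ = P X]setTI.
rewrite -(mrestricted_lawE P measurableT (mcoord (lexx s)) B).
rewrite -(mrestricted_lawE P measurableT (mZ 0%R) B).
apply: nonneg_measure_ext => //.
- by rewrite mrestricted_lawE setTI.
- by rewrite mrestricted_lawE setTI.
- by rewrite [LHS]mrestricted_lawE; exact: coord_neg.
- rewrite [LHS]mrestricted_lawE (_ : _ `&` _ = set0) ?measure0//.
  by apply/seteqP; split => u //= -[_]; rewrite ltNge Z0.
- move=> g bg cg g0; have mg : measurable_fun setT (EFin \o g) by apply/measurable_EFinP; case: bg.
  have g0' y : 0 <= (EFin \o g) y by rewrite lee_fin.
  rewrite [LHS]ge0_integral_restricted_law// [RHS]ge0_integral_restricted_law//.
  exact: path_map_start.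
Qed.

End path_law.

(** * Markov laws on the path space *)

Section markov_laws.
Variables (R : realType) (k : R -> R -> R.-pker (\bar R) ~> (\bar R)).

(** The Markov property for one starting point, tested on sets: this form is convenient for
    constructing and comparing laws, and yields conditional expectations of bounded functions by
    integration. *)
Definition markov_law (s : R) (x : \bar R) (Q : probability (Omega s) R) : Prop :=
  Q [set w : Omega s | Xc s w = x] = 1 /\
  forall t v A B, (s <= t)%R -> (t <= v)%R -> G_ `[s, t]%classic A -> measurable B ->
    Q (A `&` Xc v @^-1` B) = \int[Q]_(w in (A : set (Omega s))) k t v (Xc t w) B.

Lemma G_le (I J : set R) : I `<=` J -> G_ I `<=` G_ J.
Proof.
move=> IJ; apply: smallest_sub; first exact: smallest_sigma_algebra.
move=> _ [t [It [B [mB ->]]]]; apply: sub_sigma_algebra.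
by exists t; split; [exact: IJ|exists B].
Qed.

Lemma measurable_Xc (I : set R) t : I t ->
  measurable_fun (setT : set (g_sigma_algebraType (Ggen I))) (Xc t).
Proof.
move=> It _ B mB; rewrite setTI; apply: sub_sigma_algebra.
by exists t; split => //; exists B.
Qed.

Lemma measurable_Xc_Omega (s t : R) : (s <= t)%R ->
  measurable_fun (setT : set (Omega s)) (Xc t).
Proof. by move=> st; apply: measurable_Xc; rewrite /= in_itv /= st. Qed.

Lemma G_measurable (s t : R) (A : set (Omega s)) : G_ `[s, t]%classic A -> measurable A.
Proof. by apply: G_le => r; rewrite /= !in_itv /= andbT => /andP[]. Qed.

Lemma exists_markov_law (s : R) (x : \bar R) : branching_kernels k ->
  (0 <= s)%R -> 0 <= x -> exists Q : probability (Omega s) R, markov_law x Q.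
Proof.
move=> bk s0 x0.
have [P [Z [mZ Z0 Zx ZM]]] := exists_branching_skeleton bk s0 x0.
have [N [mN PN HN]] := skeleton_regular_path bk s0 mZ Z0 ZM.
have regN u : ~ N u -> regular_path k s (Z ^~ u).
  by move=> nN; apply: contrapT => h; apply: nN; exact: HN.
have mpath := measurable_path_map bk s0 mZ Z0 mN regN.
pose X : {mfun measurableTypeR R >-> Omega s} := mfun_Sub (mem_set mpath).
exists (distribution P X); split.
  have m1 : measurable [set x] by exact: emeasurable_set1.
  rewrite -Zx -(path_map_start_law bk s0 mZ Z0 ZM mN PN regN m1).
  by [].
move=> t v A B st tv GA mB; have pA := past_sets_G bk s0 Z0 regN st GA.
rewrite [RHS](ge0_integral_pushforward (phi := X))//.
- exact: (path_map_kernel mZ ZM mN PN st tv pA mB).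
- exact: G_measurable GA.
- apply: measurable_funTS; apply: (measurableT_comp (measurable_kernel _ _ mB)).
  exact: measurable_Xc_Omega.
Qed.

(** * Uniqueness from finite-dimensional distributions *)

Section uniqueness.
Variables (s : R) (x : \bar R) (Q Q' : probability (Omega s) R).
Hypotheses (HQ : markov_law x Q) (HQ' : markov_law x Q').

Implicit Types (l : seq (R * set (\bar R))).

(* A list of constraints [(t, B)], the latest time first. *)
Let cyl l : set (Omega s) := [set w | all (fun c => `[< c.2 (Xc c.1 w) >]) l].
Let ltm l : R := if l is c :: _ then c.1 else s.
Let admissible l := all (fun c => (s <= c.1)%R && `[< measurable c.2 >]) l.
Let later (c d : R * set (\bar R)) := (d.1 <= c.1)%R.

Let cyl_nil : cyl [::] = setT.
Proof. by apply/seteqP. Qed.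

Let cyl_cons c l : cyl (c :: l) = cyl l `&` Xc c.1 @^-1` c.2.
Proof.
apply/seteqP; split => w /=; first by move=> /andP[/asboolP ? ?].
by move=> [? ?]; apply/andP; split => //; exact/asboolP.
Qed.

Let ltm_ge l : admissible l -> (s <= ltm l)%R.
Proof. by case: l => //= c l /andP[/andP[]]. Qed.

Let ltm_cons c l : admissible (c :: l) -> sorted later (c :: l) -> (ltm l <= c.1)%R.
Proof. by case: l => [|d l]/= /andP[/andP[sc _] _] // /andP[]. Qed.

Let cyl_past l : admissible l -> sorted later l -> G_ `[s, ltm l]%classic (cyl l).
Proof.
elim: l => [|c l ih] al sl.
  by rewrite cyl_nil; exact: (@measurableT _ (g_sigma_algebraType (Ggen `[s, s]%classic))).
have lc := ltm_cons al sl.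
move: (al) => /= /andP[/andP[sc /asboolP mc] al'].
rewrite cyl_cons; apply: (@measurableI _ (g_sigma_algebraType (Ggen `[s, c.1]%classic))).
  apply: G_le (ih al' (path_sorted sl)) => r /=; rewrite !in_itv /= => /andP[-> rl].
  exact: le_trans lc.
by apply: sub_sigma_algebra; exists c.1; split;
  [rewrite /= in_itv /= sc lexx|exists c.2].
Qed.

Let start_law (P : probability (Omega s) R) : markov_law x P ->
  forall B, measurable B -> P (Xc s @^-1` B) = (\1_B x)%:E.
Proof.
move=> [Px _] B mB; have mX := measurable_Xc_Omega (lexx s).
have m1 : measurable [set w : Omega s | Xc s w = x].
  by rewrite -[X in measurable X]setTI; exact: (mX measurableT _ (emeasurable_set1 x)).
have mXB : measurable (Xc s @^-1` B : set (Omega s)).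
  by rewrite -[X in measurable X]setTI; exact: mX.
rewrite indicE; have [xB|xB] := boolP (x \in B).
  apply/eqP; rewrite eq_le probability_le1//= -Px; apply: le_measure; rewrite ?inE//.
  by move=> w /= ->; rewrite inE in xB.
have : P (~` [set w : Omega s | Xc s w = x]) = 0.
  by rewrite probability_setC// Px subee.
move=> P0; apply/eqP; rewrite eq_le measure_ge0 andbT.
apply: (@le_trans _ _ (P (~` [set w : Omega s | Xc s w = x]))); last by rewrite P0.
apply: le_measure; rewrite ?inE//; first exact: measurableC.
by move=> w /= wB wx; move: xB; rewrite notin_setE -wx.
Qed.

(** The induction carries the law of the latest coordinate on the cylinder, not just the probability
    of the cylinder: the next constraint integrates a kernel against that law. *)
Let cyl_law l B : admissible l -> sorted later l -> measurable B ->
  Q (cyl l `&` Xc (ltm l) @^-1` B) = Q' (cyl l `&` Xc (ltm l) @^-1` B).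
Proof.
elim: l B => [|c l ih] B al sl mB.
  by rewrite cyl_nil !setTI (start_law HQ)// (start_law HQ').
have lc := ltm_cons al sl.
move: (al) => /= /andP[/andP[sc /asboolP mc] al'].
have sl' := path_sorted sl; have sl0 := ltm_ge al'.
have GC := cyl_past al' sl'.
have mC := G_measurable GC.
have mX := measurable_Xc_Omega sl0.
rewrite cyl_cons -setIA -preimage_setI.
have mI := measurableI _ _ mc mB.
have [_ M] := HQ; have [_ M'] := HQ'.
rewrite (M _ _ _ _ sl0 lc GC mI) (M' _ _ _ _ sl0 lc GC mI).
have mk := measurable_kernel (k (ltm l) c.1) _ mI.
have k0 y : 0 <= k (ltm l) c.1 y (c.2 `&` B) by exact: measure_ge0.
rewrite -(ge0_integral_restricted_law Q mC mX mk k0).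
rewrite -(ge0_integral_restricted_law Q' mC mX mk k0).
apply: eq_measure_integral => D mD _.
by rewrite [LHS]mrestricted_lawE [RHS]mrestricted_lawE; exact: ih.
Qed.

Lemma markov_law_unique (A : set (Omega s)) : measurable A -> Q A = Q' A.
Proof.
move=> mA; pose G : set_system (Omega s) :=
  [set C | exists l, [/\ admissible l, sorted later l & C = cyl l]].
have Qoo : Q setT < +oo by rewrite probability_setT ltry.
have later_total : total later by move=> c d; exact: le_total.
have GI : setI_closed G.
  move=> _ _ [l [al _ ->]] [l' [al' _ ->]]; exists (sort later (l ++ l')); split.
  - by rewrite /admissible all_sort all_cat; apply/andP.
  - exact: sort_sorted.
  - apply/seteqP; split => w; rewrite /cyl /= all_sort all_cat.
      by move=> [-> ->].
    by move=> /andP[].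
apply: (@finite_measure_ext _ _ _ G Q Q').
- by move=> _ [l [al sl ->]]; exact: G_measurable (cyl_past al sl).
- exact: GI.
- by exists [::]; split => //; rewrite cyl_nil.
- move=> _ [l [al sl ->]].
  by have := cyl_law al sl measurableT; rewrite preimage_setT !setIT.
- exact: Qoo.
- apply: (smallest_sub _ _ mA); first exact: smallest_sigma_algebra.
  move=> _ [t [+ [B [mB ->]]]]; rewrite /= in_itv /= andbT => st.
  apply: sub_sigma_algebra; exists [:: (t, B)]; split => //=.
    by rewrite andbT st; exact/asboolP.
  by rewrite cyl_cons cyl_nil setTI.
Qed.

End uniqueness.
End markov_laws.

(** * Markov laws and conditional expectations *)

Section markov_families.
Variables (R : realType) (k : R -> R -> R.-pker (\bar R) ~> (\bar R)).

Lemma markov_law_cond_exp (s t v : R) (x : \bar R) (Q : probability (Omega s) R)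
    (f : \bar R -> R) : markov_law k x Q -> (s <= t)%R -> (t <= v)%R ->
  bounded_measurable f ->
  is_cond_exp `[s, t]%classic Q (fun w => (f (Xc v w))%:E)
    (fun w => \int[k t v (Xc t w)]_y (f y)%:E).
Proof.
move=> [_ MQ] st tv bf; have sv := le_trans st tv.
rewrite (_ : (fun w => \int[_]__ _) = fun w => (kexp k f t v (Xc t w))%:E); last first.
  by apply/funext => w; rewrite kexpE.
have bk := kexp_bounded k t v bf.
split=> [|A GA].
  apply/measurable_EFinP; apply: (measurableT_comp bk.1).
  by apply: measurable_Xc; rewrite /= in_itv /= st lexx.
have mA := G_measurable GA.
(* Adding the bound [M] makes [f] nonnegative, as the passage from sets to functions requires; the
   factor 1 fits the affine form of [kexp_affine]. *)
have [mf [M fM]] := bf; pose h y := (M + 1 * f y)%R.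
have bh : bounded_measurable h by exact: bounded_measurable_affine.
have h0 y : (0 <= h y)%R by have := fM y; rewrite ler_norml /h => /andP[]; lra.
have split_h (g : Omega s -> R) : bounded_measurable g ->
    \int[Q]_(w in A) (M + 1 * g w)%:E = \int[Q]_(w in A) M%:E + \int[Q]_(w in A) (g w)%:E.
  move=> bg; under eq_integral do rewrite mul1r EFinD.
  have Qoo : Q setT < +oo by rewrite probability_setT ltry.
  apply: integralD => //; apply: (integrableS measurableT) => //.
    have : bounded_measurable (fun _ : Omega s => M) by split => //; exists `|M|%R.
    exact: bounded_measurable_integrable.
  exact: bounded_measurable_integrable.
have mX := measurable_Xc_Omega st; have mXv := measurable_Xc_Omega sv.
have bX (g : \bar R -> R) r : bounded_measurable g -> (s <= r)%R ->
    bounded_measurable (fun w : Omega s => g (Xc r w)).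
  move=> [mg [K gK]] sr; split; last by exists K => w; exact: gK.
  by apply: measurableT_comp mg _; exact: measurable_Xc_Omega.
have H : \int[Q]_(w in (A : set (Omega s))) (h (Xc v w))%:E =
    \int[Q]_(w in (A : set (Omega s))) (M + 1 * kexp k f t v (Xc t w))%:E.
  rewrite (@integral_transition _ _ _ Q A mA (k t v) (Xc t) mX (Xc v) (EFin \o h) mXv).
  - by apply: eq_integral => w _; rewrite kexpE// /h kexp_affine.
  - by move=> B mB; exact: MQ.
  - by apply/measurable_EFinP; case: bh.
  - by move=> y; rewrite lee_fin.
move: H; rewrite /h !split_h; last 2 first.
- exact: bX.
- exact: bX.
(* The added constant contributes the same finite amount to both sides and cancels. *)
set c := \int[Q]_(w in _) M%:E; have cfin : c \is a fin_num.
  by rewrite /c integral_cst//= fin_numM//; exact: fin_num_measure.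
by move=> /(congr1 (fun z => z - c)); rewrite ![c + _]addeC !addeK.
Qed.

Lemma markov_family_law (Q : forall s : R, \bar R -> probability (Omega s) R)
    (s : R) (x : \bar R) : markov_family k Q -> (0 <= s)%R -> 0 <= x ->
  markov_law k x (Q s x).
Proof.
move=> [_ _ Q1 QM] s0 x0; split; first exact: Q1.
move=> t v A B st tv GA mB.
have mA := G_measurable GA.
have [||_ /(_ A GA)] := QM s t v x (\1_B) s0 st tv x0.
- exact: measurable_indic.
- by exists 1%R => y; rewrite indicE; case: (_ \in _); rewrite ?normr1 ?normr0.
rewrite (_ : (fun w => (\1_B (Xc v w))%:E) = fun w : Omega s => (\1_(Xc v @^-1` B) w)%:E)//.
have mXB : measurable (Xc v @^-1` B : set (Omega s)).
  rewrite -[X in measurable X]setTI; apply: (measurable_Xc_Omega (le_trans st tv)) => //.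
rewrite integral_indic// setIC => ->.
by apply: eq_integral => w _; rewrite integral_indic// setIT.
Qed.

End markov_families.

Theorem mainTheorem2 (R : realType)
    (k : R -> R -> R.-pker (\bar R) ~> (\bar R)) :
  branching_kernels k ->
  exists Q : forall s : R, \bar R -> probability (Omega s) R,
    markov_family k Q /\
    forall Q' : forall s : R, \bar R -> probability (Omega s) R,
      markov_family k Q' ->
      forall (s : R) (x : \bar R), (0 <= s)%R -> 0 <= x ->
        forall A : set (Omega s), measurable A -> Q' s x A = Q s x A.
Proof.
move=> bk.
(* The family is a function of all [s] and [x]; for negative [s] or [x] it takes the Dirac mass at
   the default path. *)
have HQ s x : {Q : probability (Omega s) R | (0 <= s)%R -> 0 <= x -> markov_law k x Q}.
  apply: cid; have [s0|s0] := pselect (0 <= s)%R; last first.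
    by exists (dirac (point : Omega s)).
  have [x0|x0] := pselect (0 <= x); last by exists (dirac (point : Omega s)).
  by have [Q HQ] := exists_markov_law bk s0 x0; exists Q.
pose Q s x := sval (HQ s x).
have QM s x : (0 <= s)%R -> 0 <= x -> markov_law k x (Q s x) by exact: (svalP (HQ s x)).
exists Q; split.
  split.
  - by move=> I J _ _; exact: G_le.
  - by move=> I t _ It; exact: measurable_Xc.
  - by move=> s x s0 x0; case: (QM s x s0 x0).
  - move=> s t u x f s0 st tu x0 mf bf.
    exact: (markov_law_cond_exp (QM s x s0 x0) st tu).
move=> Q' MQ' s x s0 x0 A mA.
exact: (markov_law_unique (markov_family_law MQ' s0 x0) (QM s x s0 x0)).
Qed.
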